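(* Let $Y_n=\frac{R_n-\mu(n)}{\mu(n)}$. If $\pi$ is regular with index $\gamma\in(0,1)$, then $\{Y_n\}_{n\ge 1}$ satisfies the following large deviation principle: for every measurable set $B\subset\mathbb{R}$, $$-\inf_{x\in B^o}\Lambda^*_\gamma(x)\le\liminf_{n\to\infty}\frac{1}{\mu(n)}\log\mathbb{P}(Y_n\in B)\le\limsup_{n\to\infty}\frac{1}{\mu(n)}\log\mathbb{P}(Y_n\in B)\le-\inf_{x\in\bar B}\Lambda^*_\gamma(x),$$ where $\Lambda^*_\gamma(x)=\sup_{\lambda\in\mathbb{R}}\{\lambda x-\Lambda_\gamma(\lambda)\}$ is the Fenchel–Legendre transform of the smooth function $\Lambda_\gamma:\mathbb{R}\to\mathbb{R}$ given by $$\Lambda_\gamma(\lambda)=-\lambda+\frac{\gamma}{\Gamma(1-\gamma)}\int_0^\infty\log\bigl[1+(e^\lambda-1)(1-e^{-s})\bigr]\,\frac{ds}{s^{1+\gamma}}.$$ Moreover, for $\lambda<\log 2$, the function $\Lambda_\gamma$ has the explicit expansion $$\Lambda_\gamma(\lambda)=-\lambda+\sum_{n=1}^\infty(1-e^\lambda)^n\sum_{k=1}^n\frac{(-1)^k}{k^{1-\gamma}}\binom{n-1}{k-1}.$$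
   Context: Let $\pi=(\pi_i)_{i\ge 1}$ be a probability measure on $\mathbb{N}=\{1,2,\dots\}$ with $\pi_i\ge \pi_{i+1}>0$ for all $i\ge 1$. Let $\{\xi_n\}_{n\ge 1}$ be i.i.d. random variables with common law $\pi$, and let $R_n:=\#\{\xi_k:1\le k\le n\}$. For $t\ge 0$ put $\mu(t):=\sum_{i=1}^\infty[1-e^{-t\pi_i}]$. A strictly increasing function $\zeta:[0,\infty)\to[0,\infty)$ is called $\gamma$-regular ($\gamma\in[0,1]$) if $\lim_{x\to\infty}\zeta(\lambda x)/\zeta(x)=\lambda^\gamma$ for every $\lambda>0$. For $\gamma\in(0,1)$, $\pi$ is called $\gamma$-regular (regular with index $\gamma$) if there is a $\gamma$-regular function $\zeta$ with $\lim_{n\to\infty}\pi_n\cdot\zeta^{-1}(n)=1$, where $\zeta^{-1}$ is the inverse function of $\zeta$. $\Gamma(\cdot)$ is the Euler Gamma function. $B^o$ and $\bar B$ denote the interior and the closure of $B$ in $\mathbb{R}$. Conventions: $\inf\emptyset=+\infty$, $\log 0=-\infty$. *)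

(* Defs.v *)
From HB Require Import structures.
From mathcomp Require Import all_boot all_order all_algebra finmap.
From mathcomp Require Import all_classical all_reals all_analysis.

Set Implicit Arguments.
Unset Strict Implicit.
Unset Printing Implicit Defensive.

Import Order.TTheory GRing.Theory Num.Theory.
Import numFieldNormedType.Exports.

Local Open Scope classical_set_scope.
Local Open Scope ring_scope.

(* The set {1, 2, ...} is embedded in [nat]: probability measures on it are
   probability measures on [nat] that do not charge 0. *)

Definition mass (R : realType) (p : probability nat R) (i : nat) : R :=
  fine (p [set i]).

Definition decreasing_law (R : realType) (p : probability nat R) : Prop :=
  p [set 0%N] = 0%E /\
  forall i, (0 < i)%N -> 0 < mass p i.+1 <= mass p i.

(* Mutual independence of the subfamily of X indexed by D. *)
Definition independent_RVs d d' (Omega : measurableType d)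
    (T : measurableType d') (R : realType) (P : probability Omega R)
    (I : choiceType) (D : set I) (X : I -> {RV P >-> T}) : Prop :=
  forall (J : {fset I}) (A : I -> set T),
    [set` J] `<=` D -> (forall i, measurable (A i)) ->
    P (\bigcap_(i in [set` J]) (X i @^-1` A i)) =
    (\prod_(i <- J) P (X i @^-1` A i))%E.

(* [(X k)_(k >= 1)] is i.i.d. with law [p]; [X 0] is irrelevant. *)
Definition iid_with_law d (Omega : measurableType d) (R : realType)
    (P : probability Omega R) (X : nat -> {RV P >-> nat})
    (p : probability nat R) : Prop :=
  independent_RVs [set k | (0 < k)%N] X /\
  forall k, (0 < k)%N ->
    forall A : set nat, distribution P (X k) A = p A.

Definition range_size d (Omega : measurableType d) (R : realType)
    (P : probability Omega R) (X : nat -> {RV P >-> nat})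
    (n : nat) (w : Omega) : nat :=
  size (undup [seq X k w | k <- iota 1 n]).

Definition mu (R : realType) (p : probability nat R) (t : R) : R :=
  \big[+%R/0]_(1 <= i <oo) (1 - expR (- (t * mass p i))).

Definition Y d (Omega : measurableType d) (R : realType)
    (P : probability Omega R) (X : nat -> {RV P >-> nat})
    (p : probability nat R) (n : nat) (w : Omega) : R :=
  ((range_size X n w)%:R - mu p n%:R) / mu p n%:R.

(* Functions from [0, +oo[ to [0, +oo[ are total functions on [R] of which only
   the values on [0, +oo[ matter. *)
Definition regular_function (R : realType) (gamma : R) (zeta : R -> R) : Prop :=
  [/\ forall x, 0 <= x -> 0 <= zeta x,
      forall x y, 0 <= x -> x < y -> zeta x < zeta y &
      forall l, 0 < l -> zeta (l * x) / zeta x @[x --> +oo] --> l `^ gamma].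

(* A strictly increasing [zeta] need not be continuous, so that its range may
   have gaps. Monotonicity leaves a single possible value of [zeta_inv] at each
   point of a gap due to a jump, and at points of the range [zeta_inv] is the
   ordinary inverse. *)
Definition inverse_function (R : realType) (zeta zeta_inv : R -> R) : Prop :=
  (forall x, 0 <= x -> zeta_inv (zeta x) = x) /\
  (forall x y, 0 <= x -> x <= y -> zeta_inv x <= zeta_inv y).

Definition regular_law (R : realType) (gamma : R) (p : probability nat R)
    : Prop :=
  exists zeta zeta_inv : R -> R,
    [/\ regular_function gamma zeta,
        inverse_function zeta zeta_inv &
        mass p n * zeta_inv n%:R @[n --> \oo] --> (1 : R)].

(* Euler's integral, for [0 < a]. *)
Definition Gamma (R : realType) (a : R) : R :=
  \int[@lebesgue_measure R]_(t in `]0, +oo[) (t `^ (a - 1) * expR (- t)).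

Definition Lambda_integrand (R : realType) (gamma lambda s : R) : R :=
  ln (1 + (expR lambda - 1) * (1 - expR (- s))) / s `^ (1 + gamma).

Definition Lambda (R : realType) (gamma lambda : R) : R :=
  - lambda + gamma / Gamma (1 - gamma) *
    \int[@lebesgue_measure R]_(s in `]0, +oo[) Lambda_integrand gamma lambda s.

Definition smooth (R : realType) (f : R -> R) : Prop :=
  forall n x, derivable (f^`(n))%classic x 1.

Definition fenchel_legendre (R : realType) (f : R -> R) (x : R) : \bar R :=
  ereal_sup [set (lambda * x - f lambda)%:E | lambda in [set: R]].

(* Main.v *)
Require Import Defs.
From HB Require Import structures.
From mathcomp Require Import all_boot all_order all_algebra finmap.
From mathcomp Require Import ring lra.
From mathcomp Require Import all_classical all_reals all_analysis.
From mathcomp Require Import measurable_realfun lebesgue_integral_under.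

(** Put [w i = mass p i], [q = 1 - e^(-s)] and, for a slope [l],
    [h(s) = ln (1 + (e^l - 1) q)].

    The principle is the theorem of Gartner and Ellis ([ldp_upper],
    [ldp_lower]) for [Y] at speed [mu p n]. It rests on the limit
      [ln E[expR (l * R_n)] / mu p n --> Lambda gamma l + l],
    which is [ln_range_mgf_cvg], and on the shape of [L = Lambda gamma].

    The limit is reached through Poissonization. If the sample has a Poisson
    size of mean [t], the atoms are hit independently, the atom [i] with
    probability [1 - e^(-t w_i)], so that the cumulant generating function of
    the range is [S(t) = \sum_i h(t w_i)] ([occ_mgf_egf]). Such sums are found
    by an Abelian argument: the number of atoms of mass at least [x] is
    equivalent to [zeta (1 / x)] ([counting_cvg]), hence [S(t)] is equivalent to
    [zeta(t)] times the integral of [h'(s) s^(-gamma)] ([wsum_cvg_zeta]).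
    Applied to [h] and to [q], whose sum is [mu], and combined with an
    integration by parts ([ln_emix_parts]), this gives
    [S(c n) / mu p n --> c^gamma (L(l) + l)] ([cumulant_ratio]).

    To return from a Poisson size to the size [n], note that [E[expR (l * R_n)]]
    is monotone in [n], and that a Poisson variable of mean [(1 + e) n] lies on
    a prescribed side of [n] up to an error [((1 + e) e^(-e))^n]. This error is
    negligible although [mu p n = o(n)], because [S(n) = o(n)] as well
    ([wsum_sublinear], [ln_le_poisson], [ln_ge_poisson]). Then [e] tends to 0.

    As for [L]: the derivative [r] of [h] in [l] satisfies [r' = r (1 - r)], so
    that all derivatives of [h] are polynomials in [r] without constant term, and
    [L] may be differentiated under the integral sign ([smooth_Lambda]). Its
    derivative maps the line onto [(-1, +oo)] ([derive1_Lambda_onto]): every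
    [x > -1] is an exposed point of the rate, while the rate is infinite below
    [-1] since [L(l) <= - l] for [l <= 0]. Finally [L >= 0] by Jensen's
    inequality, which reduces the upper bound to two half-lines. The series
    comes from the geometric expansion of [h'] in powers of [(1 - e^l) q]. *)

Set Implicit Arguments.
Unset Strict Implicit.
Unset Printing Implicit Defensive.

Import Order.TTheory GRing.Theory Num.Theory.
Import numFieldNormedType.Exports.

Local Open Scope classical_set_scope.
Local Open Scope ring_scope.

(** * A one-dimensional Gartner-Ellis theorem *)

Lemma limn_esup_le_near (R : realType) (u : (\bar R)^nat) (l : \bar R) :
  (\forall n \near \oo, (u n <= l)%E) -> (limn_esup u <= l)%E.
Proof.
move=> ul; apply: ge_ereal_inf; exists (ereal_sup (u @` [set n | (u n <= l)%E])).
  by exists [set n | (u n <= l)%E].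
by apply: ge_ereal_sup => _ [n /= + <-].
Qed.

Lemma limn_einf_ge_near (R : realType) (u : (\bar R)^nat) (l : \bar R) :
  (\forall n \near \oo, (l <= u n)%E) -> (l <= limn_einf u)%E.
Proof.
move=> lu; rewrite leeNr; apply: limn_esup_le_near.
by near do rewrite leeN2.
Unshelve. all: by end_near. Qed.

Lemma fenchel_legendre_ge (R : realType) (f : R -> R) (x l : R) :
  ((l * x - f l)%:E <= fenchel_legendre f x)%E.
Proof. by apply: ereal_sup_ubound; exists l. Qed.

Lemma le_ereal_lt_real (R : realType) (x y : \bar R) :
  (forall r : R, (r%:E < x -> r%:E <= y)%E) -> (x <= y)%E.
Proof.
move: x => [x| |] H; last by rewrite leNye.
- apply/lee_subgt0Pr => e e0; rewrite -EFinB; apply: H.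
  by rewrite lte_fin ltrBlDr ltrDl.
- by rewrite leye_eq; apply/eqP/eqyP => r _; apply: H; rewrite ltry.
Qed.

Lemma measurable_half_line (R : realType) (c s : R) :
  measurable [set z : R | c <= s * z].
Proof.
rewrite -[X in measurable X]setTI.
exact: (@measurable_fun_le _ _ _ setT (cst c) ( *%R s)).
Qed.

Section gartner_ellis.
Context (R : realType) (d : measure_display) (Omega : measurableType d)
  (P : probability Omega R).
Context (c : R) (Z : nat -> Omega -> R) (a : nat -> R) (M : nat -> R -> R) (L : R -> R).
Hypothesis mZ : forall n, measurable_fun setT (Z n).
Hypothesis ay : a n @[n --> \oo] --> +oo.
Hypothesis M_gt0 : forall n l, 0 < M n l.
Hypothesis intM : forall n l,
  (\int[P]_w (expR (l * a n * Z n w))%:E = (M n l)%:E)%E.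
Hypothesis cvgL : forall l, ln (M n l) / a n @[n --> \oo] --> L l.

Lemma mgf_near_le l e : 0 < e ->
  \forall n \near \oo, M n l <= expR (a n * (L l + e)).
Proof.
move=> e0; have /cvgrPdistC_le/(_ _ e0) Le := @cvgL l; near=> n.
have an0 : 0 < a n by near: n; exact: cvgry_gt.
rewrite -[leLHS]lnK ?posrE// ler_expR mulrC -ler_pdivrMr//.
rewrite -lerBlDl ler_normlW //.
by near: n.
Unshelve. all: by end_near. Qed.

Lemma mgf_near_ge l e : 0 < e ->
  \forall n \near \oo, expR (a n * (L l - e)) <= M n l.
Proof.
move=> e0; have /cvgrPdist_le/(_ _ e0) Le := @cvgL l; near=> n.
have an0 : 0 < a n by near: n; exact: cvgry_gt.
rewrite -[leRHS]lnK ?posrE// ler_expR mulrC -ler_pdivlMr//.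
rewrite lerBlDr -lerBlDl ler_normlW //.
by near: n.
Unshelve. all: by end_near. Qed.

Lemma measurable_Z_preimage n (B : set R) : measurable B -> measurable [set w | B (Z n w)].
Proof. by move=> mB; rewrite -[X in measurable X]setTI; exact: mZ. Qed.

Lemma measurable_exp_Z n (l k : R) :
  measurable_fun [set: Omega] (fun w => (expR (l * a n * Z n w + k))%:E).
Proof.
apply/measurable_EFinP; apply: measurableT_comp => //.
by apply: measurable_funD => //; exact: measurable_funM.
Qed.

Lemma integral_exp_shift n (l k : R) :
  (\int[P]_w (expR (l * a n * Z n w + k))%:E = (M n l * expR k)%:E)%E.
Proof.
under eq_integral => w _ do rewrite expRD mulrC EFinM.
rewrite ge0_integralZl_EFin ?expR_ge0//; first by rewrite intM -EFinM mulrC.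
by have := @measurable_exp_Z n l 0; under eq_fun do rewrite addr0.
Qed.

(** Markov's inequality for [expR (l * a n * Z n)]. A rate [v] strictly below
    [l * x - L l] leaves room for the error in [ln (M n l) / a n --> L l]. *)
Lemma chernoff_near l x v : v < l * x - L l ->
  \forall n \near \oo,
    (P [set w | (l * x <= l * Z n w)%R] <= (expR (- (a n * v)))%:E)%E.
Proof.
move=> vx; have e0 : 0 < l * x - L l - v by rewrite subr_gt0.
near=> n.
have an0 : 0 < a n by near: n; exact: cvgry_gt.
set A := [set w | _].
have mA : measurable A.
  apply: (@measurable_Z_preimage n [set z | l * x <= l * z]).
  exact: measurable_half_line.
rewrite -[A]setIT -integral_indic//.
apply: (@le_trans _ _ (\int[P]_w (expR (l * a n * Z n w - l * a n * x))%:E)%E).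
  apply: ge0_le_integral => //.
  - exact/measurable_EFinP/measurable_indic.
  - exact: measurable_exp_Z.
  - move=> w _; rewrite lee_fin indicE.
    have [/set_mem Aw|_] := boolP (w \in A); last exact: expR_ge0.
    rewrite -expR0 ler_expR subr_ge0.
    by rewrite -!mulrA ![a n * _]mulrC !mulrA ler_wpM2r // ltW.
rewrite integral_exp_shift lee_fin.
have Mle : M n l <= expR (a n * (L l + (l * x - L l - v))).
  by near: n; exact: (@mgf_near_le l _ e0).
rewrite (le_trans (ler_wpM2r (expR_ge0 _) Mle))// -expRD ler_expR.
rewrite [leLHS](_ : _ = - (a n * v))//; ring.
Unshelve. all: by end_near. Qed.

Hypothesis L_ge0 : forall l, 0 <= L l.
Hypothesis L0 : L 0 = 0.

Lemma fenchel_legendre_ge0 x : (0 <= fenchel_legendre L x)%E.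
Proof. by have := fenchel_legendre_ge L x 0; rewrite mul0r L0 subr0. Qed.

Lemma le0_lne_prob n (B : set Omega) : measurable B -> 0 <= a n ->
  ((a n)^-1%:E * lne (P B) <= 0)%E.
Proof.
move=> mB an0; apply: mule_ge0_le0; first by rewrite lee_fin invr_ge0.
by rewrite lne_le0 probability_le1.
Qed.

Lemma measurable_half_line_preimage n (B : set R) s : measurable B ->
  measurable [set w | B (Z n w) /\ 0 <= s * Z n w].
Proof.
move=> mB; apply: (@measurable_Z_preimage n [set z | B z /\ 0 <= s * z]).
by apply: measurableI => //; exact: measurable_half_line.
Qed.

(** The sign [s] selects a half-line. The part of [B] in it lies beyond a
    point [b] of the closure of [B], the nearest one to 0, so that a single
    Chernoff bound at [b] covers it. As [L >= 0], a slope [l] with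
    [l * b - L l > v >= 0] has the sign of [s]. *)
Lemma half_line_near (s : R) (B : set R) (v : R) : (s == 1) || (s == -1) ->
  measurable B -> 0 <= v ->
  (v%:E < ereal_inf [set fenchel_legendre L x | x in closure B])%E ->
  \forall n \near \oo,
    (P [set w | (B (Z n w) /\ 0 <= s * Z n w)%R] <= (expR (- (a n * v)))%:E)%E.
Proof.
move=> s1 mB v0 vB.
have [s0 ss]: s != 0 /\ s * s = 1.
  by case/orP: s1 => /eqP ->; rewrite ?oppr_eq0 oner_neq0 ?mulrNN mulr1.
have mBs n := measurable_half_line_preimage n s mB.
pose C := [set s * z | z in B `&` [set z | 0 <= s * z]].
have [C0|] := pselect (C !=set0); last first.
  move=> C0; near=> n; rewrite [X in P X](_ : _ = set0) ?measure0//.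
  rewrite -subset0 => w [Bw sw]; apply: C0; exists (s * Z n w).
  by exists (Z n w).
have lC : lbound C 0 by move=> _ [z [_ /= ?] <-].
have hC : has_lbound C by exists 0.
pose b := s * inf C.
have clb : closure B b.
  move=> U /nbhs_ballP[e /= e0 eU].
  have [_ [z [Bz sz] <-] xe] := inf_adherent e0 (conj C0 hC).
  exists z; split => //; apply: eU; rewrite /ball/=.
  rewrite -[z]mul1r -ss -mulrA -mulrBr normrM.
  rewrite [X in X * _](_ : _ = 1) ?mul1r; last first.
    by case/orP: s1 => /eqP ->; rewrite ?normrN normr1.
  rewrite distrC ger0_norm ?subr_ge0 ?ltrBlDl//.
  by apply: ge_inf => //; exists z.
have vb : (v%:E < fenchel_legendre L b)%E.
  by apply: lt_le_trans vB _; apply: ereal_inf_lbound; exists b.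
have iC0 : 0 <= inf C by exact: lb_le_inf.
case/ereal_sup_gtP: vb => _ [l _ <-]; rewrite lte_fin => vl.
have lb : 0 < l * s * inf C.
  rewrite -mulrA -/b (le_lt_trans v0)// (lt_le_trans vl)// lerBlDr lerDl.
  exact: L_ge0.
have ls : 0 < l * s.
  by rewrite ltNge; apply/negP => ls; move: lb; rewrite ltNge mulr_le0_ge0.
near=> n.
apply: (@le_trans _ _ (P [set w | (l * b <= l * Z n w)%R])); last first.
  by near: n; exact: chernoff_near.
apply: le_measure; rewrite ?inE//.
  apply: (@measurable_Z_preimage n [set z | l * b <= l * z]).
  exact: measurable_half_line.
move=> w [Bw sw] /=.
rewrite -[Z n w]mul1r -ss /b !mulrA -[_ * s * Z n w]mulrA ler_wpM2l ?(ltW ls)//.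
by apply: ge_inf => //; exists (Z n w).
Unshelve. all: by end_near. Qed.

(** Cramer's argument: [L >= 0] makes the rate function monotone on each side of
    0, hence each half of [B] is governed by its point nearest to 0. The union
    of the two halves costs a factor 2, negligible at speed [a n]. *)
Lemma ldp_upper (B : set R) : measurable B ->
  (limn_esup (fun n => (a n)^-1%:E * lne (P [set w | B (Z n w)]))%E <=
   - ereal_inf [set fenchel_legendre L x | x in closure B])%E.
Proof.
move=> mB; rewrite leeNr.
have mBn n : measurable [set w | B (Z n w)] by exact: measurable_Z_preimage.
have lim0 : (limn_esup (fun n => (a n)^-1%:E * lne (P [set w | B (Z n w)])) <= 0)%E.
  apply: limn_esup_le_near; near=> n; apply: le0_lne_prob => //.
  by near: n; exact: cvgry_ge.
apply: le_ereal_lt_real => v vB.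
have [v0|v0] := ltP v 0.
  by apply: (@le_trans _ _ 0%E); [rewrite lee_fin ltW|rewrite oppe_ge0].
rewrite leeNr; apply/lee_addgt0Pr => e e0; rewrite -EFinN -EFinD.
apply: limn_esup_le_near; near=> n.
have an0 : 0 < a n by near: n; exact: cvgry_gt.
have PB : (P [set w | B (Z n w)] <= (2 * expR (- (a n * v)))%:E)%E.
  rewrite mulr_natl mulr2n EFinD.
  have split_line : [set w | B (Z n w)] `<=`
      [set w | (B (Z n w) /\ 0 <= 1 * Z n w)%R] `|`
      [set w | (B (Z n w) /\ 0 <= -1 * Z n w)%R].
    move=> w Bw /=; have [Z0|Z0] := leP 0 (Z n w); [left|right];
      by split => //; rewrite ?mul1r// mulN1r oppr_ge0 ltW.
  have mhalf s : measurable [set w | (B (Z n w) /\ 0 <= s * Z n w)%R].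
    exact: measurable_half_line_preimage.
  apply: (le_trans (le_measure _ _ _ split_line)); rewrite ?inE//.
    exact: measurableU.
  apply: (le_trans (measureU2 _ _ _)) => //; apply: leeD.
    near: n; apply: half_line_near => //; by rewrite eqxx.
  near: n; apply: half_line_near => //; by rewrite eqxx orbT.
have e2 : expR (a n * e) >= 2.
  rewrite -[leLHS]lnK ?posrE// ler_expR -ler_pdivrMr//.
  by near: n; exact: cvgry_ge.
rewrite muleC lee_pdivrMr//.
apply: (@le_trans _ _ (lne (expR (a n * (- v + e)))%:E)).
  rewrite lee_lne ?in_itv/= ?leey ?andbT ?measure_ge0// ?lee_fin ?expR_ge0//.
  apply: le_trans PB _; rewrite lee_fin mulrDr addrC expRD mulrN.
  by rewrite ler_wpM2r ?expR_ge0.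
by rewrite lne_EFin ?expR_gt0// expRK -EFinM lee_fin mulrC.
Unshelve. all: by end_near. Qed.

Hypothesis dL : forall x, derivable L x 1.

(** The lower bound at an exposed point, without a change of measure. On the
    ball, [expR (eta * a * Z)] is at most
    [expR (a * (eta * x + `|eta| * del))]; off the ball it is at most one of the
    exponentials of slope [eta + th] or [eta - th], normalized at the edges
    [x + del] and [x - del]. The derivative of [L] at [eta] being [x], the means
    of these two exponentials are small fractions of [M n eta] when [th] is
    small, so that the ball carries at least half of [M n eta]. *)
Lemma tilted_ball_near eta x del : 0 < del -> derive1 L eta = x ->
  \forall n \near \oo,
   ((expR (a n * (L eta - eta * x - (`|eta| + 2) * del)))%:E <=
    P [set w | (`|Z n w - x| < del)%R])%E.
Proof.
move=> del0 Lx.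
have del20 : 0 < del / 2 by rewrite divr_gt0.
have [th /andP[th0 th1] [Lp Lm]] : exists2 th : R, 0 < th <= 1 &
    L (eta + th) <= L eta + th * (x + del / 2) /\
    L (eta - th) <= L eta - th * (x - del / 2).
  have : h^-1 *: (L (h *: 1 + eta) - L eta) @[h --> 0^'] --> x.
    by rewrite -Lx derive1E; exact: dL.
  move=> /cvgrPdist_le/(_ _ del20)/nbhs_ballP[r /= r0 H].
  pose th := Num.min 1 (r / 2).
  have th0 : 0 < th by rewrite /th lt_min ltr01 divr_gt0.
  have thr : th < r.
    by rewrite /th (@le_lt_trans _ _ (r / 2)) ?ge_min ?lexx ?orbT// ltr_pdivrMr// ltr_pMr// ltr1n.
  exists th; first by rewrite th0 ge_min lexx.
  have quot h : `|h| < r -> h != 0 ->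
      exists2 D, L (eta + h) = L eta + h * D & `|x - D| <= del / 2.
    move=> hr h0; exists (h^-1 * (L (h *: 1 + eta) - L eta)); last first.
      by apply: H => //; rewrite /ball/= sub0r normrN.
    by rewrite mulVKf// -[h *: 1]/(h * 1) mulr1 (addrC h) [RHS]addrC subrK.
  split.
    have [||D -> ] := quot th; [by rewrite gtr0_norm|by rewrite gt_eqF|].
    rewrite ler_norml => /andP[D1 D2]; rewrite lerD2l ler_wpM2l// ?(ltW th0)//; lra.
  have [||D -> ] := quot (- th); [by rewrite normrN gtr0_norm|by rewrite oppr_eq0 gt_eqF|].
  rewrite ler_norml => /andP[D1 D2]; rewrite lerD2l mulNr lerN2.
  by rewrite ler_wpM2l// ?(ltW th0)//; lra.
(* [th * del / 2 = 4 k]: one [k] for each of the two limits of moment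
   generating functions, and [2 k] to make each side a quarter of the whole. *)
pose k := th * del / 8.
have k0 : 0 < k by rewrite /k divr_gt0// mulr_gt0.
have kdel : k <= del.
  rewrite /k -[leRHS]mul1r; nra.
near=> n.
have an0 : 0 < a n by near: n; exact: cvgry_gt.
have Mp : M n (eta + th) <= expR (a n * (L (eta + th) + k)).
  by near: n; exact: mgf_near_le.
have Mm : M n (eta - th) <= expR (a n * (L (eta - th) + k)).
  by near: n; exact: mgf_near_le.
have M0 : expR (a n * (L eta - k)) <= M n eta.
  by near: n; exact: mgf_near_ge.
have e4 : expR (a n * (- (2 * k))) <= 4^-1.
  rewrite mulrN expRN lef_pV2 ?posrE ?expR_gt0//.
  rewrite -[leLHS]lnK ?posrE// ler_expR -ler_pdivrMr ?mulr_gt0//.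
  by near: n; exact: cvgry_ge.
have e2 : expR (a n * - k) <= 2^-1.
  rewrite mulrN expRN lef_pV2 ?posrE ?expR_gt0//.
  rewrite -[leLHS]lnK ?posrE// ler_expR -ler_pdivrMr ?mulr_gt0//.
  by near: n; exact: cvgry_ge.
set A := [set w | _].
have mA : measurable A.
  apply: (@measurable_Z_preimage n [set z | `|z - x| < del]).
  rewrite [X in measurable X](_ : _ = ball x del); first exact: measurable_ball.
  by apply/funext => z /=; rewrite /ball/= distrC.
have PA : P A = (fine (P A))%:E by rewrite fineK// fin_num_measure.
have int_le : ((M n eta)%:E <=
   (expR (a n * (eta * x + `|eta| * del)))%:E * P A +
   (M n (eta + th) * expR (- (th * a n * (x + del))))%:E +
   (M n (eta - th) * expR (th * a n * (x - del)))%:E)%E.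
  rewrite -intM -!integral_exp_shift -[A in (_ * P A)%E]setIT -integral_indic//.
  have mi : measurable_fun [set: Omega] (fun w => (\1_A w)%:E : \bar R).
    exact/measurable_EFinP/measurable_indic.
  rewrite -ge0_integralZl_EFin ?expR_ge0//.
  rewrite -ge0_integralD//; [|exact: measurable_funeM|exact: measurable_exp_Z].
  rewrite -ge0_integralD//; [|by move=> w _; rewrite adde_ge0 ?mule_ge0// lee_fin|
    by apply: emeasurable_funD; [exact: measurable_funeM|exact: measurable_exp_Z]
    |exact: measurable_exp_Z].
  apply: ge0_le_integral => //.
  - by have := @measurable_exp_Z n eta 0; under eq_fun do rewrite addr0.
  - apply: emeasurable_funD; [apply: emeasurable_funD|exact: measurable_exp_Z].
      exact: measurable_funeM.
    exact: measurable_exp_Z.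
  move=> w _; rewrite -EFinM -!EFinD lee_fin.
  have e0 l k' := expR_ge0 (l * a n * Z n w + k').
  have [|xdel] := ltP `|Z n w - x| del.
    move=> /[dup] Aw; rewrite ltr_norml => /andP[dm dp].
    rewrite indicE mem_set// mulr1 -addrA ler_wpDr ?addr_ge0//.
    rewrite ler_expR -mulrA mulrCA ler_pM2l// -lerBlDl -mulrBr.
    apply: (le_trans (ler_norm _)); rewrite normrM ler_wpM2l// ltW//.
  rewrite indicE memNset ?mulr0 ?add0r; last by rewrite /A/= ltNge xdel.
  have [Zx|Zx] := leP 0 (Z n w - x).
    rewrite ler_wpDr// ler_expR.
    move: xdel; rewrite ger0_norm// lerBrDl => xdel.
    rewrite -subr_ge0 [leRHS](_ : _ = th * a n * (Z n w - (x + del))); last by ring.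
    by rewrite mulr_ge0 ?subr_ge0// mulr_ge0 ?ltW.
  rewrite ler_wpDl// ler_expR.
  move: xdel; rewrite ltr0_norm// opprB lerBrDl => xdel.
  rewrite -subr_ge0 [leRHS](_ : _ = th * a n * (x - del - Z n w)); last by ring.
  rewrite mulr_ge0 ?mulr_ge0 ?(ltW th0) ?(ltW an0)//; lra.
move: int_le; rewrite PA -EFinM -!EFinD !lee_fin => int_le.
set E0 := expR (a n * (L eta - k)) in M0.
have E00 : 0 < E0 by exact: expR_gt0.
have T1 : M n (eta + th) * expR (- (th * a n * (x + del))) <= E0 / 4.
  apply: (le_trans (ler_wpM2r (expR_ge0 _) Mp)).
  rewrite -expRD (@le_trans _ _ (E0 * expR (a n * (- (2 * k)))))//; last first.
    by rewrite ler_pM2l.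
  rewrite -expRD ler_expR [leLHS](_ : _ = a n * (L (eta + th) + k - th * (x + del))); last by ring.
  rewrite -mulrDr ler_pM2l//; move: Lp; rewrite /k; lra.
have T2 : M n (eta - th) * expR (th * a n * (x - del)) <= E0 / 4.
  apply: (le_trans (ler_wpM2r (expR_ge0 _) Mm)).
  rewrite -expRD (@le_trans _ _ (E0 * expR (a n * (- (2 * k)))))//; last first.
    by rewrite ler_pM2l.
  rewrite -expRD ler_expR [leLHS](_ : _ = a n * (L (eta - th) + k + th * (x - del))); last by ring.
  rewrite -mulrDr ler_pM2l//; move: Lm; rewrite /k; lra.
have T3 : E0 / 2 <= expR (a n * (eta * x + `|eta| * del)) * fine (P A) by lra.
have T4 : expR (a n * (L eta - 2 * k)) <= E0 / 2.
  rewrite [_ - _](_ : _ = (L eta - k) - k); last by ring.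
  by rewrite mulrDr expRD ler_pM2l.
rewrite -(ler_pM2l (expR_gt0 (a n * (eta * x + `|eta| * del)))).
apply: le_trans T3; apply: le_trans T4.
rewrite -expRD ler_expR -mulrDr ler_pM2l//; lra.
Unshelve. all: by end_near. Qed.

Hypothesis c0 : (c < 0)%R.
Hypothesis L_le_linear : forall l, l <= 0 -> L l <= c * l.
Hypothesis exposed : forall x, c < x -> exists eta, derive1 L eta = x.

Lemma fenchel_legendre_pinfty x : x < c -> fenchel_legendre L x = +oo%E.
Proof.
move=> xc; apply/eqyP => r r0.
have l0 : r / (x - c) <= 0 by rewrite mulr_ge0_le0 ?(ltW r0)// invr_le0 subr_le0 ltW.
apply: le_trans (fenchel_legendre_ge L x (r / (x - c))).
have xc0 : x - c != 0 by rewrite lt_eqF// subr_lt0.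
rewrite lee_fin lerBrDr (le_trans (lerD (lexx r) (L_le_linear l0)))//.
by rewrite le_eqVlt; apply/orP; left; apply/eqP; field.
Qed.

(** Left of 0 the slopes [l > 0] contribute nothing to the supremum, since
    [L >= 0]. *)
Lemma fenchel_legendre_nonincreasing x y : x <= y -> y <= 0 ->
  (fenchel_legendre L y <= fenchel_legendre L x)%E.
Proof.
move=> xy y0; apply: ge_ereal_sup => _ [l _ <-].
have [l0|l0] := leP l 0.
  apply: le_trans (fenchel_legendre_ge L x l).
  by rewrite lee_fin lerD2r ler_wnM2l.
apply: le_trans (fenchel_legendre_ge0 x); rewrite lee_fin subr_le0.
by apply: le_trans (L_ge0 l); rewrite mulr_ge0_le0// ltW.
Qed.

Lemma ldp_lower_exposed (B : set R) x : measurable B -> c < x -> interior B x ->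
  (- fenchel_legendre L x <=
   limn_einf (fun n => (a n)^-1%:E * lne (P [set w | B (Z n w)])))%E.
Proof.
move=> mB cx /nbhs_ballP[r /= r0 rB].
have [eta etax] := exposed cx.
apply: (@le_trans _ _ (L eta - eta * x)%:E).
  by rewrite leeNl -EFinN opprB; exact: fenchel_legendre_ge.
apply/lee_subgt0Pr => e e0; rewrite -EFinB.
pose del := Num.min r (e / (`|eta| + 2)).
have eta2 : 0 < `|eta| + 2 by rewrite ltr_wpDl.
have del0 : 0 < del by rewrite lt_min r0 divr_gt0.
have dele : (`|eta| + 2) * del <= e.
  by rewrite mulrC -ler_pdivlMr// ge_min lexx orbT.
apply: limn_einf_ge_near; near=> n.
have an0 : 0 < a n by near: n; exact: cvgry_gt.
have Pge : ((expR (a n * (L eta - eta * x - (`|eta| + 2) * del)))%:E <=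
    P [set w | (`|Z n w - x| < del)%R])%E.
  by near: n; exact: tilted_ball_near.
rewrite lee_pdivlMl// -EFinM.
apply: (@le_trans _ _ (lne (expR (a n * (L eta - eta * x - (`|eta| + 2) * del)))%:E)).
  by rewrite lne_EFin ?expR_gt0// expRK lee_fin ler_pM2l// lerD2l lerN2.
rewrite lee_lne ?in_itv/= ?leey ?andbT ?measure_ge0// ?lee_fin ?expR_ge0//.
apply: le_trans Pge _; apply: le_measure; rewrite ?inE.
- apply: (@measurable_Z_preimage n [set z | `|z - x| < del]).
  rewrite [X in measurable X](_ : _ = ball x del); first exact: measurable_ball.
  by apply/funext => z /=; rewrite /ball/= distrC.
- exact: measurable_Z_preimage.
- move=> w /= wd; apply: rB; rewrite /ball/= distrC (lt_le_trans wd)//.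
  by rewrite ge_min lexx.
Unshelve. all: by end_near. Qed.

(** The rate is infinite below [c], and the points above [c] are exposed. At [c]
    the rate may be finite, but it is no smaller than at the points of the
    interior just above [c]. *)
Lemma ldp_lower (B : set R) : measurable B ->
  (- ereal_inf [set fenchel_legendre L x | x in interior B] <=
   limn_einf (fun n => (a n)^-1%:E * lne (P [set w | B (Z n w)])))%E.
Proof.
move=> mB; rewrite leeNl; apply: le_ereal_inf_tmp => _ [x Bx <-].
rewrite leeNl.
have [cx|xc|cx] := ltgtP c x; first exact: ldp_lower_exposed.
  by rewrite fenchel_legendre_pinfty// leNye.
rewrite -cx in Bx *.
have /nbhs_ballP[r /= r0 rB] : nbhs c (interior B) by exact: nbhs_interior.
pose y := c + Num.min (r / 2) (- c).
have m0 : 0 < Num.min (r / 2) (- c) by rewrite lt_min divr_gt0//= oppr_gt0.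
apply: (@le_trans _ _ (- fenchel_legendre L y)%E).
  rewrite leeN2 fenchel_legendre_nonincreasing//.
    by rewrite /y ler_wpDr// ltW.
  by rewrite /y -lerBrDl sub0r ge_min lexx orbT.
apply: ldp_lower_exposed => //; first by rewrite /y ltrDl.
apply: rB; rewrite /ball/= /y opprD addNKr normrN gtr0_norm//.
by rewrite gt_min ltr_pdivrMr// ltr_pMr// ltr1n.
Qed.

End gartner_ellis.

(** * Improper integrals on the half-line *)

Section improper.
Context (R : realType).
Notation mu := (@lebesgue_measure R).
Notation pos := (`]0, +oo[%classic : set R).

(** Compact segments exhausting the half-line, on which the fundamental theorem
    of calculus applies. *)
Let seg (n : nat) : set R := `[n.+2%:R^-1, n.+2%:R].

Let seg_pos n x : seg n x -> 0 < x.
Proof. by rewrite /seg/= in_itv/= => /andP[+ _]; apply: lt_le_trans; rewrite invr_gt0. Qed.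

Let seg_homo : nondecreasing_seq seg.
Proof.
apply/nondecreasing_seqP => n; rewrite subsetEset => x; rewrite /seg/= !in_itv/=.
move=> /andP[x1 x2]; apply/andP; split.
  by apply: le_trans x1; rewrite lef_pV2 ?posrE// ler_nat.
by apply: (le_trans x2); rewrite ler_nat.
Qed.

Let bigcup_seg : \bigcup_n seg n = pos.
Proof.
apply/seteqP; split => [x [n _ /seg_pos x0]|x]; rewrite /= in_itv/= andbT//.
move=> x0; have [n xn] : exists n : nat, x <= n%:R /\ x^-1 <= n%:R.
  exists (maxn (Num.truncn x).+1 (Num.truncn x^-1).+1); split.
    by rewrite (le_trans (ltW (truncnS_gt _)))// ler_nat leq_maxl.
  by rewrite (le_trans (ltW (truncnS_gt _)))// ler_nat leq_maxr.
exists n => //; rewrite /seg/= in_itv/=; case: xn => xn xn'.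
have n2 : n%:R <= n.+2%:R :> R by rewrite ler_nat -addn2 leq_addr.
rewrite (le_trans xn n2) andbT -[leRHS]invrK lef_pV2 ?posrE ?invr_gt0//.
exact: le_trans n2.
Qed.

Lemma continuous_pos_measurable (f : R -> R) :
  {in `]0, +oo[, continuous f} -> measurable_fun pos f.
Proof.
move=> cf; apply: open_continuous_measurable_fun; first exact: interval_open.
by move=> x /set_mem xD; exact: cf.
Qed.

Lemma integral_pos_lim (f : R -> R) : {in `]0, +oo[, continuous f} ->
  (forall x, 0 < x -> 0 <= f x) ->
  (\int[mu]_(x in seg n) (f x)%:E)%E @[n --> \oo] -->
  (\int[mu]_(x in pos) (f x)%:E)%E.
Proof.
move=> cf f0; rewrite -bigcup_seg; apply: ge0_nondecreasing_set_cvg_integral => //.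
- by move=> n; exact: measurable_itv.
- move=> n; apply/measurable_EFinP.
  apply: (@measurable_funS _ _ _ _ pos) => //.
    by move=> x /seg_pos; rewrite /= in_itv/= andbT.
  exact: continuous_pos_measurable.
- by move=> n x /seg_pos x0; rewrite lee_fin f0.
Qed.

(** The fundamental theorem of calculus on the segments [seg n], in the limit.
    The integrands being nonnegative, the finiteness of the second integral
    comes from that of the first and of the boundary values. *)
Lemma integral_pos_parts (f1 f2 F : R -> R) (l0 l1 I : R) :
  {in `]0, +oo[, continuous f1} -> {in `]0, +oo[, continuous f2} ->
  (forall x, 0 < x -> 0 <= f1 x) -> (forall x, 0 < x -> 0 <= f2 x) ->
  (forall x : R, 0 < x -> is_derive x 1 F (f1 x - f2 x)) ->
  F x @[x --> 0^'+] --> l0 -> F x @[x --> +oo] --> l1 ->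
  (\int[mu]_(x in pos) (f1 x)%:E = I%:E)%E ->
  (\int[mu]_(x in pos) (f2 x)%:E = (I - (l1 - l0))%:E)%E.
Proof.
move=> cf1 cf2 f10 f20 dF Fl0 Fl1 intf1.
have segP n (x : R) : x \in `[n.+2%:R^-1, n.+2%:R] -> x \in `]0, +oo[.
  by by move=> xs; have /seg_pos : seg n x by []; rewrite in_itv/= andbT.
have cseg (f : R -> R) n : {in `]0, +oo[, continuous f} -> {within seg n, continuous f}.
  by move=> cf; apply: continuous_subspace_itv => x /segP; exact: cf.
have iseg (f : R -> R) n : {in `]0, +oo[, continuous f} -> mu.-integrable (seg n) (EFin \o f).
  move=> cf; apply: continuous_compact_integrable; first exact: segment_compact.
  exact: cseg.
have fseg (f : R -> R) n : {in `]0, +oo[, continuous f} ->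
    (\int[mu]_(x in seg n) (f x)%:E)%E \is a fin_num.
  by move=> cf; apply: integrable_fin_num; [exact: measurable_itv|exact: (iseg _ _ cf)].
have int_seg n : (\int[mu]_(x in seg n) (f2 x)%:E =
    \int[mu]_(x in seg n) (f1 x)%:E - (F n.+2%:R - F n.+2%:R^-1)%:E)%E.
  have ab : n.+2%:R^-1 < n.+2%:R :> R.
    by rewrite (@lt_trans _ _ 1)// ?invf_lt1// ltr1n.
  have cF (x : R) : 0 < x -> {for x, continuous F}.
    by move=> x0; apply/differentiable_continuous/derivable1_diffP; case: (dF _ x0).
  have := @continuous_FTC2 _ (fun x => f1 x - f2 x) F _ _ ab.
  have n2 : 0 < n.+2%:R^-1 :> R by rewrite invr_gt0.
  rewrite -/(seg n) => FTC.
  rewrite -EFinB in FTC; rewrite -FTC.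
  - have -> : (\int[mu]_(x in seg n) (f1 x - f2 x)%:E =
        \int[mu]_(x in seg n) (f1 x)%:E - \int[mu]_(x in seg n) (f2 x)%:E)%E.
      under eq_integral do rewrite EFinB.
      rewrite integralB_EFin//; [exact: measurable_itv|exact: (iseg f1 n cf1)|exact: (iseg f2 n cf2)].
    have := fseg f1 n cf1.
    have := fseg f2 n cf2.
    case: integral => // s2 _; case: integral => // s1 _.
    by rewrite -!EFinB; congr EFin; ring.
  - apply: (cseg (f1 \- f2)) => x xD; apply: cvgB; [exact: cf1|exact: cf2].
  - split.
    + move=> x; rewrite in_itv/= => /andP[x1 _].
      by have [] := dF x (lt_trans n2 x1).
    + by apply: cvg_at_right_filter; exact: cF.
    + by apply: cvg_at_left_filter; apply: cF; exact: lt_trans ab.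
  - move=> x; rewrite in_itv/= => /andP[x1 _].
    have [_ <-] := dF x (lt_trans n2 x1); exact: derive1E.
have lim2 := integral_pos_lim cf2 f20.
have lim1 := integral_pos_lim cf1 f10; rewrite intf1 in lim1.
have limF : F n.+2%:R - F n.+2%:R^-1 @[n --> \oo] --> l1 - l0.
  have n2 : (n.+2%:R : R) @[n --> \oo] --> +oo.
    apply/cvgryPge => A; near=> n.
    by rewrite (@le_trans _ _ n%:R)// ?ler_nat 1?ltnW// -?addn2 ?leq_addr//; near: n; exact: nbhs_infty_ger.
  apply: cvgB; first exact: (cvg_comp _ _ n2 Fl1).
  have n20 : (n.+2%:R : R)^-1 @[n --> \oo] --> 0^'+.
    have n20 : (n.+2%:R : R)^-1 @[n --> \oo] --> (0 : R).
      by apply/gtr0_cvgV0 => //; exact: nearW.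
    move=> B [e /= e0 eB]; have /cvgrPdist_lt/(_ _ e0) := n20.
    by apply: filterS => n /= ne; apply: eB => //=; rewrite invr_gt0.
  exact: (cvg_comp _ _ n20 Fl0).
apply/(cvg_unique _ lim2) => //.
rewrite /= EFinB; under eq_fun do rewrite int_seg.
 apply: cvgeB => //.
by apply: cvg_EFin => //; exact: nearW.
Unshelve. all: by end_near. Qed.

End improper.

Section calculus.
Context (R : realType).
Implicit Types (f g : R -> R) (x a b : R).

(** The rules of differentiation for functions written as abstractions over the
    point: in this form derivatives of composite expressions are built by
    unification. *)
Lemma is_deriveD_fun f g x a b : is_derive x 1 f a -> is_derive x 1 g b ->
  is_derive x 1 (fun y => f y + g y) (a + b).
Proof. by move=> fa gb; exact: is_deriveD. Qed.

Lemma is_deriveN_fun f x a : is_derive x 1 f a ->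
  is_derive x 1 (fun y => - f y) (- a).
Proof. by move=> fa; exact: is_deriveN. Qed.

Lemma is_deriveB_fun f g x a b : is_derive x 1 f a -> is_derive x 1 g b ->
  is_derive x 1 (fun y => f y - g y) (a - b).
Proof. by move=> fa gb; exact: is_deriveB. Qed.

Lemma is_derive_cst_fun x a : is_derive x 1 (fun _ : R => a) 0.
Proof. exact: is_derive_cst. Qed.

Lemma is_derive_powR_fun x a : 0 < x ->
  is_derive x 1 (fun y => y `^ a) (a * x `^ (a - 1)).
Proof. by move=> x0; exact: is_derive1_powR. Qed.

Lemma is_deriveM_fun f g x a b : is_derive x 1 f a -> is_derive x 1 g b ->
  is_derive x 1 (fun y => f y * g y) (a * g x + f x * b).
Proof.
move=> fa gb; apply: (@is_derive_eq _ _ _ (f * g)).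
by rewrite addrC; congr (_ + _); rewrite mulrC.
Qed.

Lemma is_deriveV_fun f x a : f x != 0 -> is_derive x 1 f a ->
  is_derive x 1 (fun y => (f y)^-1) (- a / f x ^+ 2).
Proof.
move=> fx fa; apply: (is_derive_eq (is_deriveV fx fa)).
by rewrite -[_ *: _]/(_ * _) mulrC mulrN mulNr.
Qed.

Lemma is_derive_comp_fun f g x a b : is_derive x 1 f a ->
  is_derive (f x) 1 g b -> is_derive x 1 (fun y => g (f y)) (b * a).
Proof. by move=> fa gb; exact: is_derive1_comp. Qed.

Lemma is_derive_continuous f x a : is_derive x 1 f a -> {for x, continuous f}.
Proof. by case=> df _; exact/differentiable_continuous/derivable1_diffP. Qed.

Lemma is_derive_expRN x : is_derive x 1 (fun y => expR (- y)) (- expR (- x)).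
Proof.
have dN : is_derive x 1 (fun y => - y) (- 1) by exact: is_deriveNid.
by apply: (is_derive_eq (is_derive_comp_fun dN (is_derive_expR _))); rewrite mulrN1.
Qed.

Lemma pos_continuous f : (forall x, 0 < x -> exists a, is_derive x 1 f a) ->
  {in `]0, +oo[, continuous f}.
Proof.
by move=> df x; rewrite in_itv/= andbT => /df[a]; exact: is_derive_continuous.
Qed.

Lemma powRN_cvgy0 a : 0 < a -> x `^ (- a) @[x --> +oo] --> 0.
Proof.
move=> a0; apply/cvgr0Pnorm_le => e e0; near=> x.
rewrite ger0_norm ?powR_ge0// powRN.
have ea0 : 0 < e `^ (- a^-1) by rewrite powR_gt0.
have : e `^ (- a^-1) <= x by near: x; exact: nbhs_pinfty_ge.
move=> /(ge0_ler_powR (ltW a0)); rewrite !nnegrE => /(_ (ltW ea0)).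
rewrite -powRrM mulNr mulVf ?gt_eqF// powR_inv1 ?(ltW e0)// => H.
have x0 : 0 < x by near: x; exact: nbhs_pinfty_gt.
by rewrite -[leRHS]invrK lef_pV2 ?posrE ?powR_gt0 ?invr_gt0//; exact/H/ltW.
Unshelve. all: by end_near. Qed.

Lemma le_powR_1D x a : 0 <= x -> 0 <= a <= 1 -> x `^ a <= 1 + x.
Proof.
move=> x0 /andP[a0 a1]; have [x1|x1] := leP x 1.
  rewrite ler_wpDr//; have := ge0_ler_powR a0.
  by move=> /(_ x 1); rewrite !nnegrE powR1; apply.
by rewrite ler_wpDl// -[leRHS]powRr1// ler_powR// ltW.
Qed.

Lemma expR_ge_sqr x : 0 <= x -> (2 + x) ^+ 2 <= 4 * expR x.
Proof.
move=> x0; have -> : x = x / 2 + x / 2 by rewrite -splitr.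
rewrite expRD; have := expR_ge1Dx (x / 2); set e := expR _ => e1.
have x2 : 0 <= x / 2 by rewrite divr_ge0.
by rewrite expr2; nra.
Qed.

End calculus.

Section gamma_integrand.
Context (R : realType).
Notation mu := (@lebesgue_measure R).
Notation pos := (`]0, +oo[%classic : set R).

Lemma ge0_pos_integrable (f : R -> R) (I : R) : {in `]0, +oo[, continuous f} ->
  (forall x, 0 < x -> 0 <= f x) -> (\int[mu]_(s in pos) (f s)%:E = I%:E)%E ->
  mu.-integrable pos (EFin \o f).
Proof.
move=> cf f0 intf; apply/integrableP; split.
  by apply/measurable_EFinP; exact: continuous_pos_measurable.
rewrite (_ : integral _ _ _ = I%:E) ?ltry// -intf.
apply: eq_integral => s /=; rewrite inE/= in_itv/= andbT => s0.
by rewrite ger0_norm// f0.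
Qed.

Lemma continuous_pos_powR (a : R) : {in `]0, +oo[, continuous (fun x : R => x `^ a)}.
Proof.
apply: pos_continuous => x x0; eexists; exact: is_derive1_powR.
Qed.

Lemma continuous_powR_expRN (a : R) :
  {in `]0, +oo[, continuous (fun x : R => x `^ a * expR (- x))}.
Proof.
apply: pos_continuous => x x0; eexists.
exact: (is_deriveM_fun (is_derive_powR_fun _ x0) (is_derive_expRN _)).
Qed.

(** [s^(-a) e^(-s)] is dominated by a multiple of the derivative of the bounded
    function [- 1 / (1 + s^(1-a))], because
    [(1 + s^(1-a))^2 <= (2 + s)^2 <= 4 e^s]. *)
Lemma integrable_powR_expRN (a : R) : 0 <= a < 1 ->
  mu.-integrable pos (fun s => (s `^ (- a) * expR (- s))%:E).
Proof.
move=> /andP[a0 a1].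
pose F (s : R) := (1 + s `^ (1 - a))^-1.
pose f (s : R) := (1 - a) * s `^ (- a) / (1 + s `^ (1 - a)) ^+ 2.
have den0 (s : R) : 0 < 1 + s `^ (1 - a) by rewrite ltr_pwDl// powR_ge0.
have dden (s : R) : 0 < s ->
    is_derive s 1 (fun y => 1 + y `^ (1 - a)) ((1 - a) * s `^ (- a)).
  move=> s0.
  apply: (is_derive_eq (is_deriveD_fun (is_derive_cst_fun s 1) (is_derive_powR_fun _ s0))).
  by rewrite add0r; congr (_ * _ `^ _); lra.
have dF (s : R) : 0 < s -> is_derive s 1 F (0 - f s).
  move=> s0; apply: (is_derive_eq (is_deriveV_fun _ (dden _ s0))).
    by rewrite gt_eqF.
  by rewrite sub0r /f !mulNr.
have f0 (s : R) : 0 <= f s.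
  apply: divr_ge0; last by rewrite exprn_ge0// ltW.
  by rewrite mulr_ge0 ?powR_ge0// subr_ge0 ltW.
have cf : {in `]0, +oo[, continuous f}.
  apply: pos_continuous => s s0; eexists.
  apply: (is_deriveM_fun (is_deriveM_fun (is_derive_cst_fun _ _) (is_derive_powR_fun _ s0))).
  apply: (is_deriveV_fun _ (is_deriveM_fun (dden _ s0) (dden _ s0))).
  by rewrite mulf_neq0// gt_eqF.
have intf : (\int[mu]_(s in pos) (f s)%:E = (0 - (0 - 1))%:E)%E.
  apply: (@integral_pos_parts _ (cst 0) f F) => //.
  - by move=> x _; exact: cst_continuous.
  - have H : 1 + x `^ (1 - a) @[x --> 0^'+] --> (1 + 0 : R).
      by apply: cvgD; [exact: cvg_cst|apply: powR_cvg0; rewrite subr_gt0].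
    rewrite addr0 in H; rewrite -[X in _ --> X]invr1.
    by apply: cvgV H; rewrite oner_neq0.
  - apply: (@squeeze_cvgr _ _ _ _ (cst 0) (fun x => x `^ (- (1 - a)))).
    + near=> x; have x0 : 0 < x by near: x; exact: nbhs_pinfty_gt.
      rewrite invr_ge0 ltW//= powRN lef_pV2 ?posrE ?powR_gt0//.
      by rewrite ler_wpDl.
    + exact: cvg_cst.
    + by apply: powRN_cvgy0; rewrite subr_gt0.
  - by rewrite integral0_eq.
have f_int : mu.-integrable pos (EFin \o f).
  exact: ge0_pos_integrable intf.
apply: (@le_integrable _ _ _ mu pos _ _ (EFin \o (fun s => 4 / (1 - a) * f s))) => //.
- apply/measurable_EFinP; exact: (continuous_pos_measurable (@continuous_powR_expRN _)).
- move=> s /=; rewrite in_itv/= andbT => s0.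
  rewrite lee_fin ger0_norm ?mulr_ge0 ?powR_ge0 ?expR_ge0//.
  rewrite ger0_norm; last by rewrite mulr_ge0// divr_ge0// subr_ge0 ltW.
  rewrite /f !mulrA divfK; last by rewrite gt_eqF// subr_gt0.
  rewrite expRN ler_pdivlMr ?exprn_gt0// mulrAC ler_pdivrMr ?expR_gt0//.
  rewrite -!mulrA [leRHS]mulrCA ler_wpM2l ?powR_ge0//.
  apply: le_trans (expR_ge_sqr (ltW s0)).
  rewrite lerXn2r ?nnegrE ?addr_ge0 ?powR_ge0 ?(ltW s0)//.
  have : s `^ (1 - a) <= 1 + s.
    by apply: le_powR_1D; rewrite ?(ltW s0)// gerBl subr_ge0 a0 ltW.
  lra.
- by apply: (integrableZl _ (4 / (1 - a)) f_int).
Unshelve. all: by end_near. Qed.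

End gamma_integrand.

(** * Integration by parts against a power *)

Section powR_parts.
Context (R : realType) (gamma : R).
Hypothesis gamma01 : 0 < gamma < 1.
Notation mu := (@lebesgue_measure R).
Notation pos := (`]0, +oo[%classic : set R).

Let gamma0 : 0 < gamma. Proof. by case/andP: gamma01. Qed.
Let gamma1 : gamma < 1. Proof. by case/andP: gamma01. Qed.

Lemma one_sub_expRN_le (s : R) : 1 - expR (- s) <= s.
Proof. by rewrite lerBlDr -lerBlDl; have := expR_ge1Dx (- s). Qed.

Lemma one_sub_expRN_ge0 (s : R) : 0 <= s -> 0 <= 1 - expR (- s).
Proof. by move=> s0; rewrite subr_ge0 -expR0 ler_expR oppr_le0. Qed.

Lemma one_sub_expRN_le1 (s : R) : 1 - expR (- s) <= 1.
Proof. by rewrite gerBl expR_ge0. Qed.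

Lemma powR_1D_inv (s : R) : 0 < s -> s `^ (- gamma - 1) = (s `^ (1 + gamma))^-1.
Proof. by move=> s0; rewrite -powRN opprD addrC. Qed.

Lemma gamma_integrable : mu.-integrable pos (fun s => (s `^ (- gamma) * expR (- s))%:E).
Proof. by apply: integrable_powR_expRN; rewrite ltW. Qed.

Lemma le_gamma_integrable (f : R -> R) (K : R) : {in `]0, +oo[, continuous f} ->
  (forall s, 0 < s -> `|f s| <= K * expR (- s)) ->
  mu.-integrable pos (fun s => (f s * s `^ (- gamma))%:E).
Proof.
move=> cf fK.
apply: (@le_integrable _ _ _ mu pos _ _
  (fun s => (K%:E * (s `^ (- gamma) * expR (- s))%:E)%E)) => //.
- apply/measurable_EFinP; apply: continuous_pos_measurable => s spos.
  by apply: cvgM; [exact: cf|exact: continuous_pos_powR].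
- move=> s /=; rewrite in_itv/= andbT => s0.
  rewrite lee_fin normrM [X in _ * X]ger0_norm ?powR_ge0//.
  apply: le_trans (ler_norm _); rewrite mulrC mulrCA ler_wpM2l ?powR_ge0//.
  exact: fK.
- by apply: integrableZl => //; exact: gamma_integrable.
Qed.

(** Integration by parts with [F = h s^(-gamma)]. By the bounds on [h], the
    boundary terms vanish like [s^(1-gamma)] at 0 and like [s^(-gamma)] at
    infinity. *)
Lemma integral_powR_parts (h dh : R -> R) (K : R) :
  (forall s : R, 0 < s -> is_derive s 1 h (dh s)) ->
  {in `]0, +oo[, continuous dh} ->
  (forall s, 0 < s -> 0 <= dh s <= K * expR (- s)) ->
  (forall s, 0 < s -> 0 <= h s <= K * (1 - expR (- s))) ->
  [/\ mu.-integrable pos (fun s => (dh s * s `^ (- gamma))%:E),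
      mu.-integrable pos (fun s => (h s / s `^ (1 + gamma))%:E) &
      gamma * \int[mu]_(s in pos) (h s / s `^ (1 + gamma)) =
      \int[mu]_(s in pos) (dh s * s `^ (- gamma))].
Proof.
move=> hdh cdh dhK hK.
have K0 : 0 <= K.
  have /andP[d0 d1] := dhK 1 ltr01.
  by rewrite -(pmulr_lge0 _ (expR_gt0 (- 1))) (le_trans d0).
pose f1 (s : R) := dh s * s `^ (- gamma).
pose f2 (s : R) := gamma * (h s / s `^ (1 + gamma)).
pose F (s : R) := h s * s `^ (- gamma).
have cf1 : {in `]0, +oo[, continuous f1}.
  by move=> s spos; apply: cvgM; [exact: cdh|exact: continuous_pos_powR].
have ch : {in `]0, +oo[, continuous (fun s => h s / s `^ (1 + gamma))}.
  apply: pos_continuous => s s0; eexists.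
  apply: (is_deriveM_fun (hdh _ s0)); apply: is_deriveV_fun.
    by rewrite gt_eqF// powR_gt0.
  exact: is_derive_powR_fun.
have cf2 : {in `]0, +oo[, continuous f2}.
  by move=> s spos; apply: cvgM; [exact: cvg_cst|exact: ch].
have f10 (s : R) : 0 < s -> 0 <= f1 s.
  by move=> s0; have /andP[? _] := dhK s s0; rewrite mulr_ge0 ?powR_ge0.
have f20 (s : R) : 0 < s -> 0 <= f2 s.
  move=> s0; have /andP[? _] := hK s s0.
  by rewrite mulr_ge0 ?(ltW gamma0)// divr_ge0 ?powR_ge0.
have dF (s : R) : 0 < s -> is_derive s 1 F (f1 s - f2 s).
  move=> s0; apply: (is_derive_eq (is_deriveM_fun (hdh _ s0) (is_derive_powR_fun _ s0))).
  by rewrite /f1 /f2 powR_1D_inv//; ring.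
have int1 : mu.-integrable pos (EFin \o f1).
  apply: (@le_gamma_integrable _ K cdh) => s s0.
  by have /andP[d0 d1] := dhK s s0; rewrite ger0_norm.
have intf1 : (\int[mu]_(s in pos) (f1 s)%:E = (\int[mu]_(s in pos) f1 s)%:E)%E.
  by rewrite /Rintegral fineK//; apply: integrable_fin_num; [exact: measurable_itv|exact: int1].
have F0 : F x @[x --> 0^'+] --> 0.
  apply: (@squeeze_cvgr _ _ _ _ (cst 0) (fun x => K * x `^ (1 - gamma))).
  - near=> x; have x0 : 0 < x by near: x; exact: nbhs_right_gt.
    have /andP[h0 h1] := hK x x0.
    rewrite /F mulr_ge0 ?powR_ge0//=.
    rewrite [1 - gamma]addrC powRD; last by rewrite (gt_eqF x0) implybT.
    rewrite powRr1 ?(ltW x0)// mulrCA mulrC ler_wpM2l ?powR_ge0//.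
    by rewrite (le_trans h1)// ler_wpM2l// one_sub_expRN_le.
  - exact: cvg_cst.
  - rewrite -[X in _ --> X](mulr0 K); apply: cvgM; first exact: cvg_cst.
    by apply: powR_cvg0; rewrite subr_gt0.
have Fy : F x @[x --> +oo] --> 0.
  apply: (@squeeze_cvgr _ _ _ _ (cst 0) (fun x => K * x `^ (- gamma))).
  - near=> x; have x0 : 0 < x by near: x; exact: nbhs_pinfty_gt.
    have /andP[h0 h1] := hK x x0.
    rewrite /F mulr_ge0 ?powR_ge0//= ler_wpM2r ?powR_ge0//.
    by rewrite (le_trans h1)// ler_piMr// one_sub_expRN_le1.
  - exact: cvg_cst.
  - rewrite -[X in _ --> X](mulr0 K); apply: cvgM; first exact: cvg_cst.
    exact: powRN_cvgy0.
have intf2 := integral_pos_parts cf1 cf2 f10 f20 dF F0 Fy intf1.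
rewrite subrr subr0 in intf2.
have int2 : mu.-integrable pos (EFin \o f2) := ge0_pos_integrable cf2 f20 intf2.
have inth : mu.-integrable pos (fun s => (h s / s `^ (1 + gamma))%:E).
  have int3 : mu.-integrable pos (fun s => (gamma^-1 * f2 s)%:E).
    by apply: (integrableZl _ gamma^-1 int2).
  by apply: eq_integrable int3 => // s _; rewrite /f2 mulKf// gt_eqF.
split => //; rewrite -RintegralZl//.
by rewrite {1}/Rintegral -/f2 intf2.
Unshelve. all: by end_near. Qed.

End powR_parts.

(** * Scaling and lower bounds of integrals *)

Section scaling.
Context (R : realType).
Notation mu := (@lebesgue_measure R).
Notation pos := (`]0, +oo[%classic : set R).

Lemma le_integral_interval (f : R -> R) (a b c : R) : 0 < a <= b ->
  mu.-integrable pos (EFin \o f) -> (forall s, 0 < s -> 0 <= f s) ->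
  0 <= c -> (forall s, a <= s <= b -> c <= f s) ->
  c * (b - a) <= \int[mu]_(s in pos) f s.
Proof.
move=> /andP[a0 ab] intf f0 c0 cf.
have sub : (`[a, b]%classic : set R) `<=` pos.
  by move=> x; rewrite /= !in_itv/= andbT => /andP[+ _]; exact: lt_le_trans.
have intb : (\int[mu]_(s in pos) (f s)%:E)%E \is a fin_num.
  by apply: integrable_fin_num; [exact: measurable_itv|exact: intf].
rewrite -lee_fin /Rintegral fineK//.
apply: (@le_trans _ _ (\int[mu]_(s in (`[a, b]%classic : set R)) (c%:E))%E).
  rewrite integral_cst//= lebesgue_measure_itv/= lte_fin.
  move: ab; rewrite le_eqVlt => /predU1P[->|->]; last by rewrite EFinM.
  by rewrite subrr mulr0 ltxx mule0.
apply: (@le_trans _ _ (\int[mu]_(s in (`[a, b]%classic : set R)) ((f s)%:E))%E).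
  apply: ge0_le_integral => //.
  by case/integrableP : intf => + _; exact: measurable_funS.
apply: ge0_subset_integral => //; first by case/integrableP : intf.
by move=> s /=; rewrite in_itv/= andbT lee_fin; exact: f0.
Qed.

Lemma bigcup_itvcy (u : nat -> R) : (forall n, 0 < u n) ->
  u n @[n --> \oo] --> 0 -> \bigcup_n (`[u n, +oo[%classic : set R) = pos.
Proof.
move=> u0 cu; apply/seteqP; split => [x [n _]|x] /=; rewrite !in_itv/= !andbT.
  exact: lt_le_trans.
move=> x0; have /cvgr0_norm_le/(_ _ x0)[n _ /(_ n (leqnn n))] := cu.
by rewrite gtr0_norm// => un; exists n => //=; rewrite in_itv/= un.
Qed.

Lemma cvg_integral_itvcy (f : R -> R) (u : nat -> R) :
  {in `]0, +oo[, continuous f} -> (forall s, 0 < s -> 0 <= f s) ->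
  (forall n, 0 < u n) -> nonincreasing_seq u -> u n @[n --> \oo] --> 0 ->
  (\int[mu]_(x in (`[u n, +oo[%classic : set R)) (f x)%:E)%E @[n --> \oo] -->
  (\int[mu]_(x in pos) (f x)%:E)%E.
Proof.
move=> cf f0 u0 du cu; rewrite -(bigcup_itvcy u0 cu).
apply: ge0_nondecreasing_set_cvg_integral.
- move=> m n mn; rewrite subsetEset => x /=; rewrite !in_itv/= !andbT.
  by apply: le_trans; exact: du.
- by move=> n; exact: measurable_itv.
- move=> n; apply/measurable_EFinP.
  apply: (@measurable_funS _ _ _ _ pos) => //.
    by move=> x /=; rewrite !in_itv/= !andbT; exact: lt_le_trans.
  exact: continuous_pos_measurable.
- by move=> n x /=; rewrite in_itv/= andbT => /(lt_le_trans (u0 n)); rewrite lee_fin; exact: f0.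
Qed.

(** Substitution on closed half-lines, whose left end then tends to 0. *)
Lemma integral_pos_scale (f : R -> R) (k : R) : 0 < k ->
  {in `]0, +oo[, continuous f} -> (forall s, 0 < s -> 0 <= f s) ->
  (\int[mu]_(x in pos) (f x)%:E = \int[mu]_(x in pos) (f (k * x) * k)%:E)%E.
Proof.
move=> k0 cf f0.
pose u (n : nat) : R := n.+1%:R^-1.
have u0 n : 0 < u n by rewrite invr_gt0.
have du : nonincreasing_seq u.
  by apply/nonincreasing_seqP => n; rewrite /u lef_pV2 ?posrE// ler_nat.
have cu : u n @[n --> \oo] --> 0 by exact: cvg_harmonic.
have dk (x : R) : is_derive x 1 ( *%R k) k.
  have := is_deriveM_fun (is_derive_cst_fun x k) (is_derive_id x 1).
  by rewrite mul0r add0r mulr1.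
have dkE : derive1 ( *%R k) = cst k.
  by apply/funext => x; rewrite derive1E; case: (dk x).
have ck (x : R) : {for x, continuous ( *%R k)} := is_derive_continuous (dk x).
have lim1 : (\int[mu]_(x in (`[(k * u n)%R, +oo[%classic : set R)) (f x)%:E)%E @[n --> \oo] -->
    (\int[mu]_(x in pos) (f x)%:E)%E.
  apply: (@cvg_integral_itvcy f (fun n => k * u n)) => //.
  - by move=> n; rewrite mulr_gt0.
  - by move=> m n mn; rewrite ler_pM2l//; exact: du.
  - by rewrite -[X in _ --> X](mulr0 k); apply: cvgM; [exact: cvg_cst|].
have lim2 : (\int[mu]_(x in (`[u n, +oo[%classic : set R)) (f (k * x) * k)%:E)%E @[n --> \oo] -->
    (\int[mu]_(x in pos) (f (k * x) * k)%:E)%E.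
  apply: (@cvg_integral_itvcy (fun x => f (k * x) * k) u) => //.
  - move=> x; rewrite in_itv/= andbT => x0; apply: cvgM; last exact: cvg_cst.
    apply: (cvg_comp _ _ (ck x)); apply: cf.
    by rewrite in_itv/= andbT mulr_gt0.
  - by move=> s s0; rewrite mulr_ge0 ?(ltW k0)// f0// mulr_gt0.
apply/(cvg_unique _ lim1) => //.
rewrite (_ : (fun n => \int[mu]_(x in (`[(k * u n)%R, +oo[%classic : set R)) (f x)%:E)%E =
  (fun n => \int[mu]_(x in (`[u n, +oo[%classic : set R)) (f (k * x) * k)%:E)%E)//.
apply/funext => n.
have kpos x : x \in `]k * u n, +oo[ -> 0 < x.
  by rewrite in_itv/= andbT; apply: lt_trans; rewrite mulr_gt0.
rewrite (@increasing_ge0_integration_by_substitutiony _ ( *%R k) f (u n)) ?dkE//.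
- by move=> x y _ _; rewrite ltr_pM2l.
- by move=> x _; exact: cst_continuous.
- exact: is_cvg_cst.
- exact: is_cvg_cst.
- split; first by move=> x _; case: (dk x).
  by apply: cvg_at_right_filter; exact: ck.
- apply/cvgryPge => A; exists (k^-1 * A); split; first exact: num_real.
  by move=> x Ax; rewrite -ler_pdivrMl// ltW.
- apply: continuous_subspace_itv => x; rewrite in_itv/= andbT => x0.
  by apply: cf; rewrite in_itv/= andbT (lt_le_trans _ x0)// mulr_gt0.
- by move=> x /kpos; exact: f0.
Qed.

End scaling.

(** * The cumulant of one occupancy indicator *)

(** The moment generating function at [l] of the indicator that a Poisson
    process of rate 1 has a point before time [s]; [tilt l s] is the mean of this
    indicator under the exponentially tilted law, and [demix l s] the derivative
    of [ln (emix l s)] in [s]. *)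
Definition emix (R : realType) (l s : R) : R :=
  1 + (expR l - 1) * (1 - expR (- s)).

Definition tilt (R : realType) (l s : R) : R :=
  expR l * (1 - expR (- s)) / emix l s.

Definition demix (R : realType) (l s : R) : R :=
  (expR l - 1) * expR (- s) / emix l s.

Section tilt.
Context (R : realType).
Implicit Types (l s : R).

Lemma emixE l s : emix l s = expR (- s) + expR l * (1 - expR (- s)).
Proof. by rewrite /emix; ring. Qed.

Lemma emix_gt0 l s : 0 <= s -> 0 < emix l s.
Proof.
move=> s0; rewrite emixE ltr_pwDl ?expR_gt0// mulr_ge0 ?expR_ge0//.
exact: one_sub_expRN_ge0.
Qed.

(** [emix l s] is a convex combination of 1 and [expR l]. *)
Lemma emix_inv_le l s : 0 <= s -> (emix l s)^-1 <= 1 + expR (- l).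
Proof.
move=> s0; rewrite -[leLHS]mul1r ler_pdivrMr ?emix_gt0// emixE.
have := one_sub_expRN_ge0 s0; have := expR_gt0 (- s); have := expR_gt0 l.
have := expR_gt0 (- l); have : expR l * expR (- l) = 1 by rewrite -expRD subrr expR0.
set a := expR l; set b := expR (- l); set c := expR (- s) => ab b0 a0 c0 c1.
have -> : (1 + b) * (c + a * (1 - c)) = 1 + a * (1 - c) + b * c.
  transitivity (c + a * (1 - c) + b * c + a * b * (1 - c)); first by ring.
  by rewrite ab; ring.
by rewrite -addrA lerDl addr_ge0// mulr_ge0 ?(ltW a0) ?(ltW b0) ?(ltW c0).
Qed.

Lemma is_derive_emix_s l s : is_derive s 1 (emix l) ((expR l - 1) * expR (- s)).
Proof.
apply: (is_derive_eq (is_deriveD_fun (is_derive_cst_fun s 1)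
  (is_deriveM_fun (is_derive_cst_fun s (expR l - 1))
  (is_deriveB_fun (is_derive_cst_fun s 1) (is_derive_expRN s))))).
ring.
Qed.

Lemma is_derive_emix_l l s :
  is_derive l 1 (fun l => emix l s) (expR l * (1 - expR (- s))).
Proof.
apply: (is_derive_eq (is_deriveD_fun (is_derive_cst_fun l 1)
  (is_deriveM_fun (is_deriveB_fun (is_derive_expR l) (is_derive_cst_fun l 1))
    (is_derive_cst_fun l (1 - expR (- s)))))).
ring.
Qed.

Lemma is_derive_ln_emix_s l s : 0 <= s ->
  is_derive s 1 (fun s => ln (emix l s)) (demix l s).
Proof.
move=> s0; apply: (is_derive_eq (is_derive_comp_fun (is_derive_emix_s l s)
  (is_derive1_ln (emix_gt0 l s0)))).
by rewrite mulrC.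
Qed.

Lemma is_derive_ln_emix_l l s : 0 <= s ->
  is_derive l 1 (fun l => ln (emix l s)) (tilt l s).
Proof.
move=> s0; apply: (is_derive_eq (is_derive_comp_fun (is_derive_emix_l l s)
  (is_derive1_ln (emix_gt0 l s0)))).
by rewrite mulrC.
Qed.

(** The derivative of a tilted mean is the tilted variance, which for an
    indicator of mean [r] is [r (1 - r)]. *)
Lemma is_derive_tilt l s : 0 <= s ->
  is_derive l 1 (fun l => tilt l s) (tilt l s * (1 - tilt l s)).
Proof.
move=> s0; have e0 := emix_gt0 l s0; rewrite /tilt.
apply: (is_derive_eq (is_deriveM_fun
  (is_deriveM_fun (is_derive_expR l) (is_derive_cst_fun l (1 - expR (- s))))
  (is_deriveV_fun (f := fun l => emix l s) (lt0r_neq0 e0) (is_derive_emix_l l s)))).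
field; exact: lt0r_neq0.
Qed.

Lemma tilt_ge0 l s : 0 <= s -> 0 <= tilt l s.
Proof.
move=> s0; apply: divr_ge0; last exact/ltW/emix_gt0.
by rewrite mulr_ge0 ?expR_ge0// one_sub_expRN_ge0.
Qed.

Lemma tilt_le1 l s : 0 <= s -> tilt l s <= 1.
Proof.
by move=> s0; rewrite /tilt ler_pdivrMr ?emix_gt0// mul1r emixE lerDr expR_ge0.
Qed.

Lemma tilt_le l s : 0 <= s -> tilt l s <= (expR l + 1) * (1 - expR (- s)).
Proof.
move=> s0; have q0 := one_sub_expRN_ge0 s0.
rewrite /tilt -mulrA mulrCA mulrC ler_wpM2r//.
apply: (le_trans (ler_wpM2l (expR_ge0 l) (emix_inv_le l s0))).
by rewrite mulrDr mulr1 -expRD subrr expR0.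
Qed.

(** A nonpositive slope tilts the law towards 0. *)
Lemma tilt_le_q l s : l <= 0 -> 0 <= s -> tilt l s <= 1 - expR (- s).
Proof.
move=> l0 s0; have q0 := one_sub_expRN_ge0 s0.
rewrite /tilt ler_pdivrMr ?emix_gt0// mulrC ler_wpM2l// emixE.
have e1 : expR l <= 1 by rewrite -expR0 ler_expR.
have := expR_ge0 (- s); nra.
Qed.

(** Jensen's inequality for the indicator, obtained from [1 + x <= e^x] at the
    deviations [- l q] and [l (1 - q)] from the mean. *)
Lemma ln_emix_ge l s : 0 <= s -> l * (1 - expR (- s)) <= ln (emix l s).
Proof.
move=> s0; have q0 := one_sub_expRN_ge0 s0.
rewrite -ler_expR lnK ?posrE ?emix_gt0// /emix.
have c0 := expR_ge0 (- s); set q := 1 - expR (- s) in q0 *.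
have q1 : 0 <= 1 - q by rewrite /q opprB addrC subrK.
have -> : expR l = expR (l * q) * expR (l * (1 - q)) by rewrite -expRD; congr expR; ring.
have E1 : expR (l * q) * expR (- (l * q)) = 1 by rewrite -expRD subrr expR0.
have b1 := expR_ge1Dx (l * (1 - q)); have b2 := expR_ge1Dx (- (l * q)).
have E0 := expR_gt0 (l * q).
set E := expR (l * q) in E1 E0 *; set x := expR _ in E1 b2 *; set y := expR _ in b1 *.
have -> : 1 + (E * y - 1) * q = E * (x * (1 - q) + y * q).
  transitivity (1 * (1 - q) + E * y * q); first by ring.
  by rewrite -E1; ring.
rewrite -[leLHS]mulr1 ler_pM2l//.
apply: (@le_trans _ _ ((1 - l * q) * (1 - q) + (1 + l * (1 - q)) * q)).
  by rewrite le_eqVlt; apply/orP; left; apply/eqP; ring.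
by apply: lerD; rewrite ler_wpM2r.
Qed.

Lemma continuous_demix l s : 0 <= s -> {for s, continuous (demix l)}.
Proof.
move=> s0; exact: (is_derive_continuous (is_deriveM_fun (is_deriveM_fun
  (is_derive_cst_fun s (expR l - 1)) (is_derive_expRN s))
  (is_deriveV_fun (f := emix l) (lt0r_neq0 (emix_gt0 l s0)) (is_derive_emix_s l s)))).
Qed.

Lemma continuous_demix_pos l : {in `]0, +oo[, continuous (demix l)}.
Proof. by move=> s; rewrite in_itv/= andbT => /ltW; exact: continuous_demix. Qed.

(** The same constant dominates [ln (emix l s)] by [1 - e^(-s)] and its
    derivative by [e^(-s)]. *)
Definition emix_cst l : R := `|expR l - 1| * (1 + expR (- l)).

Lemma norm_demix_le l s : 0 <= s -> `|demix l s| <= emix_cst l * expR (- s).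
Proof.
move=> s0; rewrite /demix !normrM normfV [X in _ * X / _]ger0_norm ?expR_ge0//.
rewrite [X in _ / X]ger0_norm; last by rewrite ltW// emix_gt0.
by rewrite mulrAC ler_wpM2r ?expR_ge0// ler_wpM2l// emix_inv_le.
Qed.

Lemma ln_emix0 l : ln (emix l 0) = 0 :> R.
Proof. by rewrite /emix oppr0 expR0 subrr mulr0 addr0 ln1. Qed.

Lemma demix_ge0 (l s : R) : 0 <= l -> 0 <= s -> 0 <= demix l s.
Proof.
move=> l0 s0; have u0 : 0 <= expR l - 1 by rewrite subr_ge0 -expR0 ler_expR.
by rewrite /demix divr_ge0 ?mulr_ge0 ?expR_ge0// ltW// emix_gt0.
Qed.

Lemma ln_emix_bounds (l s : R) : 0 <= l -> 0 <= s ->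
  0 <= ln (emix l s) <= emix_cst l * (1 - expR (- s)).
Proof.
move=> l0 s0; have u0 : 0 <= expR l - 1 by rewrite subr_ge0 -expR0 ler_expR.
have q0 := one_sub_expRN_ge0 s0.
rewrite (le_trans _ (ln_emix_ge l s0)) ?mulr_ge0//=.
apply: (@le_trans _ _ ((expR l - 1) * (1 - expR (- s)))).
  by apply: le_ln1Dx; rewrite (lt_le_trans (ltrN10 _))// mulr_ge0.
by rewrite ler_wpM2r// /emix_cst ger0_norm// ler_peMr// lerDl expR_ge0.
Qed.

Lemma demixN_ge0 (l s : R) : l <= 0 -> 0 <= s -> 0 <= - demix l s.
Proof.
move=> l0 s0; have u0 : expR l - 1 <= 0 by rewrite subr_le0 -expR0 ler_expR.
rewrite oppr_ge0 /demix mulr_le0_ge0 ?invr_ge0 ?(ltW (emix_gt0 l s0))//.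
by rewrite mulr_le0_ge0 ?expR_ge0.
Qed.

Lemma lnN_emix_bounds (l s : R) : l <= 0 -> 0 <= s ->
  0 <= - ln (emix l s) <= emix_cst l * (1 - expR (- s)).
Proof.
move=> l0 s0; have u0 : expR l - 1 <= 0 by rewrite subr_le0 -expR0 ler_expR.
have q0 := one_sub_expRN_ge0 s0; have e0 := emix_gt0 l s0.
apply/andP; split.
  by rewrite oppr_ge0 ln_le0// /emix gerDl mulr_le0_ge0.
rewrite -lnV ?posrE// -[_^-1](subrK 1) addrC.
apply: (le_trans (le_ln1Dx _)); first by rewrite ltrBrDr addNr invr_gt0.
have -> : (emix l s)^-1 - 1 = - (expR l - 1) * (1 - expR (- s)) * (emix l s)^-1.
  by rewrite /emix; field; rewrite -/(emix l s) gt_eqF.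
rewrite /emix_cst ler0_norm// -!mulrA ler_wpM2l ?oppr_ge0// mulrC ler_wpM2r//.
exact/emix_inv_le.
Qed.

Lemma demix_le (l s : R) : 0 <= s -> demix l s <= emix_cst l * expR (- s).
Proof. by move=> s0; apply: le_trans (ler_norm _) (norm_demix_le l s0). Qed.

Lemma demixN_le (l s : R) : 0 <= s -> - demix l s <= emix_cst l * expR (- s).
Proof.
move=> s0; apply: le_trans (norm_demix_le l s0).
by rewrite -normrN ler_norm.
Qed.

End tilt.

(** * The limiting cumulant and its series *)

Section cumulant.
Context (R : realType) (gamma : R).
Hypothesis gamma01 : 0 < gamma < 1.
Notation mu := (@lebesgue_measure R).
Notation pos := (`]0, +oo[%classic : set R).

Let gamma0 : 0 < gamma. Proof. by case/andP: gamma01. Qed.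

Lemma GammaE : Gamma (1 - gamma) = \int[mu]_(s in pos) (s `^ (- gamma) * expR (- s)).
Proof. by rewrite /Gamma addrAC subrr add0r. Qed.

Lemma Gamma_gt0 : 0 < Gamma (1 - gamma).
Proof.
rewrite GammaE.
have c0 : 0 < 2 `^ (- gamma) * expR (- 2) :> R by rewrite mulr_gt0 ?powR_gt0 ?expR_gt0.
apply: lt_le_trans (@le_integral_interval _ _ 1 2 (2 `^ (- gamma) * expR (- 2)) _ _ _ _ _).
- by rewrite mulr_gt0// subr_gt0 ltr1n.
- by rewrite ltr01 ler1n.
- exact: gamma_integrable.
- by move=> s _; rewrite mulr_ge0 ?powR_ge0 ?expR_ge0.
- exact: ltW.
- move=> s /andP[s1 s2]; apply: ler_pM; rewrite ?powR_ge0 ?expR_ge0//.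
    have s0 : 0 < s by exact: lt_le_trans s1.
    rewrite !powRN lef_pV2 ?posrE ?powR_gt0//.
    by rewrite ge0_ler_powR ?nnegrE ?(ltW gamma0) ?(ltW s0).
  by rewrite ler_expR lerN2.
Qed.

Lemma integral_expRN_powR (k : R) : 0 < k ->
  mu.-integrable pos (fun s => (expR (- (k * s)) * s `^ (- gamma))%:E) /\
  \int[mu]_(s in pos) (expR (- (k * s)) * s `^ (- gamma)) =
    k `^ (gamma - 1) * Gamma (1 - gamma).
Proof.
move=> k0.
pose f (s : R) := k `^ (gamma - 1) * (s `^ (- gamma) * expR (- s)).
pose g (s : R) := expR (- (k * s)) * s `^ (- gamma).
have cf : {in `]0, +oo[, continuous f}.
  by move=> s spos; apply: cvgM; [exact: cvg_cst|exact: continuous_powR_expRN].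
have f0 (s : R) : 0 < s -> 0 <= f s.
  by move=> s0; rewrite /f !mulr_ge0 ?powR_ge0 ?expR_ge0.
have fE : (\int[mu]_(s in pos) (f s)%:E = (k `^ (gamma - 1) * Gamma (1 - gamma))%:E)%E.
  rewrite EFinM GammaE /Rintegral fineK; last first.
    by apply: integrable_fin_num; [exact: measurable_itv|exact: gamma_integrable].
  rewrite -integralZl//; last exact: gamma_integrable.
have gE : (\int[mu]_(s in pos) (g s)%:E = (k `^ (gamma - 1) * Gamma (1 - gamma))%:E)%E.
  rewrite -fE (integral_pos_scale k0 cf f0); apply: eq_integral => s.
  rewrite inE/= in_itv/= andbT => s0; congr EFin; rewrite /f /g.
  rewrite powRM ?ltW//.
  have -> : k `^ (gamma - 1) * (k `^ (- gamma) * s `^ (- gamma) * expR (- (k * s))) * k =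
    (k `^ (gamma - 1) * k `^ (- gamma) * k) * (s `^ (- gamma) * expR (- (k * s))) by ring.
  rewrite -powRD; last by rewrite (gt_eqF k0) implybT.
  rewrite addrAC subrr add0r powR_inv1 ?(ltW k0)// mulVf ?gt_eqF// mul1r mulrC//.
have g0 (s : R) : 0 < s -> 0 <= g s.
  by move=> s0; rewrite mulr_ge0 ?powR_ge0 ?expR_ge0.
have cg : {in `]0, +oo[, continuous g}.
  apply: pos_continuous => s s0; eexists.
  apply: (is_deriveM_fun (is_derive_comp_fun (is_deriveN_fun (is_deriveM_fun
    (is_derive_cst_fun s k) (is_derive_id s 1))) (is_derive_expR _))
    (is_derive_powR_fun _ s0)).
split; first exact: ge0_pos_integrable gE.
by rewrite /Rintegral gE.
Qed.

Lemma integral_expRN_powR1 :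
  \int[mu]_(s in pos) (expR (- s) * s `^ (- gamma)) = Gamma (1 - gamma).
Proof. by rewrite GammaE; apply: eq_Rintegral => s _; rewrite mulrC. Qed.

Lemma one_sub_expRN_parts :
  mu.-integrable pos (fun s => ((1 - expR (- s)) / s `^ (1 + gamma))%:E) /\
  gamma * \int[mu]_(s in pos) ((1 - expR (- s)) / s `^ (1 + gamma)) =
    Gamma (1 - gamma).
Proof.
have [] := @integral_powR_parts _ _ gamma01 (fun s => 1 - expR (- s))
  (fun s => expR (- s)) 1.
- move=> s s0; apply: (is_derive_eq (is_deriveB_fun (is_derive_cst_fun s 1) (is_derive_expRN s))).
  by rewrite sub0r opprK.
- by apply: pos_continuous => s s0; eexists; exact: is_derive_expRN.
- by move=> s s0; rewrite expR_ge0 mul1r lexx.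
- by move=> s s0; rewrite mul1r lexx one_sub_expRN_ge0// ltW.
- by move=> _ ? ->; rewrite integral_expRN_powR1.
Qed.

(** Both [ln (emix l s)] and [demix l s] have the sign of [l], so that
    integration by parts applies to them or to their opposites. *)
Lemma ln_emix_parts (l : R) :
  [/\ mu.-integrable pos (fun s => (demix l s * s `^ (- gamma))%:E),
      mu.-integrable pos (fun s => (Lambda_integrand gamma l s)%:E) &
      gamma * \int[mu]_(s in pos) Lambda_integrand gamma l s =
      \int[mu]_(s in pos) (demix l s * s `^ (- gamma))].
Proof.
have [l0|/ltW l0] := leP 0 l.
  apply: (@integral_powR_parts _ _ gamma01 (fun s => ln (emix l s)) (demix l) (emix_cst l)).
  - by move=> s s0; exact/is_derive_ln_emix_s/ltW.
  - exact: continuous_demix_pos.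
  - by move=> s /ltW s0; rewrite demix_ge0 ?demix_le.
  - by move=> s /ltW; exact: ln_emix_bounds.
have [||||I1 I2 I3] := @integral_powR_parts _ _ gamma01 (fun s => - ln (emix l s))
  (fun s => - demix l s) (emix_cst l).
- by move=> s s0; apply: is_deriveN_fun; exact/is_derive_ln_emix_s/ltW.
- by move=> s spos; apply: cvgN; exact: continuous_demix_pos.
- by move=> s /ltW s0; rewrite demixN_ge0 ?demixN_le.
- by move=> s /ltW; exact: lnN_emix_bounds.
split.
- have I4 : mu.-integrable pos (fun s => (-1 * (- demix l s * s `^ (- gamma)))%:E).
    by apply: (integrableZl _ (-1) I1).
  by apply: eq_integrable I4 => // s _; rewrite mulN1r mulNr opprK.
- have I5 : mu.-integrable pos (fun s => (-1 * (- ln (emix l s) / s `^ (1 + gamma)))%:E).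
    by apply: (integrableZl _ (-1) I2).
  by apply: eq_integrable I5 => // s _; rewrite mulN1r mulNr opprK.
- have -> : \int[mu]_(s in pos) (demix l s * s `^ (- gamma)) =
      -1 * \int[mu]_(s in pos) (- demix l s * s `^ (- gamma)).
    rewrite -RintegralZl//; apply: eq_Rintegral => s _.
    by rewrite mulN1r mulNr opprK.
  rewrite -I3 mulrCA; congr (_ * _); rewrite -RintegralZl//.
  by apply: eq_Rintegral => s _; rewrite mulN1r mulNr opprK.
Qed.

Lemma LambdaE (l : R) : Lambda gamma l =
  - l + (\int[mu]_(s in pos) (demix l s * s `^ (- gamma))) / Gamma (1 - gamma).
Proof.
have [_ _ <-] := ln_emix_parts l.
by rewrite /Lambda; congr (_ + _); rewrite mulrAC.
Qed.

Lemma Lambda0 : Lambda gamma 0 = 0.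
Proof.
rewrite LambdaE; under eq_Rintegral do rewrite /demix expR0 subrr !mul0r.
by rewrite /Rintegral integral0 mul0r oppr0 addr0.
Qed.

(** Jensen's inequality under the integral: [Gamma (1 - gamma)] is the constant
    for which the linear terms cancel. *)
Lemma Lambda_ge0 (l : R) : 0 <= Lambda gamma l.
Proof.
have [q1 q2] := one_sub_expRN_parts.
have [_ l1 _] := ln_emix_parts l.
rewrite /Lambda addrC subr_ge0 -mulrA mulrCA mulrC ler_pdivlMr ?Gamma_gt0//.
rewrite -q2 mulrCA ler_pM2l// -RintegralZl//.
have q3 : mu.-integrable pos (EFin \o (fun s => l * ((1 - expR (- s)) / s `^ (1 + gamma)))).
  by apply: (integrableZl _ l q1).
apply: le_Rintegral => //.
move=> s /=; rewrite in_itv/= andbT => s0.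
by rewrite /Lambda_integrand mulrA ler_wpM2r ?invr_ge0 ?powR_ge0// ln_emix_ge// ltW.
Qed.

(** For [l <= 0] the integrand is nonpositive. This is the trace of [Y >= -1],
    and it makes the rate infinite below -1. *)
Lemma Lambda_le_linear (l : R) : l <= 0 -> Lambda gamma l <= -1 * l.
Proof.
move=> l0; rewrite mulN1r LambdaE gerDl.
apply: mulr_le0_ge0; last by rewrite invr_ge0 ltW// Gamma_gt0.
have [d1 _ _] := ln_emix_parts l.
rewrite -oppr_ge0 -mulN1r -RintegralZl//; apply: Rintegral_ge0 => s /=.
rewrite in_itv/= andbT => /ltW s0.
by rewrite mulN1r -mulNr mulr_ge0 ?powR_ge0// demixN_ge0.
Qed.

Definition lambda_coef (n : nat) : R :=
  \sum_(1 <= k < n.+1) (-1) ^+ k / k%:R `^ (1 - gamma) * 'C(n.-1, k.-1)%:R.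

Lemma Rintegral_sum (n : nat) (f : nat -> R -> R) :
  (forall i, mu.-integrable pos (EFin \o f i)) ->
  mu.-integrable pos (fun s => (\sum_(i < n) f i s)%:E) /\
  \int[mu]_(s in pos) (\sum_(i < n) f i s) = \sum_(i < n) \int[mu]_(s in pos) f i s.
Proof.
move=> fi; elim: n => [|n [IH1 IH2]].
  have E : (fun s => \sum_(i < 0) f i s) = cst 0.
    by apply/funext => s; rewrite big_ord0.
  split; last by rewrite E big_ord0 /Rintegral integral0.
  have : mu.-integrable pos (fun=> 0%E) by exact: integrable0.
  by apply: eq_integrable => // s _; rewrite big_ord0.
have E : (fun s => \sum_(i < n.+1) f i s) = (fun s => \sum_(i < n) f i s + f n s).
  by apply/funext => s; rewrite big_ord_recr.
split; last by rewrite E RintegralD// big_ord_recr/= IH2.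
have : mu.-integrable pos (fun s => (\sum_(i < n) f i s)%:E + (f n s)%:E)%E.
  by apply: integrableD => //; exact: fi.
by apply: eq_integrable => // s _; rewrite big_ord_recr.
Qed.

(** The binomial expansion of [(1 - e^(-s))^n]: the integral of each exponential
    against [s^(-gamma)] is a power of its rate. *)
Lemma lambda_coefE (n : nat) :
  mu.-integrable pos (fun s => (expR (- s) * (1 - expR (- s)) ^+ n * s `^ (- gamma))%:E) /\
  lambda_coef n.+1 * Gamma (1 - gamma) =
  - \int[mu]_(s in pos) (expR (- s) * (1 - expR (- s)) ^+ n * s `^ (- gamma)).
Proof.
pose c (j : nat) : R := (-1) ^+ j * 'C(n, j)%:R.
pose f (j : nat) (s : R) := c j * (expR (- (j.+1%:R * s)) * s `^ (- gamma)).
have fi j : mu.-integrable pos (EFin \o f j).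
  have [i1 _] := @integral_expRN_powR j.+1%:R (ltr0Sn _ _).
  exact: (integrableZl _ (c j) i1).
have fE (s : R) : expR (- s) * (1 - expR (- s)) ^+ n * s `^ (- gamma) =
    \sum_(j < n.+1) f j s.
  rewrite exprBn mulr_sumr mulr_suml; apply: eq_bigr => j _.
  rewrite expr1n mulr1 /f /c -[- (_ * s)]mulrN expRM_natl exprS -mulr_natr.
  ring.
have [s1 s2] := Rintegral_sum n.+1 fi.
split; first by apply: eq_integrable s1 => // s _; rewrite fE.
rewrite (_ : (fun s => expR _ * _ * _) = (fun s => \sum_(j < n.+1) f j s)); last first.
  by apply/funext => s; exact: fE.
rewrite s2 /lambda_coef big_add1 /= big_mkord mulr_suml -sumrN; apply: eq_bigr => j _.
have [i1 i2] := @integral_expRN_powR j.+1%:R (ltr0Sn _ _).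
rewrite /f RintegralZl// i2 /c exprS mulN1r -powRN opprB; ring.
Qed.

(** With [a = 1 - e^l] and [q = 1 - e^(-s)], [demix l s] is
    [- a e^(-s) / (1 - a q)]; its geometric series is integrated against
    [s^(-gamma)]. The remainder after [N] terms is [g N], and [l < ln 2] means
    [`|a| < 1]. *)
Lemma Lambda_series (l : R) : l < ln 2 ->
  - l + \sum_(1 <= n < N.+1) (1 - expR l) ^+ n * lambda_coef n
    @[N --> \oo] --> Lambda gamma l.
Proof.
move=> l2; set a := 1 - expR l.
have a1 : `|a| < 1.
  have e2 : expR l < 2 by rewrite -[ltRHS]lnK ?posrE// ltr_expR.
  by have e0 := expR_gt0 l; rewrite ltr_norml /a; apply/andP; split; lra.
have G0 := Gamma_gt0.
have [d1 _ _] := ln_emix_parts l.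
have K0 : 0 <= emix_cst l by rewrite mulr_ge0// addr_ge0// expR_ge0.
pose w (n : nat) (s : R) := expR (- s) * (1 - expR (- s)) ^+ n * s `^ (- gamma).
pose g0 (n : nat) (s : R) := demix l s * (a * (1 - expR (- s))) ^+ n.
pose g (n : nat) (s : R) := g0 n s * s `^ (- gamma).
have g0_le n (s : R) : 0 < s -> `|g0 n s| <= emix_cst l * `|a| ^+ n * expR (- s).
  move=> s0; rewrite /g0 normrM normrX (normrM a) [leRHS]mulrAC ler_pM ?exprn_ge0//.
  - exact/norm_demix_le/ltW.
  - have q0 := one_sub_expRN_ge0 (ltW s0).
    rewrite lerXn2r ?nnegrE ?mulr_ge0// ?normr_ge0// [X in _ * X <= _]ger0_norm//.
    by rewrite ler_piMr// one_sub_expRN_le1.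
have cg0 n : {in `]0, +oo[, continuous (g0 n)}.
  move=> s spos; apply: cvgM; first exact: continuous_demix_pos.
  have ca := is_derive_continuous (is_deriveM_fun (is_derive_cst_fun s a)
    (is_deriveB_fun (is_derive_cst_fun s 1) (is_derive_expRN s))).
  exact: (continuous_comp ca (@exprn_continuous R n _)).
have ig n : mu.-integrable pos (EFin \o g n).
  exact: (le_gamma_integrable gamma01 (cg0 n) (g0_le n)).
have partial N : \sum_(1 <= n < N.+1) a ^+ n * lambda_coef n =
    (\int[mu]_(s in pos) (demix l s * s `^ (- gamma)) -
     \int[mu]_(s in pos) g N s) / Gamma (1 - gamma).
  apply/(canRL (mulfK (lt0r_neq0 G0))).
  rewrite big_add1/= big_mkord mulr_suml.
  pose f (i : nat) (s : R) := - a ^+ i.+1 * w i s.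
  have iw i : mu.-integrable pos (EFin \o w i) by have [] := lambda_coefE i.
  have fi i : mu.-integrable pos (EFin \o f i).
    exact: (integrableZl _ (- a ^+ i.+1) (iw i)).
  rewrite -RintegralB//.
  transitivity (\int[mu]_(s in pos) (\sum_(i < N) f i s)).
    have [_ ->] := Rintegral_sum N fi; apply: eq_bigr => i _.
    have [_ wi] := lambda_coefE i.
    by rewrite -mulrA wi /f RintegralZl// mulNr mulrN.
  apply: eq_Rintegral => s; rewrite inE/= in_itv/= andbT => s0.
  have e0 := emix_gt0 l (ltW s0).
  rewrite /g /g0 -mulrBl -[X in X - _]mulr1 -mulrBr.
  have -> : 1 - (a * (1 - expR (- s))) ^+ N =
      emix l s * \sum_(i < N) (a * (1 - expR (- s))) ^+ i.
    by rewrite -opprB subrX1 -mulNr; congr (_ * _); rewrite /emix /a; ring.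
  rewrite /demix mulrA divfK ?gt_eqF// mulr_sumr mulr_suml; apply: eq_bigr => i _.
  by rewrite /f /w /a exprMn exprS; ring.
rewrite LambdaE; apply: cvgD; first exact: cvg_cst.
under eq_fun do rewrite partial.
set I := \int[mu]_(s in pos) (demix l s * s `^ (- gamma)).
suff cg : \int[mu]_(s in pos) g N s @[N --> \oo] --> 0.
  have : (I - \int[mu]_(s in pos) g N s) / Gamma (1 - gamma) @[N --> \oo] -->
      (I - 0) / Gamma (1 - gamma).
    by apply: cvgM; [apply: cvgB => //; exact: cvg_cst|exact: cvg_cst].
  by rewrite subr0.
apply/norm_cvg0P.
apply: (@squeeze_cvgr _ _ _ _ (cst 0) (fun n => emix_cst l * `|a| ^+ n * Gamma (1 - gamma))).
- apply: nearW => n; rewrite normr_ge0/=.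
  apply: (le_trans (le_normr_Rintegral _ (ig n))) => //.
  have iG := gamma_integrable gamma01.
  rewrite GammaE -RintegralZl//; apply: le_Rintegral => //.
  + exact: (integrable_abse (ig n)).
  + exact: (integrableZl _ (emix_cst l * `|a| ^+ n) iG).
  + move=> s /=; rewrite in_itv/= andbT => s0.
    rewrite /g normrM [X in _ * X <= _]ger0_norm ?powR_ge0//.
    by rewrite mulrCA mulrC ler_wpM2l ?powR_ge0// g0_le.
- exact: cvg_cst.
- have ca : `|a| ^+ n @[n --> \oo] --> 0 by apply: cvg_expr; rewrite normr_id.
  have : emix_cst l * `|a| ^+ n * Gamma (1 - gamma) @[n --> \oo] --> emix_cst l * 0 * Gamma (1 - gamma).
    by apply: cvgM; [apply: cvgM => //; exact: cvg_cst|exact: cvg_cst].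
  by rewrite mulr0 mul0r.
Qed.

End cumulant.

(** * Smoothness of the limiting cumulant and range of its derivative *)

Section smooth.
Context (R : realType) (gamma : R).
Hypothesis gamma01 : 0 < gamma < 1.
Notation mu := (@lebesgue_measure R).
Notation pos := (`]0, +oo[%classic : set R).

Let gamma0 : 0 < gamma. Proof. by case/andP: gamma01. Qed.

(** The factor ['X] keeps the integrand of order [s^(-gamma)] near 0. By
    [is_derive_tilt], these integrals are stable under differentiation. *)
Definition tilt_integral (p : {poly R}) (l : R) : R :=
  \int[mu]_(s in pos) ((p * 'X).[tilt l s] / s `^ (1 + gamma)).

Lemma norm_horner_le (p : {poly R}) :
  exists2 C : R, 0 <= C & forall x, 0 <= x <= 1 -> `|p.[x]| <= C.
Proof.
exists (\sum_(i < size p) `|p`_i|); first exact: sumr_ge0.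
move=> x /andP[x0 x1]; rewrite horner_coef (le_trans (ler_norm_sum _ _ _))//.
apply: ler_sum => i _; rewrite normrM ler_piMr// normrX ger0_norm//.
exact: exprn_ile1.
Qed.

Lemma tilt_in01 (l s : R) : 0 < s -> 0 <= tilt l s <= 1.
Proof. by move=> s0; rewrite tilt_ge0 ?tilt_le1 ?ltW. Qed.

Lemma continuous_tilt_s (l : R) : {in `]0, +oo[, continuous (tilt l)}.
Proof.
apply: pos_continuous => s s0; eexists; rewrite /tilt.
apply: (is_deriveM_fun (is_deriveM_fun (is_derive_cst_fun s (expR l))
  (is_deriveB_fun (is_derive_cst_fun s 1) (is_derive_expRN s)))
  (is_deriveV_fun _ (is_derive_emix_s l s))).
exact/lt0r_neq0/emix_gt0/ltW.
Qed.

(** The bound is locally uniform in [l], as differentiation under the integral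
    sign requires. *)
Lemma tilt_integrand_le (p : {poly R}) : exists2 C : R, 0 <= C &
  forall l s, 0 < s -> `|(p * 'X).[tilt l s] / s `^ (1 + gamma)| <=
    C * (expR l + 1) * ((1 - expR (- s)) / s `^ (1 + gamma)).
Proof.
have [C C0 HC] := norm_horner_le p; exists C => // l s s0.
rewrite normrM [X in _ * X <= _]ger0_norm ?invr_ge0 ?powR_ge0//.
rewrite mulrA ler_wpM2r ?invr_ge0 ?powR_ge0// hornerMX normrM -mulrA.
have t01 := tilt_in01 l s0; have /andP[t0 _] := t01.
apply: ler_pM => //; first exact: HC.
by rewrite ger0_norm// tilt_le// ltW.
Qed.

Lemma tilt_integrable (p : {poly R}) (l : R) :
  mu.-integrable pos (EFin \o (fun s => (p * 'X).[tilt l s] / s `^ (1 + gamma))).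
Proof.
have [C C0 HC] := tilt_integrand_le p.
have [q1 _] := one_sub_expRN_parts gamma01.
apply: (@le_integrable _ _ _ mu pos _ _
  (fun s => ((C * (expR l + 1))%:E * ((1 - expR (- s)) / s `^ (1 + gamma))%:E)%E)) => //.
- apply/measurable_EFinP; apply: continuous_pos_measurable => s spos.
  have s0 : 0 < s by move: spos; rewrite in_itv/= andbT.
  apply: cvgM; first exact: (continuous_comp (@continuous_tilt_s l s spos) (@continuous_horner _ _ _)).
  apply: cvgV; first by rewrite gt_eqF// powR_gt0.
  exact: continuous_pos_powR.
- move=> s /=; rewrite in_itv/= andbT => s0; rewrite lee_fin.
  exact: le_trans (HC l s s0) (ler_norm _).
- exact: integrableZl.
Qed.

Lemma is_derive_tilt_integrand (p : {poly R}) (l s : R) : 0 < s ->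
  is_derive l 1 (fun l => (p * 'X).[tilt l s] / s `^ (1 + gamma))
   (((p * 'X)^`() * (1 - 'X) * 'X).[tilt l s] / s `^ (1 + gamma)).
Proof.
move=> s0.
apply: (is_derive_eq (is_deriveM_fun (is_derive_comp_fun
  (is_derive_tilt l (ltW s0)) (is_derive_poly (p * 'X) _)) (is_derive_cst_fun l _))).
by rewrite mulr0 addr0 !hornerE/= ; ring.
Qed.

Lemma is_derive_tilt_integral (p : {poly R}) (l : R) :
  is_derive l 1 (tilt_integral p) (tilt_integral ((p * 'X)^`() * (1 - 'X)) l).
Proof.
pose f (l s : R) := (p * 'X).[tilt l s] / s `^ (1 + gamma).
have [C C0 HC] := tilt_integrand_le ((p * 'X)^`() * (1 - 'X)).
have [q1 _] := one_sub_expRN_parts gamma01.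
pose G (s : R) := C * (expR (l + 1) + 1) * `|(1 - expR (- s)) / s `^ (1 + gamma)|.
have df (x s : R) : pos s -> is_derive x 1 (fun l => f l s)
    (((p * 'X)^`() * (1 - 'X) * 'X).[tilt x s] / s `^ (1 + gamma)).
  by rewrite /= in_itv/= andbT => s0; exact: is_derive_tilt_integrand.
have pE x s : pos s -> partial1of2 f x s =
    ((p * 'X)^`() * (1 - 'X) * 'X).[tilt x s] / s `^ (1 + gamma).
  by move=> ps; rewrite partial1of2E; case: (df x s ps).
have lI : (`]l - 1, l + 1[%classic : set R) l.
  by rewrite /= in_itv/=; apply/andP; split; lra.
have fI x : (`]l - 1, l + 1[%classic : set R) x -> mu.-integrable pos (EFin \o f x).
  by move=> _; exact: tilt_integrable.
have fD (x s : R) : (`]l - 1, l + 1[%classic : set R) x -> pos s -> derivable (f ^~ s) x 1.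
  by move=> _ ps; case: (df x s ps).
have G0 s : 0 <= G s.
  by rewrite !mulr_ge0// addr_ge0// expR_ge0.
have GI : mu.-integrable pos (EFin \o G).
  exact: (integrableZl _ (C * (expR (l + 1) + 1)) (integrable_abse q1)).
have Gub (x s : R) : (`]l - 1, l + 1[%classic : set R) x -> pos s -> `|partial1of2 f x s| <= G s.
  move=> /=; rewrite !in_itv/= andbT => /andP[_ xl] s0.
  rewrite pE; last by rewrite /= in_itv/= andbT.
  apply: (le_trans (HC x s s0)); rewrite /G ler_pM ?ler_norm//.
  - by rewrite mulr_ge0// addr_ge0// expR_ge0.
  - by rewrite divr_ge0 ?powR_ge0// one_sub_expRN_ge0// ltW.
  - by rewrite ler_wpM2l// lerD2r ler_expR ltW.
apply: DeriveDef; first exact: (derivable_under_integral _ lI fI fD G0 GI Gub).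
rewrite -derive1E (differentiation_under_integral _ lI fI fD G0 GI Gub)//.
by apply: eq_Rintegral => s; rewrite inE => ps; exact: pE.
Qed.

Lemma is_derive_integral_ln_emix (l : R) :
  is_derive l 1 (fun l => \int[mu]_(s in pos) Lambda_integrand gamma l s)
    (tilt_integral 1 l).
Proof.
have [q1 _] := one_sub_expRN_parts gamma01.
pose G (s : R) := (expR (l + 1) + 1) * `|(1 - expR (- s)) / s `^ (1 + gamma)|.
have df (x s : R) : pos s -> is_derive x 1 (fun l => Lambda_integrand gamma l s)
    (tilt x s / s `^ (1 + gamma)).
  rewrite /= in_itv/= andbT => s0.
  apply: (is_derive_eq (is_deriveM_fun (is_derive_ln_emix_l x (ltW s0))
    (is_derive_cst_fun x (s `^ (1 + gamma))^-1))).
  by rewrite mulr0 addr0.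
have pE x s : pos s -> partial1of2 (Lambda_integrand gamma) x s = tilt x s / s `^ (1 + gamma).
  by move=> ps; rewrite partial1of2E; case: (df x s ps).
have lI : (`]l - 1, l + 1[%classic : set R) l.
  by rewrite /= in_itv/=; apply/andP; split; lra.
have fI x : (`]l - 1, l + 1[%classic : set R) x ->
    mu.-integrable pos (EFin \o Lambda_integrand gamma x).
  by move=> _; have [] := ln_emix_parts gamma01 x.
have fD (x s : R) : (`]l - 1, l + 1[%classic : set R) x -> pos s ->
    derivable (fun l => Lambda_integrand gamma l s) x 1.
  by move=> _ ps; case: (df x s ps).
have G0 s : 0 <= G s by rewrite mulr_ge0// addr_ge0// expR_ge0.
have GI : mu.-integrable pos (EFin \o G).
  exact: (integrableZl _ (expR (l + 1) + 1) (integrable_abse q1)).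
have Gub (x s : R) : (`]l - 1, l + 1[%classic : set R) x -> pos s ->
    `|partial1of2 (Lambda_integrand gamma) x s| <= G s.
  move=> /=; rewrite !in_itv/= andbT => /andP[_ xl] s0.
  rewrite pE; last by rewrite /= in_itv/= andbT.
  have := tilt_ge0 x (ltW s0) => t0.
  have -> : G s = (expR (l + 1) + 1) * (1 - expR (- s)) / s `^ (1 + gamma).
    by rewrite /G ger0_norm ?mulrA// divr_ge0 ?powR_ge0// one_sub_expRN_ge0// ltW.
  rewrite ger0_norm; last by rewrite divr_ge0 ?powR_ge0.
  rewrite ler_wpM2r ?invr_ge0 ?powR_ge0//.
  apply: (le_trans (tilt_le x (ltW s0))); rewrite ler_pM ?ler_norm//.
  - by rewrite one_sub_expRN_ge0// ltW.
  - by rewrite lerD2r ler_expR ltW.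
apply: DeriveDef; first exact: (derivable_under_integral _ lI fI fD G0 GI Gub).
rewrite -derive1E (differentiation_under_integral _ lI fI fD G0 GI Gub)//.
by apply: eq_Rintegral => s; rewrite inE => ps; rewrite mul1r hornerX; exact: pE.
Qed.

Let c : R := gamma / Gamma (1 - gamma).

Lemma is_derive_Lambda (l : R) :
  is_derive l 1 (Lambda gamma) (-1 + c * tilt_integral 1 l).
Proof.
apply: (is_derive_eq (is_deriveD_fun (is_deriveN_fun (is_derive_id l 1))
  (is_deriveM_fun (is_derive_cst_fun l c) (is_derive_integral_ln_emix l)))).
by rewrite mul0r add0r.
Qed.

Lemma derive1_Lambda (l : R) : derive1 (Lambda gamma) l = -1 + c * tilt_integral 1 l.
Proof. by rewrite derive1E; case: (is_derive_Lambda l). Qed.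

(** Up to an additive constant, every derivative of [Lambda gamma] is a multiple
    of some [tilt_integral p]. *)
Lemma smooth_Lambda : smooth (Lambda gamma).
Proof.
move=> n.
have dform (b : R) (p : {poly R}) (x : R) :
    is_derive x 1 (fun l => b + c * tilt_integral p l)
      (c * tilt_integral ((p * 'X)^`() * (1 - 'X)) x).
  apply: (is_derive_eq (is_deriveD_fun (is_derive_cst_fun x b)
    (is_deriveM_fun (is_derive_cst_fun x c) (is_derive_tilt_integral p x)))).
  by rewrite mul0r !add0r.
have form m : exists b p, derive1n m.+1 (Lambda gamma) = fun l => b + c * tilt_integral p l.
  elim: m => [|m [b [p IH]]].
    by exists (-1), 1; apply/funext => l; exact: derive1_Lambda.
  exists 0, ((p * 'X)^`() * (1 - 'X)); apply/funext => l.
  by rewrite derive1nS IH derive1E add0r; case: (dform b p l).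
case: n => [|n] x; first by case: (is_derive_Lambda x).
by have [b [p ->]] := form n; case: (dform b p x).
Qed.

Lemma derivable_Lambda x : derivable (Lambda gamma) x 1.
Proof. by case: (is_derive_Lambda x). Qed.

Lemma continuous_tilt_integral p : continuous (tilt_integral p).
Proof. by move=> l; exact: is_derive_continuous (is_derive_tilt_integral p l). Qed.

(** Dominated convergence: the tilted mean tends to 0 as the slope tends to
    [-oo], and it is at most [1 - e^(-s)] for nonpositive slopes. *)
Lemma tilt_integral_cvgN : tilt_integral 1 (- n%:R) @[n --> \oo] --> 0.
Proof.
have [q1 _] := one_sub_expRN_parts gamma01.
pose f (n : nat) (s : R) := (1 * 'X).[tilt (- n%:R) s] / s `^ (1 + gamma).
have fE n s : f n s = tilt (- n%:R) s / s `^ (1 + gamma).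
  by rewrite /f mul1r hornerX.
have : (\int[mu]_(s in pos) (f n s)%:E)%E @[n --> \oo] --> (\int[mu]_(s in pos) (cst 0 s))%E.
  apply: (@dominated_cvg _ _ _ mu pos _ _ _
    (fun s => `|((1 - expR (- s)) / s `^ (1 + gamma))%:E|%E)) => //.
  - move=> n; have /integrableP[] := tilt_integrable 1 (- n%:R) => //.
  - move=> s /=; rewrite in_itv/= andbT => s0; apply: cvg_EFin; first exact: nearW.
    rewrite /comp/=; under eq_fun do rewrite fE.
    apply: (@squeeze_cvgr _ _ _ _ (cst 0) (fun n => expR (- n%:R) * ((1 - expR (- s)) * expR s / s `^ (1 + gamma)))).
    + apply: nearW => n; rewrite divr_ge0 ?tilt_ge0 ?powR_ge0 ?(ltW s0)//=.
      rewrite !mulrA ler_wpM2r ?invr_ge0 ?powR_ge0// /tilt ler_wpM2l//.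
        by rewrite mulr_ge0 ?expR_ge0// one_sub_expRN_ge0 ?ltW.
      rewrite -[expR s]invrK -expRN lef_pV2 ?posrE ?expR_gt0 ?emix_gt0 ?(ltW s0)//.
      by rewrite emixE lerDl mulr_ge0 ?expR_ge0// one_sub_expRN_ge0 ?ltW.
    + exact: cvg_cst.
    + rewrite -[X in _ --> X](mul0r ((1 - expR (- s)) * expR s / s `^ (1 + gamma))).
      apply: cvgM; last exact: cvg_cst.
      exact: cvgn_expR.
  - exact: integrable_abse.
  - move=> n s /=; rewrite in_itv/= andbT => s0; rewrite lee_fin fE.
    rewrite ger0_norm; last by apply: divr_ge0; [exact/tilt_ge0/ltW|exact: powR_ge0].
    apply: le_trans (ler_norm _); rewrite ler_wpM2r ?invr_ge0 ?powR_ge0//.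
    by rewrite tilt_le_q ?(ltW s0)// oppr_le0.
by rewrite integral0_eq// => /fine_cvg.
Qed.

(** For [l = - ln (1 - expR (- e))] the tilted mean is at least 1/2 from [e] to
    [2 e], which contributes a multiple of [e `^ (- gamma)] to the integral; [e]
    is then taken small. *)
Lemma tilt_integral_unbounded (A : R) : exists l, A <= tilt_integral 1 l.
Proof.
have [A0|A0] := leP A 0.
  exists 0; apply: (le_trans A0); apply: Rintegral_ge0 => s /=.
  rewrite in_itv/= andbT => s0.
  rewrite mul1r hornerX.
  by apply: divr_ge0; [exact/tilt_ge0/ltW|exact: powR_ge0].
(* [e `^ gamma = B^-1], and the lower bound from [e] to [2 e] is then [A]. *)
pose B := A * 2 * 2 `^ (1 + gamma).
have B0 : 0 < B by rewrite !mulr_gt0// powR_gt0.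
pose e := B `^ (- gamma^-1).
have e0 : 0 < e by rewrite powR_gt0.
have eg : e `^ gamma = B^-1.
  by rewrite /e -powRrM mulNr mulVf ?gt_eqF// powR_inv1// ltW.
have qe0 : 0 < 1 - expR (- e) by rewrite subr_gt0 -expR0 ltr_expR oppr_lt0.
pose l := - ln (1 - expR (- e)).
have le : expR l = (1 - expR (- e))^-1 by rewrite /l expRN lnK.
clearbody e l; exists l.
have c0 : 0 <= 2^-1 / (2 * e) `^ (1 + gamma) by rewrite divr_ge0 ?powR_ge0.
have := @le_integral_interval _ _ e (2 * e) (2^-1 / (2 * e) `^ (1 + gamma)) _
  (tilt_integrable 1 l) _ c0.
rewrite -/(tilt_integral 1 l) => H; apply: le_trans (H _ _ _).
- rewrite powRM ?(ltW e0)// [e `^ _]powRD; last by rewrite (gt_eqF e0) implybT.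
  rewrite eg powRr1 ?(ltW e0)// le_eqVlt; apply/orP; left; apply/eqP.
  rewrite /B; have : 2 `^ (1 + gamma) != 0 :> R by rewrite gt_eqF// powR_gt0.
  set b := 2 `^ (1 + gamma) => b0; field.
  by rewrite b0 (gt_eqF e0) (gt_eqF A0).
- by rewrite e0 ler_peMl ?(ltW e0)// ler1n.
- move=> s s0; rewrite mul1r hornerX.
  by apply: divr_ge0; [exact/tilt_ge0/ltW|exact: powR_ge0].
- move=> s /andP[es se]; rewrite mul1r hornerX.
  have s0 : 0 < s by exact: lt_le_trans es.
  apply: ler_pM; rewrite ?invr_ge0 ?powR_ge0//.
    rewrite /tilt ler_pdivlMr ?emix_gt0 ?(ltW s0)// emixE.
    have : 1 <= expR l * (1 - expR (- s)).
      rewrite le ler_pdivlMl// mulr1.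
      by rewrite lerD2l lerN2 ler_expR lerN2.
    have : expR (- s) <= 1 by rewrite -expR0 ler_expR oppr_le0 ltW.
    by lra.
  rewrite lef_pV2 ?posrE ?powR_gt0//; last by rewrite mulr_gt0.
  by rewrite ge0_ler_powR ?nnegrE ?addr_ge0 ?mulr_ge0 ?(ltW gamma0) ?(ltW s0) ?(ltW e0).
Qed.

(** The derivative tends to [-1] at [-oo] and is unbounded above; the
    intermediate value theorem does the rest. *)
Lemma derive1_Lambda_onto (x : R) : -1 < x -> exists l, derive1 (Lambda gamma) l = x.
Proof.
move=> x1; have c0 : 0 < c by rewrite divr_gt0// Gamma_gt0.
have y0 : 0 < (x + 1) / c by rewrite divr_gt0// -ltrBlDr sub0r.
suff [l Hl] : exists l, tilt_integral 1 l = (x + 1) / c.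
  by exists l; rewrite derive1_Lambda Hl mulrC divfK ?gt_eqF//; ring.
have [b Hb] := tilt_integral_unbounded ((x + 1) / c).
have [n Hn] : exists n : nat, tilt_integral 1 (- n%:R) <= (x + 1) / c.
  have /cvgr_le/(_ _ y0)[n _ /(_ n (leqnn n)) Hn] := tilt_integral_cvgN.
  by exists n.
have cw u v : {within `[u, v], continuous (tilt_integral 1)}.
  by apply: continuous_subspaceT; exact: continuous_tilt_integral.
have [ab|/ltW ba] := leP (- n%:R) b.
  have [|l _ Hl] := @IVT _ _ _ _ ((x + 1) / c) ab (cw _ _); last by exists l.
  rewrite ge_min le_max; apply/andP; split; apply/orP; [left; exact: Hn|right; exact: Hb].
have [|l _ Hl] := @IVT _ _ _ _ ((x + 1) / c) ba (cw _ _); last by exists l.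
rewrite ge_min le_max; apply/andP; split; apply/orP; [right; exact: Hn|left; exact: Hb].
Qed.

End smooth.

(** * Counting the atoms of a regular law *)

Lemma sandwich_thirds (R : realType) (a b c a' b' x y z d : R) :
  a <= b + c -> a' <= b' + a -> `|c - x| <= d / 3 -> `|a' - y| <= d / 3 ->
  b <= d / 3 -> b' <= d / 3 -> `|x - z| <= d / 3 -> `|y - z| <= d / 3 ->
  `|a - z| <= d.
Proof.
rewrite !ler_norml => ? ? /andP[? ?] /andP[? ?] ? ? /andP[? ?] /andP[? ?].
by apply/andP; split; lra.
Qed.

Section counting.
Context (R : realType) (w : nat -> R).
Hypothesis w_dec : forall i, (0 < i)%N -> 0 < w i.+1 <= w i.
Hypothesis w_sum : forall n, \sum_(1 <= i < n) w i <= 1.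

Lemma atom_gt0 i : (0 < i)%N -> 0 < w i.
Proof. by move=> /w_dec/andP[w0]; exact: lt_le_trans. Qed.

Lemma atom_le i j : (0 < i)%N -> (i <= j)%N -> w j <= w i.
Proof.
move=> i0; elim: j => [|j IH]; first by rewrite leqn0 => /eqP i00; rewrite i00 in i0.
rewrite leq_eqVlt => /predU1P[->//|]; rewrite ltnS => ij.
by apply: le_trans (IH ij); have /andP[] := w_dec (leq_trans i0 ij).
Qed.

(** The first [i] weights are at least [w i] and have sum at most 1. *)
Lemma atom_le_inv i : (0 < i)%N -> w i <= i%:R^-1.
Proof.
move=> i0; rewrite -[leRHS]mul1r ler_pdivlMr ?ltr0n//.
apply: le_trans (w_sum i.+1); rewrite mulr_natr.
have -> : w i *+ i = \sum_(1 <= j < i.+1) w i by rewrite sumr_const_nat subn1.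
by rewrite big_nat_cond [leRHS]big_nat_cond; apply: ler_sum => j /andP[/andP[j0 ji] _]; exact: atom_le.
Qed.

Lemma counting_ex x : exists n, (w n.+1 < x) || (x <= 0).
Proof.
have [x0|x0] := ltP 0 x; last by exists 0%N; rewrite orbT.
exists (Num.truncn x^-1); rewrite (le_lt_trans (atom_le_inv _))//.
by rewrite -[ltRHS]invrK ltf_pV2 ?posrE ?invr_gt0// truncnS_gt.
Qed.

(** The number of atoms of mass at least [x > 0]: as the weights decrease, it is
    the first [n] with [w n.+1 < x]. *)
Definition counting (x : R) : nat := ex_minn (counting_ex x).

Lemma countingP x i : 0 < x -> (0 < i)%N -> (x <= w i) = (i <= counting x)%N.
Proof.
move=> x0; case: i => // i _; rewrite /counting; case: ex_minnP => n.
rewrite (leNgt x 0) x0 orbF => wn nmin.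
apply/idP/idP => [|ni].
  rewrite ltnNge; apply: contraTN => ni; rewrite -ltNge.
  by apply: le_lt_trans wn; exact: atom_le.
rewrite leNgt; apply/negP => wi; have := nmin i; rewrite wi => /(_ isT).
by rewrite leqNgt ni.
Qed.

Context (gamma : R) (zeta zinv : R -> R).
Hypothesis gamma01 : 0 < gamma < 1.
Hypothesis zeta_reg : regular_function gamma zeta.
Hypothesis zinvP : inverse_function zeta zinv.
Hypothesis w_zinv : w n * zinv n%:R @[n --> \oo] --> (1 : R).

Let gamma0 : 0 < gamma. Proof. by case/andP: gamma01. Qed.
Let gamma1 : gamma < 1. Proof. by case/andP: gamma01. Qed.

Lemma zeta_le x y : 0 <= x -> x <= y -> zeta x <= zeta y.
Proof.
move=> x0; rewrite le_eqVlt => /predU1P[->//|xy].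
by have [_ zlt _] := zeta_reg; rewrite ltW// zlt.
Qed.

Lemma zeta_gt0 x : 0 < x -> 0 < zeta x.
Proof.
move=> x0; have [z0 zlt _] := zeta_reg.
exact: (le_lt_trans (z0 _ (lexx 0)) (zlt _ _ (lexx 0) x0)).
Qed.

Lemma zeta_ge_zinv y x : 0 <= x -> zeta x <= y -> x <= zinv y.
Proof.
move=> x0 xy; have [zK zle] := zinvP; have [z0 _ _] := zeta_reg.
by rewrite -[leLHS]zK//; apply: zle => //; exact: z0.
Qed.

Lemma zeta_le_zinv y x : 0 <= x -> 0 <= y -> y <= zeta x -> zinv y <= x.
Proof.
by move=> x0 y0 yx; have [zK zle] := zinvP; rewrite -[leRHS]zK//; exact: zle.
Qed.

(** Since [zeta] may jump, [counting t^-1] is compared with [zeta] at a slightly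
    larger argument. The constant [N] accounts for the indices at which
    [w n * zinv n] is still far from 1. *)
Lemma counting_le (e : R) : 0 < e -> exists N : nat, forall t, 0 < t ->
  (counting t^-1)%:R <= N%:R + zeta ((1 + e) * t).
Proof.
move=> e0; have e20 : 0 < e / 2 by rewrite divr_gt0.
have /cvgrPdistC_le/(_ _ e20)[N _ HN] := w_zinv.
exists N => t t0; set n := counting _.
have et0 : 0 < (1 + e) * t by rewrite mulr_gt0// addr_gt0.
have z0 := zeta_gt0 et0.
have [nN|Nn] := leqP n N; first by rewrite ler_wpDr ?ler_nat// ltW.
rewrite ler_wpDl// leNgt; apply/negP => zn.
have n0 : (0 < n)%N by exact: leq_ltn_trans Nn.
have := zeta_ge_zinv (ltW et0) (ltW zn); apply/negP; rewrite -ltNge.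
have := HN n (ltnW Nn); rewrite ler_norml => /andP[_]; rewrite lerBlDl => wz.
have wn : t^-1 <= w n by rewrite countingP ?invr_gt0.
have wn0 := atom_gt0 n0.
rewrite -(ltr_pM2l wn0) (le_lt_trans wz)//.
apply: (@lt_le_trans _ _ (1 + e)).
  by rewrite ltrD2l gtr_pMr// invf_lt1// ltr1n.
by rewrite mulrCA ler_peMr ?addr_ge0 ?(ltW e0)// -ler_pdivrMr// div1r.
Qed.

Lemma counting_ge (e : R) : 0 < e < 1 -> exists N : nat, forall t, 0 < t ->
  zeta ((1 - e) * t) <= N%:R + (counting t^-1)%:R.
Proof.
move=> /andP[e0 e1]; have e20 : 0 < e / 2 by rewrite divr_gt0.
have /cvgrPdist_le/(_ _ e20)[N _ HN] := w_zinv.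
exists N.+2 => t t0.
have et0 : 0 < (1 - e) * t by rewrite mulr_gt0// subr_gt0.
have z0 := zeta_gt0 et0.
set m := Num.truncn (zeta ((1 - e) * t)).
have zm : zeta ((1 - e) * t) <= m%:R + 1 by rewrite natr1 ltW// truncnS_gt.
apply: (le_trans zm).
have [mN|Nm] := leqP m N.+1.
  by rewrite natr1 -natrD ler_nat (leq_trans _ (leq_addr _ _)).
suff mc : (m <= counting t^-1)%N.
  by rewrite addrC lerD ?ler_nat// ler1n.
have m0 : (0 < m)%N by exact: leq_ltn_trans Nm.
rewrite -countingP ?invr_gt0//.
have mz : m%:R <= zeta ((1 - e) * t) by rewrite truncn_le// ltW.
have zi := zeta_le_zinv (ltW et0) (ler0n _ _) mz.
have := HN m (ltnW (ltnW Nm)); rewrite ler_norml => /andP[_].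
rewrite lerBlDl -lerBlDr => wz.
have wm0 := atom_gt0 m0.
have : 1 - e / 2 <= w m * ((1 - e) * t).
  by apply: le_trans wz _; rewrite ler_pM2l.
move=> H; rewrite -div1r ler_pdivrMr//.
have e10 : 0 < 1 - e by rewrite subr_gt0.
rewrite -(ler_pM2l e10) mulr1; nra.
Qed.

(** There are infinitely many atoms. *)
Lemma zeta_cvgy : zeta x @[x --> +oo] --> +oo.
Proof.
have [N HN] := @counting_le 1 ltr01.
apply/cvgryPge => A.
have [m Am] : exists m : nat, A + N%:R <= m.+1%:R.
  by exists (Num.truncn (A + N%:R)); exact/ltW/truncnS_gt.
near=> x.
have x0 : 0 < x by near: x; exact: nbhs_pinfty_gt.
have x20 : 0 < x / 2 by rewrite divr_gt0.
have := HN _ x20; rewrite (_ : (1 + 1) * (x / 2) = x); last by field.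
move=> H; rewrite -(lerD2r N%:R) [leRHS]addrC; apply: le_trans H.
apply: (le_trans Am); rewrite ler_nat -countingP ?invr_gt0//.
rewrite -[leRHS]invrK lef_pV2 ?posrE ?invr_gt0 ?atom_gt0//.
by rewrite ler_pdivlMr//; near: x; exact: nbhs_pinfty_ge.
Unshelve. all: by end_near. Qed.

(** [counting (u / t)] lies between [zeta ((1 - e) t / u)] and
    [zeta ((1 + e) t / u)] up to constants, and [zeta] varies regularly. *)
Lemma counting_cvg (t : nat -> R) (u : R) : 0 < u ->
  (forall n, 0 < t n) -> t n @[n --> \oo] --> +oo ->
  (counting (u / t n))%:R / zeta (t n) @[n --> \oo] --> u `^ (- gamma).
Proof.
move=> u0 t0 ty; suff near_lim (d : R) : 0 < d -> \forall n \near \oo,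
    `|(counting (u / t n))%:R / zeta (t n) - u `^ (- gamma)| <= d.
  by apply/cvgrPdistC_le => d d0; exact: near_lim.
move=> d0; have ui0 : 0 < u^-1 by rewrite invr_gt0.
have [e /andP[e0 e1] He] : exists2 e, 0 < e < 1 & forall s, `|s| <= e ->
    `|((1 + s) / u) `^ gamma - u `^ (- gamma)| <= d / 3.
  have cp := is_derive_continuous (is_derive_powR_fun gamma ui0).
  have d3 : 0 < d / 3 by rewrite divr_gt0.
  have /cvgrPdistC_le/(_ _ d3)/nbhs_ballP[r /= r0 Hr] := cp.
  exists (Num.min (1 / 2) (r * u / 2)).
    by rewrite lt_min gt_min !divr_gt0 ?mulr_gt0//= ltr_pdivrMr// mul1r ltr1n.
  move=> s; rewrite le_min => /andP[s2 sr].
  have -> : u `^ (- gamma) = u^-1 `^ gamma.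
    by rewrite -powR_inv1 ?(ltW u0)// -powRrM mulN1r.
  apply: Hr; rewrite /ball/= -[X in X - _]mul1r -mulrBl normrM opprD addrA subrr sub0r normrN.
  rewrite [X in _ * X]gtr0_norm// ltr_pdivrMr// (le_lt_trans sr)//.
  by rewrite ltr_pdivrMr// ltr_pMr ?mulr_gt0// ltr1n.
have [N1 HN1] := counting_le e0.
have [N2 HN2] := @counting_ge e (introT andP (conj e0 e1)).
have d3 : 0 < d / 3 by rewrite divr_gt0.
have zy : zeta (t n) @[n --> \oo] --> +oo := cvg_comp _ _ ty zeta_cvgy.
have [_ _ zr] := zeta_reg.
have zlim c : 0 < c -> zeta (c * t n) / zeta (t n) @[n --> \oo] --> c `^ gamma.
  by move=> c0; exact: (cvg_comp _ _ ty (zr c c0)).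
have pp : 0 < (1 + e) / u by rewrite divr_gt0// addr_gt0.
have pm : 0 < (1 - e) / u by rewrite divr_gt0// subr_gt0.
have /cvgrPdistC_le/(_ _ d3) Lp := zlim _ pp.
have /cvgrPdistC_le/(_ _ d3) Lm := zlim _ pm.
have Hp := He e; rewrite gtr0_norm// lexx in Hp; have {}Hp := Hp isT.
have Hm := He (- e); rewrite normrN gtr0_norm// lexx in Hm; have {}Hm := Hm isT.
near=> n.
have tn0 := t0 n.
have z0 : 0 < zeta (t n) by exact: zeta_gt0.
have ut : (t n / u)^-1 = u / t n by rewrite invfM invrK mulrC.
have tu0 : 0 < t n / u by rewrite divr_gt0.
have K1 : (N1%:R / zeta (t n)) <= d / 3.
  rewrite ler_pdivrMr// -ler_pdivrMl//.
  by near: n; exact: cvgry_ge.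
have K2 : (N2%:R / zeta (t n)) <= d / 3.
  rewrite ler_pdivrMr// -ler_pdivrMl//.
  by near: n; exact: cvgry_ge.
have E1 x : x / u * t n = x * (t n / u) by rewrite mulrAC mulrA.
have A1 : (counting (u / t n))%:R / zeta (t n) <=
   N1%:R / zeta (t n) + zeta ((1 + e) / u * t n) / zeta (t n).
  rewrite -mulrDl ler_wpM2r ?invr_ge0 ?(ltW z0)//.
  by have := HN1 _ tu0; rewrite ut E1.
have A2 : zeta ((1 - e) / u * t n) / zeta (t n) <=
   N2%:R / zeta (t n) + (counting (u / t n))%:R / zeta (t n).
  rewrite -mulrDl ler_wpM2r ?invr_ge0 ?(ltW z0)//.
  by have := HN2 _ tu0; rewrite ut E1.
have B1 : `|zeta ((1 + e) / u * t n) / zeta (t n) - ((1 + e) / u) `^ gamma| <= d / 3.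
  by near: n.
have B2 : `|zeta ((1 - e) / u * t n) / zeta (t n) - ((1 - e) / u) `^ gamma| <= d / 3.
  by near: n.
exact: (sandwich_thirds A1 A2 B1 B2 K1 K2 Hp Hm).
Unshelve. all: by end_near. Qed.

(** Potter's bound with the exponent [(1 + gamma) / 2 < 1], from the iteration
    of [zeta (2 x) <= 2^del * zeta x], which holds for large [x] because
    [gamma < del]. It provides the integrable dominating function for
    [wsum_cvg_zeta]. *)
Lemma zeta_potter_bound : exists2 x0, 0 < x0 & forall t u, x0 <= t -> 0 < u ->
  zeta ((1 + 1) * (t / u)) <= (1 + 4 * u `^ (- ((1 + gamma) / 2))) * zeta t.
Proof.
set del := (1 + gamma) / 2.
have del0 : 0 < del by rewrite /del divr_gt0// addr_gt0.
have del1 : del < 1 by rewrite /del ltr_pdivrMr// mul1r -natr1 addrC ltrD2r.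
have gdel : gamma < del by rewrite /del ltr_pdivlMr// mulr_natr mulr2n ltrD2r.
have [_ _ zr] := zeta_reg.
have g2 : 2 `^ gamma < 2 `^ del :> R.
  by rewrite /powR (gt_eqF (ltr0Sn _ 1)) ltr_expR ltr_pM2r// ln_gt0// ltr1n.
have /cvgr_le/(_ _ g2)[x1 [_ Hx1]] := zr 2 (ltr0Sn _ 1).
exists (Num.max 1 (x1 + 1)); first by rewrite lt_max ltr01.
move=> t u; rewrite ge_max => /andP[t1 tx1] u0.
have t0 : 0 < t by exact: lt_le_trans t1.
have dbl k : zeta (2 ^+ k * t) <= (2 ^+ k) `^ del * zeta t.
  elim: k => [|k IH]; first by rewrite !expr0 powR1 !mul1r.
  have k0 : 0 < 2 ^+ k * t by rewrite mulr_gt0// exprn_gt0.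
  have : zeta (2 * (2 ^+ k * t)) / zeta (2 ^+ k * t) <= 2 `^ del.
    apply: Hx1; rewrite (@lt_le_trans _ _ t)//; first by apply: lt_le_trans tx1; rewrite ltrDl.
    by rewrite ler_peMl ?(ltW t0)// exprn_ege1// ler1n.
  rewrite ler_pdivrMr ?zeta_gt0// mulrA -exprS => /le_trans; apply.
  by rewrite exprS powRM ?exprn_ge0// -mulrA ler_wpM2l ?powR_ge0.
have t2 : 0 < 2 / u by rewrite divr_gt0.
(* The least power of 2 above [2 / u] is below [4 / u], unless it is 1. *)
have [k Hk Hk'] : exists2 k : nat, 2 / u <= 2 ^+ k & k = 0%N \/ 2 ^+ k <= 4 / u.
  have ex : exists k : nat, 2 / u <= 2 ^+ k.
    exists (Num.truncn (2 / u)).+1; apply: (le_trans (ltW (truncnS_gt _))).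
    by rewrite -natrX ler_nat ltnW// ltn_expl.
  case: (ex_minnP ex) => -[|k] kP kmin; first by exists 0%N => //; left.
  exists k.+1 => //; right; rewrite exprS.
  have : 2 ^+ k <= 2 / u.
    by rewrite leNgt; apply/negP => /ltW /kmin; rewrite ltnn.
  rewrite -(ler_pM2l (ltr0Sn _ 1)) => /le_trans; apply.
  by rewrite mulrA -natrM.
apply: (@le_trans _ _ (zeta (2 ^+ k * t))).
  apply: zeta_le; first by rewrite !mulr_ge0 ?invr_ge0 ?(ltW t0) ?(ltW u0).
  by rewrite mulrCA mulrC ler_wpM2r ?(ltW t0).
apply: (le_trans (dbl k)); rewrite ler_wpM2r ?(ltW (zeta_gt0 t0))//.
case: Hk' => [->|k4]; first by rewrite expr0 powR1 lerDl mulr_ge0 ?powR_ge0.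
apply: (@le_trans _ _ ((4 / u) `^ del)).
  apply: (ge0_ler_powR (ltW del0)) k4; rewrite nnegrE; first exact: exprn_ge0.
  by rewrite divr_ge0// ltW.
rewrite powRM ?invr_ge0 ?(ltW u0)// ler_wpDl//.
rewrite -[u^-1]powR_inv1 ?(ltW u0)// -powRrM mulN1r ler_wpM2r ?powR_ge0//.
by rewrite ler1_powR ?ler1n ?(ltW del1).
Qed.

End counting.

(** * An Abelian theorem for sums over the atoms *)

Section weighted_sums.
Context (R : realType) (w : nat -> R).
Hypothesis w_dec : forall i, (0 < i)%N -> 0 < w i.+1 <= w i.
Hypothesis w_sum : forall n, \sum_(1 <= i < n) w i <= 1.
Notation mu := (@lebesgue_measure R).
Notation pos := (`]0, +oo[%classic : set R).

Definition wsum (h : R -> R) (t : R) : R := \big[+%R/0]_(1 <= i <oo) h (t * w i).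

Section one_profile.
Context (h : R -> R) (K : R).
Hypothesis h_bounds : forall s, 0 <= s -> 0 <= h s <= K * (1 - expR (- s)).

Let h_ge0 s : 0 <= s -> 0 <= h s.
Proof. by move/h_bounds/andP/proj1. Qed.

Let h_le s : 0 <= s -> h s <= K * (1 - expR (- s)).
Proof. by move/h_bounds/andP/proj2. Qed.

Lemma profile_cst_ge0 : 0 <= K.
Proof.
have /andP[a b] := h_bounds ler01; have := le_trans a b.
by rewrite pmulr_lge0// subr_gt0 -[ltRHS]expR0 ltr_expR oppr_lt0.
Qed.

Lemma profile_le_id s : 0 <= s -> h s <= K * s.
Proof.
by move=> s0; apply: le_trans (h_le s0) _; rewrite ler_wpM2l ?profile_cst_ge0// one_sub_expRN_le.
Qed.

Lemma atom_ge0 i : (0 < i)%N -> 0 <= w i.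
Proof. by move=> i0; exact/ltW/(atom_gt0 w_dec). Qed.

Lemma wsum_partial_le t n : 0 <= t -> \sum_(1 <= i < n) h (t * w i) <= K * t.
Proof.
move=> t0; apply: (@le_trans _ _ (\sum_(1 <= i < n) K * t * w i)).
  rewrite big_nat_cond [leRHS]big_nat_cond; apply: ler_sum => i /andP[/andP[i0 _] _].
  by rewrite -mulrA profile_le_id// mulr_ge0// atom_ge0.
by rewrite -mulr_sumr ler_piMr// mulr_ge0// profile_cst_ge0.
Qed.

Lemma wsum_partial_nd t : 0 <= t ->
  nondecreasing_seq (fun n => \sum_(1 <= i < n) h (t * w i)).
Proof.
move=> t0; apply/nondecreasing_seqP => -[|n]; first by rewrite !big_geq.
by rewrite [leRHS]big_nat_recr//= lerDl h_ge0// mulr_ge0// atom_ge0.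
Qed.

Lemma wsum_is_cvg t : 0 <= t -> cvgn (fun n => \sum_(1 <= i < n) h (t * w i)).
Proof.
move=> t0; apply: nondecreasing_is_cvgn; first exact: wsum_partial_nd.
by exists (K * t) => _ [n _ <-]; exact: wsum_partial_le.
Qed.

Lemma wsum_partial_cvg t : 0 <= t ->
  \sum_(1 <= i < n) h (t * w i) @[n --> \oo] --> wsum h t.
Proof. exact: wsum_is_cvg. Qed.

Lemma wsum_ge_partial t n : 0 <= t -> \sum_(1 <= i < n) h (t * w i) <= wsum h t.
Proof.
by move=> t0; apply: nondecreasing_cvgn_le; [exact: wsum_partial_nd|exact: wsum_is_cvg].
Qed.

Lemma wsum_ge0 t : 0 <= t -> 0 <= wsum h t.
Proof. by move=> t0; have := wsum_ge_partial 0 t0; rewrite big_geq. Qed.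

Context (g : R -> R).
Hypothesis h0 : h 0 = 0.
Hypothesis dh : forall s : R, 0 <= s -> is_derive s 1 h (g s).
Hypothesis cg : forall s : R, 0 <= s -> {for s, continuous g}.
Hypothesis g_ge0 : forall s, 0 <= s -> 0 <= g s.
Hypothesis g_le : forall s, 0 <= s -> g s <= K * expR (- s).

Lemma continuous_pos_g : {in `]0, +oo[, continuous g}.
Proof. by move=> s; rewrite in_itv/= andbT => s0; exact/cg/ltW. Qed.

Lemma profile_integral (b : R) : 0 < b ->
  (\int[mu]_(u in pos) (g u * \1_(`]-oo, b]%classic : set R) u)%:E = (h b)%:E)%E.
Proof.
move=> b0.
transitivity (\int[mu]_(u in (`]0%R, b]%classic : set R)) (g u)%:E)%E.
  rewrite (_ : (`]0, b]%classic : set R) = pos `&` (`]-oo, b]%classic : set R)); last first.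
    by apply/seteqP; split => x /=; rewrite !in_itv/= andbT; [by move/andP|by move/andP].
  rewrite integral_mkcondr; apply: eq_integral => u _.
  by rewrite patchE indicE; case: (u \in _); rewrite (mulr1, mulr0).
rewrite integral_itv_obnd_cbnd.
  rewrite (continuous_FTC2 b0 (F := h)).
  - by rewrite h0 sube0.
  - apply: continuous_subspace_itv => x; rewrite in_itv/= => /andP[x0 _]; exact: cg.
  - split.
    + by move=> x; rewrite in_itv/= => /andP[x0 _]; case: (dh (ltW x0)).
    + by apply: cvg_at_right_filter; exact: is_derive_continuous (dh (lexx 0)).
    + by apply: cvg_at_left_filter; exact: is_derive_continuous (dh (ltW b0)).
  - by move=> x; rewrite in_itv/= => /andP[x0 _]; rewrite derive1E; case: (dh (ltW x0)).
apply/measurable_EFinP; apply: (@measurable_funS _ _ _ _ pos) => //.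
  by move=> x /=; rewrite !in_itv/= => /andP[->].
exact: continuous_pos_measurable continuous_pos_g.
Qed.

Lemma sum_indic (t u : R) n : 0 < t -> 0 < u ->
  \sum_(1 <= i < n.+1) (\1_(`]-oo, t * w i]%classic : set R) u : R) =
  (minn n (counting w_dec w_sum (u / t)))%:R.
Proof.
move=> t0 u0; elim: n => [|n IH]; first by rewrite big_geq// min0n.
rewrite big_nat_recr//= IH indicE.
have -> : (u \in (`]-oo, t * w n.+1]%classic : set R)) =
    (n.+1 <= counting w_dec w_sum (u / t))%N.
  rewrite -countingP ?divr_gt0// ler_pdivrMr// mulrC.
  by apply/idP/idP; rewrite inE/= in_itv.
case: leqP => cn; rewrite -natrD; congr (_%:R).
  by rewrite addn0 (minn_idPr (leqW cn)).
by rewrite (minn_idPl cn) addn1.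
Qed.

(** [h (t * w i)] is the integral of [g] up to [t * w i], and the number of
    indices with [u <= t * w i] is [counting (u / t)]. *)
Lemma wsum_integral t : 0 < t ->
  measurable_fun pos (fun u => g u * (counting w_dec w_sum (u / t))%:R) /\
  (\int[mu]_(u in pos) (g u * (counting w_dec w_sum (u / t))%:R)%:E =
    (wsum h t)%:E)%E.
Proof.
move=> t0.
pose F n (u : R) := g u * \sum_(1 <= i < n.+1) \1_(`]-oo, t * w i]%classic : set R) u.
have mF n : measurable_fun pos (F n).
  apply: measurable_funM; first exact: continuous_pos_measurable continuous_pos_g.
  by apply: measurable_sum => i; exact: measurable_indic.
have F0 n u : pos u -> 0 <= F n u.
  rewrite /= in_itv/= andbT => u0; rewrite mulr_ge0 ?g_ge0 ?(ltW u0)//.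
  exact: sumr_ge0.
have Fc u : pos u -> F n u @[n --> \oo] --> g u * (counting w_dec w_sum (u / t))%:R.
  rewrite /= in_itv/= andbT => u0; apply: cvg_near_cst; near=> n.
  rewrite /F sum_indic// (minn_idPr _)//.
  by near: n; exact: nbhs_infty_ge.
have intF n : (\int[mu]_(u in pos) (F n u)%:E = (\sum_(1 <= i < n.+1) h (t * w i))%:E)%E.
  under eq_integral do rewrite /F big_add1/= mulr_sumr -sumEFin.
  rewrite ge0_integral_sum//.
  - rewrite big_add1/= -sumEFin; apply: eq_bigr => i _; apply: profile_integral.
    by rewrite mulr_gt0// (atom_gt0 w_dec).
  - move=> i; apply/measurable_EFinP; apply: measurable_funM; last exact: measurable_indic.
    exact: continuous_pos_measurable continuous_pos_g.
  - move=> i u; rewrite /= in_itv/= andbT => u0; rewrite lee_fin mulr_ge0// g_ge0//.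
    exact: ltW.
have mlim : measurable_fun pos (fun u => (g u * (counting w_dec w_sum (u / t))%:R)%:E).
  apply: (@emeasurable_fun_cvg _ _ _ _ (fun n u => (F n u)%:E)).
    by move=> n; exact/measurable_EFinP.
  by move=> u pu; apply: cvg_EFin; [exact: nearW|exact: Fc].
split; first exact/measurable_EFinP.
have lim1 : (\int[mu]_(u in pos) (F n u)%:E)%E @[n --> \oo] -->
    (\int[mu]_(u in pos) (g u * (counting w_dec w_sum (u / t))%:R)%:E)%E.
  apply: cvg_toP.
    apply: ereal_nondecreasing_is_cvgn => m n mn; rewrite !intF lee_fin.
    by apply: wsum_partial_nd; [exact: ltW|].
  rewrite -monotone_convergence//; last 2 first.
  - by move=> n; apply/measurable_EFinP; exact: mF.
  - move=> u pu; apply/nondecreasing_seqP => n; rewrite lee_fin.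
    move: pu; rewrite /= in_itv/= andbT => u0.
    rewrite ler_wpM2l ?g_ge0 ?(ltW u0)// [leRHS]big_nat_recr//= lerDl.
    by rewrite indicE.
  apply: eq_integral => u; rewrite inE => pu.
  by apply/cvg_lim => //; apply: cvg_EFin; [exact: nearW|exact: Fc].
apply/(cvg_unique _ lim1) => //=.
under eq_fun do rewrite intF.
apply: cvg_EFin; first exact: nearW.
have := wsum_partial_cvg (ltW t0).
by rewrite -(cvg_shiftS (fun n => \sum_(1 <= i < n) h (t * w i))).
Unshelve. all: by end_near. Qed.

Context (gamma : R) (zeta zinv : R -> R).
Hypothesis gamma01 : 0 < gamma < 1.
Hypothesis zeta_reg : regular_function gamma zeta.
Hypothesis zinvP : inverse_function zeta zinv.
Hypothesis w_zinv : w n * zinv n%:R @[n --> \oo] --> (1 : R).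

(** Dominated convergence in [wsum_integral]: divided by [zeta t], the counting
    function tends to [u^(-gamma)]. *)
Lemma wsum_cvg_zeta (t : nat -> R) : t n @[n --> \oo] --> +oo ->
  wsum h (t n) / zeta (t n) @[n --> \oo] -->
  \int[mu]_(u in pos) (g u * u `^ (- gamma)).
Proof.
move=> ty.
have [x0 x00 Hx0] := zeta_potter_bound gamma01 zeta_reg.
have [N1 HN1] := counting_le w_dec w_sum zeta_reg zinvP w_zinv ltr01.
have zy := zeta_cvgy w_dec w_sum zeta_reg zinvP w_zinv.
set del := (1 + gamma) / 2 in Hx0.
have /andP[gamma0 gamma1] := gamma01.
have del01 : 0 <= del < 1.
  by rewrite /del divr_ge0 ?addr_ge0 ?(ltW gamma0)//= ltr_pdivrMr// mul1r -natr1 addrC ltrD2r.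
have [n0 Hn0] : exists n0 : nat, forall n, x0 <= t (n + n0) /\ 1 <= zeta (t (n + n0)).
  have : \forall n \near \oo, x0 <= t n /\ 1 <= zeta (t n).
    near=> n; split; first by near: n; exact: cvgry_ge.
    by near: n; exact: (cvg_comp _ _ ty zy) _ (nbhs_pinfty_ge (num_real 1)).
  by move=> [n0 _ H]; exists n0 => n; apply: H => /=; rewrite leq_addl.
rewrite -(cvg_shiftn n0).
pose s (n : nat) := t (n + n0).
have s0 n : 0 < s n by have [+ _] := Hn0 n; exact: lt_le_trans.
have sy : s n @[n --> \oo] --> +oo by rewrite (cvg_shiftn n0).
have z1 n : 1 <= zeta (s n) by have [] := Hn0 n.
have z0 n : 0 < zeta (s n) by exact: lt_le_trans (z1 n).
pose c (n : nat) (u : R) : R := (counting w_dec w_sum (u / s n))%:R.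
pose f (n : nat) (u : R) := g u * c n u / zeta (s n).
have intf n : (\int[mu]_(u in pos) (f n u)%:E = (wsum h (s n) / zeta (s n))%:E)%E.
  have [m1 m2] := wsum_integral (s0 n).
  rewrite mulrC EFinM -m2 -ge0_integralZl_EFin ?invr_ge0 ?(ltW (z0 n))//.
  - by apply: eq_integral => u _; rewrite /f mulrC EFinM.
  - move=> u /=; rewrite in_itv/= andbT => u0.
    by rewrite lee_fin mulr_ge0// g_ge0// ltW.
  - exact/measurable_EFinP.
(* [counting (u / s n) / zeta (s n)] is at most [N1 + 1 + 4 u^(-del)]. *)
pose G (u : R) := K * (N1%:R + 1) * (u `^ (- 0) * expR (- u)) +
  K * 4 * (u `^ (- del) * expR (- u)).
have GI : mu.-integrable pos (EFin \o G).
  have G1 : mu.-integrable pos (EFin \o (fun u => K * (N1%:R + 1) * (u `^ (- 0) * expR (- u)))).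
    have i1 : mu.-integrable pos (fun s => (s `^ (- 0) * expR (- s))%:E).
      by apply: integrable_powR_expRN; rewrite lexx ltr01.
    by apply: (integrableZl _ (K * (N1%:R + 1)) i1).
  have G2 : mu.-integrable pos (EFin \o (fun u => K * 4 * (u `^ (- del) * expR (- u)))).
    have i1 := integrable_powR_expRN del01.
    by apply: (integrableZl _ (K * 4) i1).
  by apply: (integrableD _ G1 G2).
have lim : (\int[mu]_(u in pos) (f n u)%:E)%E @[n --> \oo] -->
    (\int[mu]_(u in pos) (g u * u `^ (- gamma))%:E)%E.
  apply: (@dominated_cvg _ _ _ mu pos _ _ _ (EFin \o G)) => //.
  - move=> n; apply/measurable_EFinP; apply: measurable_funM => //.
    by have [] := wsum_integral (s0 n).
  - move=> u; rewrite /= in_itv/= andbT => u0; apply: cvg_EFin; first exact: nearW.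
    rewrite /comp/= /f; under eq_fun do rewrite -mulrA.
    apply: cvgM; first exact: cvg_cst.
    exact: (counting_cvg w_dec w_sum zeta_reg zinvP w_zinv u0 s0 sy).
  - move=> n u; rewrite /= in_itv/= andbT => u0; rewrite lee_fin.
    have g0 := g_ge0 (ltW u0).
    rewrite ger0_norm; last by rewrite divr_ge0 ?mulr_ge0// ltW.
    have us0 : 0 < s n / u by rewrite divr_gt0.
    have cle : c n u / zeta (s n) <= N1%:R + (1 + 4 * u `^ (- del)).
      rewrite ler_pdivrMr//; have := HN1 _ us0; rewrite invfM invrK mulrC -/(c n u) => /le_trans; apply.
      rewrite [leRHS]mulrDl lerD//; first by rewrite ler_peMr.
      by apply: Hx0 => //; have [] := Hn0 n.
    rewrite /f -mulrA.
    apply: (@le_trans _ _ (K * expR (- u) * (N1%:R + (1 + 4 * u `^ (- del))))).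
      apply: ler_pM => //; first by rewrite divr_ge0// ltW.
      exact/g_le/ltW.
    by rewrite /G oppr0 powRr0 le_eqVlt; apply/orP; left; apply/eqP; ring.
have Ifin : (\int[mu]_(u in pos) (g u * u `^ (- gamma))%:E)%E \is a fin_num.
  have gi := @le_gamma_integrable _ _ gamma01 g K continuous_pos_g.
  apply: integrable_fin_num => //; apply: gi => u u0.
  by rewrite ger0_norm ?g_ge0 ?g_le ?(ltW u0).
move: lim; rewrite -(fineK Ifin) => /fine_cvg.
by under eq_fun do rewrite /comp/= intf.
Unshelve. all: by end_near. Qed.

End one_profile.
End weighted_sums.

(** * Growth of the cumulant of the Poissonized range *)

Section sublinear.
Context (R : realType) (w : nat -> R).
Hypothesis w_dec : forall i, (0 < i)%N -> 0 < w i.+1 <= w i.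
Hypothesis w_sum : forall n, \sum_(1 <= i < n) w i <= 1.
Context (h : R -> R) (K : R).
Hypothesis h_bounds : forall s, 0 <= s -> 0 <= h s <= K * (1 - expR (- s)).

(** The first [m] terms are at most [K] each; the others are at most
    [K * t * w i], whose sum is a small multiple of [t] since the weights are
    summable. *)
Lemma wsum_sublinear : wsum w h t / t @[t --> +oo] --> 0.
Proof.
have K0 : 0 <= K := profile_cst_ge0 h_bounds.
have wnd : nondecreasing_seq (fun n => \sum_(1 <= i < n) w i).
  apply/nondecreasing_seqP => -[|n]; first by rewrite !big_geq.
  by rewrite [leRHS]big_nat_recr//= lerDl atom_ge0.
have wcv : cvgn (fun n => \sum_(1 <= i < n) w i).
  by apply: nondecreasing_is_cvgn => //; exists 1 => _ [n _ <-].
set S := limn (fun n => \sum_(1 <= i < n) w i) in wcv.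
suff H (e : R) : 0 < e -> \forall t \near +oo, `|wsum w h t / t| <= e.
  by apply/cvgr0Pnorm_le => e e0; exact: H.
move=> e0.
have ek : 0 < e / 2 / (K + 1) by rewrite !divr_gt0// ltr_wpDl.
have /cvgrPdist_le/(_ _ ek)[m0 _ /(_ m0.+1 (leqnSn m0)) Hm] := wcv.
set m := m0.+1 in Hm.
have Sm n : \sum_(1 <= i < n) w i <= S by exact: nondecreasing_cvgn_le.
near=> t.
have t0 : 0 < t by near: t; exact: nbhs_pinfty_gt.
rewrite ger0_norm; last by rewrite divr_ge0 ?(ltW t0)// (wsum_ge0 w_dec w_sum h_bounds)// ltW.
rewrite ler_pdivrMr//.
have cv := wsum_is_cvg w_dec w_sum h_bounds (ltW t0).
apply: (@le_trans _ _ (K * m%:R + K * t * (e / 2 / (K + 1)))); last first.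
  have tm : K * m%:R <= t * (e / 2).
    by rewrite -ler_pdivrMr ?divr_gt0//; near: t; exact: nbhs_pinfty_ge.
  have K1 : K * (e / 2 / (K + 1)) <= e / 2.
    rewrite mulrCA ler_piMr ?divr_ge0 ?(ltW e0)// ler_pdivrMr ?ltr_wpDl//.
    by rewrite mul1r lerDl.
  rewrite mulrAC [_ * t]mulrC; have := ler_wpM2l (ltW t0) K1; lra.
apply: limr_le => //; near=> n.
have mn : (m <= n)%N by near: n; exact: nbhs_infty_ge.
rewrite (big_cat_nat (n := m))//=; apply: lerD.
  apply: (@le_trans _ _ (\sum_(1 <= i < m) K)).
    rewrite big_nat_cond [leRHS]big_nat_cond; apply: ler_sum => i /andP[/andP[i0 _] _].
    have tw : 0 <= t * w i by rewrite mulr_ge0 ?(ltW t0)// (atom_ge0 w_dec).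
    have /andP[_ hl] := h_bounds tw; apply: (le_trans hl); rewrite ler_piMr// one_sub_expRN_le1.
  by rewrite sumr_const_nat subn1 -[K *+ _]mulr_natr ler_wpM2l// ler_nat leqnSn.
apply: (@le_trans _ _ (\sum_(m <= i < n) K * t * w i)).
  rewrite big_nat_cond [leRHS]big_nat_cond; apply: ler_sum => i /andP[/andP[mi _] _].
  have i0 : (0 < i)%N by exact: leq_trans mi.
  rewrite -mulrA (profile_le_id h_bounds)// mulr_ge0 ?(ltW t0)// (atom_ge0 w_dec)//.
rewrite -mulr_sumr ler_wpM2l ?mulr_ge0 ?(ltW t0)//.
have := Sm n; rewrite (big_cat_nat (n := m))//= => Smn.
by move: Hm; rewrite ler_norml => /andP[_]; apply: le_trans; rewrite lerBrDl.
Unshelve. all: by end_near. Qed.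

End sublinear.

Lemma wsumN (R : realType) (w : nat -> R) (h : R -> R) (t : R) :
  cvgn (fun n => \sum_(1 <= i < n) h (t * w i)) ->
  wsum w (fun s => - h s) t = - wsum w h t.
Proof.
move=> hc; rewrite /wsum -limN//; congr (limn _); apply/funext => n.
by rewrite sumrN.
Qed.

Lemma cvgN_fun (R : realType) (T : Type) (F : set_system T) (f : T -> R) (l : R) :
  Filter F -> f x @[x --> F] --> l -> - f x @[x --> F] --> - l.
Proof. by move=> FF; exact: cvgN. Qed.

Section cumulant_ratio.
Context (R : realType) (w : nat -> R).
Hypothesis w_dec : forall i, (0 < i)%N -> 0 < w i.+1 <= w i.
Hypothesis w_sum : forall n, \sum_(1 <= i < n) w i <= 1.
Context (gamma : R) (zeta zinv : R -> R).
Hypothesis gamma01 : 0 < gamma < 1.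
Hypothesis zeta_reg : regular_function gamma zeta.
Hypothesis zinvP : inverse_function zeta zinv.
Hypothesis w_zinv : w n * zinv n%:R @[n --> \oo] --> (1 : R).
Notation mu := (@lebesgue_measure R).
Notation pos := (`]0, +oo[%classic : set R).

(** The cumulant generating function of the number of distinct values in a
    sample of Poisson size of mean [t]; [mean_range w t] is the expectation of
    that number. *)
Definition poisson_cumulant (l t : R) : R := wsum w (fun s => ln (emix l s)) t.

Definition mean_range (t : R) : R := wsum w (fun s => 1 - expR (- s)) t.

Lemma poisson_cumulant_is_cvg l t : 0 <= t ->
  cvgn (fun n => \sum_(1 <= i < n) ln (emix l (t * w i))).
Proof.
move=> t0; have [l0|/ltW l0] := leP 0 l.
  exact: (wsum_is_cvg w_dec w_sum (fun s => ln_emix_bounds l0) t0).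
have : cvgn (fun n => \sum_(1 <= i < n) - ln (emix l (t * w i))).
  exact: (wsum_is_cvg w_dec w_sum (fun s => lnN_emix_bounds l0) t0).
under eq_fun do rewrite sumrN.
move=> /cvg_ex[x /cvgN_fun cx]; apply/cvg_ex; exists (- x); move: cx.
by under eq_fun do rewrite opprK.
Qed.

Lemma poisson_cumulantN l t : 0 <= t ->
  wsum w (fun s => - ln (emix l s)) t = - poisson_cumulant l t.
Proof. by move=> t0; apply: wsumN; exact: poisson_cumulant_is_cvg. Qed.

Lemma poisson_cumulant_sublinear l : poisson_cumulant l t / t @[t --> +oo] --> 0.
Proof.
have [l0|/ltW l0] := leP 0 l.
  exact: (wsum_sublinear w_dec w_sum (fun s => ln_emix_bounds l0)).
have : wsum w (fun s => - ln (emix l s)) t / t @[t --> +oo] --> 0.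
  exact: (wsum_sublinear w_dec w_sum (fun s => lnN_emix_bounds l0)).
move/cvgN_fun; rewrite oppr0; apply: cvg_trans; apply: near_eq_cvg.
near=> t; rewrite poisson_cumulantN; last by near: t; exact: nbhs_pinfty_ge.
by rewrite mulNr opprK.
Unshelve. all: by end_near. Qed.

Lemma poisson_cumulant_cvg_zeta l (t : nat -> R) : (forall n, 0 <= t n) ->
  t n @[n --> \oo] --> +oo ->
  poisson_cumulant l (t n) / zeta (t n) @[n --> \oo] -->
  \int[mu]_(u in pos) (demix l u * u `^ (- gamma)).
Proof.
move=> t0 ty; have [l0|/ltW l0] := leP 0 l.
  apply: (@wsum_cvg_zeta _ _ w_dec w_sum _ (emix_cst l) (fun s => ln_emix_bounds l0) (demix l) (ln_emix0 l)
    _ _ _ _ _ _ zinv) => //.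
  - by move=> s; exact: is_derive_ln_emix_s.
  - by move=> s; exact: continuous_demix.
  - by move=> s; exact: demix_ge0.
  - by move=> s; exact: demix_le.
have : wsum w (fun s => - ln (emix l s)) (t n) / zeta (t n) @[n --> \oo] -->
    \int[mu]_(u in pos) (- demix l u * u `^ (- gamma)).
  apply: (@wsum_cvg_zeta _ _ w_dec w_sum _ (emix_cst l) (fun s => lnN_emix_bounds l0) (fun s => - demix l s) _
    _ _ _ _ _ _ zinv) => //.
  - by rewrite ln_emix0 oppr0.
  - by move=> s s0; apply: is_deriveN_fun; exact: is_derive_ln_emix_s.
  - by move=> s s0; apply: cvgN; exact: continuous_demix.
  - by move=> s; exact: demixN_ge0.
  - by move=> s; exact: demixN_le.
move/cvgN_fun; under eq_fun do rewrite poisson_cumulantN// mulNr opprK.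
have [d1 _ _] := ln_emix_parts gamma01 l.
rewrite (_ : \int[mu]_(u in pos) (- demix l u * u `^ (- gamma)) =
  - \int[mu]_(u in pos) (demix l u * u `^ (- gamma))) ?opprK//.
rewrite -[RHS]mulN1r -RintegralZl//; apply: eq_Rintegral => s _.
by rewrite mulN1r mulNr.
Qed.

Lemma one_sub_expRN_bounds (s : R) : 0 <= s ->
  0 <= 1 - expR (- s) <= 1 * (1 - expR (- s)).
Proof. by move=> s0; rewrite mul1r lexx one_sub_expRN_ge0. Qed.

Lemma mean_range_gt0 t : 0 < t -> 0 < mean_range t.
Proof.
move=> t0; have := wsum_ge_partial w_dec w_sum one_sub_expRN_bounds 2 (ltW t0).
apply: lt_le_trans; rewrite big_nat1 subr_gt0 -expR0 ltr_expR oppr_lt0 mulr_gt0//.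
exact: (atom_gt0 w_dec).
Qed.

Lemma mean_range_cvg_zeta (t : nat -> R) : t n @[n --> \oo] --> +oo ->
  mean_range (t n) / zeta (t n) @[n --> \oo] --> Gamma (1 - gamma).
Proof.
move=> ty; rewrite -integral_expRN_powR1.
apply: (@wsum_cvg_zeta _ _ w_dec w_sum _ 1 one_sub_expRN_bounds (fun s => expR (- s))
    _ _ _ _ _ _ _ zinv) => //.
- by rewrite oppr0 expR0 subrr.
- move=> s s0; apply: (is_derive_eq (is_deriveB_fun (is_derive_cst_fun s 1) (is_derive_expRN s))).
  by rewrite sub0r opprK.
- by move=> s s0; exact: is_derive_continuous (is_derive_expRN s).
- by move=> s s0; rewrite mul1r.
Qed.

Let natry : (n%:R : R) @[n --> \oo] --> +oo.
Proof.
by apply/cvgryPge => A; near=> n; near: n; exact: nbhs_infty_ger.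
Unshelve. all: by end_near. Qed.

Lemma mean_range_cvgy : mean_range n%:R @[n --> \oo] --> +oo.
Proof.
have zy := zeta_cvgy w_dec w_sum zeta_reg zinvP w_zinv.
have zn : zeta n%:R @[n --> \oo] --> +oo := cvg_comp _ _ natry zy.
have G0 := Gamma_gt0 gamma01.
have G2 : Gamma (1 - gamma) / 2 < Gamma (1 - gamma) by rewrite ltr_pdivrMr// ltr_pMr// ltr1n.
have /cvgr_ge/(_ _ G2) Hr := mean_range_cvg_zeta natry.
apply/cvgryPge => A; near=> n.
have z0 : 0 < zeta n%:R.
  by apply: (zeta_gt0 zeta_reg); rewrite ltr0n; near: n; exact: nbhs_infty_gt.
have : Gamma (1 - gamma) / 2 <= mean_range n%:R / zeta n%:R by near: n.
rewrite ler_pdivlMr//; apply: le_trans.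
rewrite mulrC -ler_pdivrMr ?divr_gt0//.
by near: n; exact: cvgry_ge.
Unshelve. all: by end_near. Qed.

(** Numerator and denominator are asymptotic to explicit multiples of
    [zeta (c n)] and [zeta n]. *)
Lemma cumulant_ratio (l c : R) : 0 < c ->
  poisson_cumulant l (c * n%:R) / mean_range n%:R @[n --> \oo] -->
  c `^ gamma * (Lambda gamma l + l).
Proof.
move=> c0.
have cy : c * n%:R @[n --> \oo] --> +oo.
  apply/cvgryPge => A; near=> n; rewrite -ler_pdivrMl//.
  by near: n; exact: nbhs_infty_ger.
have L1 := @poisson_cumulant_cvg_zeta l (fun n : nat => c * n%:R) (fun n => mulr_ge0 (ltW c0) (ler0n _ n)) cy.
have L2 := mean_range_cvg_zeta natry.
have [_ _ zr] := zeta_reg.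
have L3 : zeta (c * n%:R) / zeta n%:R @[n --> \oo] --> c `^ gamma := cvg_comp _ _ natry (zr c c0).
have G0 := Gamma_gt0 gamma01.
set I := \int[mu]_(u in pos) (demix l u * u `^ (- gamma)) in L1 *.
have L4 : poisson_cumulant l (c * n%:R) / zeta (c * n%:R) *
    (zeta (c * n%:R) / zeta n%:R) * (mean_range n%:R / zeta n%:R)^-1 @[n --> \oo] -->
    I * c `^ gamma * (Gamma (1 - gamma))^-1.
  by apply: cvgM; [exact: cvgM|exact: cvgV (lt0r_neq0 G0) L2].
have E : Lambda gamma l + l = I / Gamma (1 - gamma).
  by rewrite LambdaE// addrAC addNr add0r.
have mry := mean_range_cvgy.
rewrite E mulrA [c `^ _ * _]mulrC; apply: cvg_trans L4; apply: near_eq_cvg.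
near=> n => /=.
have z0 : 0 < zeta n%:R.
  by apply: (zeta_gt0 zeta_reg); rewrite ltr0n; near: n; exact: nbhs_infty_gt.
have zc0 : 0 < zeta (c * n%:R).
  by apply: (zeta_gt0 zeta_reg); rewrite mulr_gt0// ltr0n; near: n; exact: nbhs_infty_gt.
have b0 : 0 < mean_range n%:R by near: n; exact: cvgry_gt.
by field; rewrite (gt_eqF b0) (gt_eqF z0) (gt_eqF zc0).
Unshelve. all: by end_near. Qed.

End cumulant_ratio.

(** * Depoissonization *)

(** [expR (- t) * l] is the mean of [a] at a Poisson index of mean [t]. *)
Definition is_egf (R : realType) (a : nat -> R) (t l : R) : Prop :=
  series (fun k => exp_coeff t k * a k) @ \oo --> l.

Section egf.
Context (R : realType).
Implicit Types (a b : nat -> R) (t l x : R).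

Lemma exp_coeffM t x k : exp_coeff t k * x ^+ k = exp_coeff (t * x) k.
Proof. by rewrite /exp_coeff/= exprMn mulrAC. Qed.

Lemma egf_pow t x : is_egf (fun k => x ^+ k) t (expR (t * x)).
Proof.
rewrite /is_egf; under eq_fun do rewrite exp_coeffM.
exact: is_cvg_series_exp_coeff.
Qed.

Lemma egf_one t : is_egf (fun=> 1) t (expR t).
Proof. by have := @egf_pow t 1; rewrite mulr1; under eq_fun do rewrite expr1n. Qed.

Lemma egfD a b t l x : is_egf a t l -> is_egf b t x ->
  is_egf (fun k => a k + b k) t (l + x).
Proof.
move=> ca cb; rewrite /is_egf.
rewrite (_ : series _ = series (fun k => exp_coeff t k * a k) +
   series (fun k => exp_coeff t k * b k)); first exact: cvgD.
apply/funext => n; rewrite /series/= fctE -big_split/=.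
by apply: eq_bigr => k _; rewrite mulrDr.
Qed.

Lemma egfZ a t l x : is_egf a t l -> is_egf (fun k => x * a k) t (x * l).
Proof.
move=> ca; rewrite /is_egf.
rewrite (_ : series _ = (fun n => x * series (fun k => exp_coeff t k * a k) n)).
  by apply: cvgM => //; exact: cvg_cst.
apply/funext => n; rewrite /series/= mulr_sumr.
by apply: eq_bigr => k _; rewrite mulrCA.
Qed.

Lemma egf_sum (I : Type) (r : seq I) (a : I -> nat -> R) t (l : I -> R) :
  (forall i, is_egf (a i) t (l i)) ->
  is_egf (fun k => \sum_(i <- r) a i k) t (\sum_(i <- r) l i).
Proof.
move=> ai; elim: r => [|i r IH].
  rewrite big_nil (_ : (fun k => _) = (fun=> 0 * 1)); last first.
    by apply/funext => k; rewrite big_nil mul0r.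
  by rewrite -[X in is_egf _ _ X](mul0r (expR t)); exact: egfZ (@egf_one t).
rewrite big_cons (_ : (fun k => _) = (fun k => a i k + \sum_(j <- r) a j k)).
  exact: egfD.
by apply/funext => k; rewrite big_cons.
Qed.

Lemma egf_le a b t l x : 0 <= t -> (forall k, a k <= b k) ->
  is_egf a t l -> is_egf b t x -> l <= x.
Proof.
move=> t0 ab ca cb; apply: ler_cvg_to ca cb _.
apply: nearW => n; apply: ler_sum => k _.
by rewrite ler_wpM2l// exp_coeff_ge0.
Qed.

End egf.

Section depoissonize.
Context (R : realType) (a : nat -> R) (A : R -> R).
Hypothesis a_ge0 : forall n, 0 <= a n.
Hypothesis aA : forall t, 0 <= t -> is_egf a t (expR t * A t).

(** The mean of [(1 + e)^n (1 + e)^(-k)], where [k] has the Poisson law of mean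
    [(1 + e) n]: the Chernoff bound for [k] to be on the other side of [n]. *)
Lemma chernoff_weight_mean (e : R) n : -1 < e ->
  (1 + e) ^+ n * expR ((1 + e) * n%:R * (1 + e)^-1) / expR ((1 + e) * n%:R) =
  ((1 + e) * expR (- e)) ^+ n.
Proof.
move=> e1; have e0 : 1 + e != 0 by rewrite gt_eqF// -ltrBlDl sub0r.
rewrite (_ : (1 + e) * n%:R * (1 + e)^-1 = n%:R); last by rewrite mulrAC mulfV ?mul1r.
rewrite exprMn -mulrA; congr (_ * _).
rewrite -expRM_natl -expRN -expRD; congr expR; ring.
Qed.

Lemma depoissonize_le (e : R) n : -1 < e ->
  (forall k, a n * (1 - (1 + e) ^+ n * (1 + e)^-1 ^+ k) <= a k) ->
  a n * (1 - ((1 + e) * expR (- e)) ^+ n) <= A ((1 + e) * n%:R).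
Proof.
move=> e1 ak; have e0 : 0 < 1 + e by rewrite -ltrBlDl sub0r.
set t := (1 + e) * n%:R; have t0 : 0 <= t by rewrite mulr_ge0// ltW.
have tE : t * (1 + e)^-1 = n%:R by rewrite /t mulrAC mulfV ?mul1r// gt_eqF.
have L1 : is_egf (fun k => a n * (1 - (1 + e) ^+ n * (1 + e)^-1 ^+ k)) t
    (a n * (expR t - (1 + e) ^+ n * expR n%:R)).
  have := egfZ (x := a n) (egfD (@egf_one R t)
    (egfZ (x := - (1 + e) ^+ n) (@egf_pow R t (1 + e)^-1))).
  by rewrite tE mulNr; under eq_fun do rewrite mulNr.
have H := egf_le t0 ak L1 (aA t0).
rewrite -(ler_pM2l (expR_gt0 t)); apply: le_trans H.
rewrite mulrCA mulrBr mulr1 -chernoff_weight_mean// -/t tE.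
by rewrite (mulrC (expR t)) divfK ?gt_eqF// expR_gt0.
Qed.

Lemma depoissonize_ge (e : R) n (b : nat -> R) (B : R) : -1 < e ->
  (forall k, a k <= a n + (1 + e) ^+ n * ((1 + e)^-1 ^+ k * b k)) ->
  is_egf b n%:R (expR n%:R * B) ->
  A ((1 + e) * n%:R) <= a n + ((1 + e) * expR (- e)) ^+ n * B.
Proof.
move=> e1 ak bB; have e0 : 0 < 1 + e by rewrite -ltrBlDl sub0r.
set t := (1 + e) * n%:R; have t0 : 0 <= t by rewrite mulr_ge0// ltW.
have tE : t * (1 + e)^-1 = n%:R by rewrite /t mulrAC mulfV ?mul1r// gt_eqF.
have L0 : is_egf (fun k => (1 + e)^-1 ^+ k * b k) t (expR n%:R * B).
  rewrite /is_egf; under eq_fun do rewrite mulrA exp_coeffM tE.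
  exact: bB.
have L1 : is_egf (fun k => a n + (1 + e) ^+ n * ((1 + e)^-1 ^+ k * b k)) t
    (a n * expR t + (1 + e) ^+ n * (expR n%:R * B)).
  have := egfD (egfZ (x := a n) (@egf_one R t)) (egfZ (x := (1 + e) ^+ n) L0).
  by under eq_fun do rewrite mulr1.
have H := egf_le t0 ak (aA t0) L1.
rewrite -(ler_pM2l (expR_gt0 t)); apply: (le_trans H).
rewrite mulrDr [expR t * a n]mulrC lerD2l.
rewrite -chernoff_weight_mean// -/t tE !mulrA [expR t * _]mulrC -!mulrA.
rewrite le_eqVlt; apply/orP; left; apply/eqP.
by field; rewrite gt_eqF// expR_gt0.
Qed.

End depoissonize.

Section depoissonize_monotone.
Context (R : realType) (a : nat -> R) (A : R -> R).
Hypothesis a_ge0 : forall n, 0 <= a n.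
Hypothesis aA : forall t, 0 <= t -> is_egf a t (expR t * A t).

Lemma chernoff_weight_ge1 (x : R) n k : 0 < x ->
  (1 <= x /\ (k <= n)%N) \/ (x <= 1 /\ (n <= k)%N) -> 1 <= x ^+ n * x^-1 ^+ k.
Proof.
move=> x0 [[x1 kn]|[x1 nk]].
  rewrite -(subnK kn) exprD -mulrA exprVn mulfV ?expf_neq0 ?gt_eqF// mulr1.
  exact: exprn_ege1.
rewrite -(subnK nk) exprD mulrCA [x^-1 ^+ n]exprVn mulfV ?expf_neq0 ?gt_eqF// mulr1.
by rewrite exprVn invf_ge1 ?exprn_gt0// exprn_ile1// ltW.
Qed.

Lemma chernoff_weight_ge0 (x : R) n k : 0 < x -> 0 <= x ^+ n * x^-1 ^+ k.
Proof. by move=> x0; rewrite mulr_ge0 ?exprn_ge0 ?invr_ge0 ?ltW. Qed.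

(** The parameter [(1 + e) n] puts the Poisson index, up to a Chernoff error, on
    the side of [n] where [a] is at least [a n]. *)
Lemma depoissonize_upper (e : R) n : -1 < e ->
  (0 < e /\ {homo a : i j / (i <= j)%N >-> i <= j}) \/
  (e < 0 /\ {homo a : i j / (i <= j)%N >-> j <= i}) ->
  a n * (1 - ((1 + e) * expR (- e)) ^+ n) <= A ((1 + e) * n%:R).
Proof.
move=> e1 H; have x0 : 0 < 1 + e by rewrite -ltrBlDl sub0r.
apply: (depoissonize_le aA) => // k.
have W0 := chernoff_weight_ge0 n k x0.
have small : 1 <= (1 + e) ^+ n * (1 + e)^-1 ^+ k ->
    a n * (1 - (1 + e) ^+ n * (1 + e)^-1 ^+ k) <= a k.
  by move=> W1; apply: le_trans (a_ge0 k); rewrite mulr_ge0_le0// subr_le0.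
have large : a n <= a k -> a n * (1 - (1 + e) ^+ n * (1 + e)^-1 ^+ k) <= a k.
  by move=> /(le_trans _); apply; rewrite ler_piMr// gerBl.
have [kn|/ltnW nk] := leqP k n; case: H => -[es am].
- by apply/small/chernoff_weight_ge1 => //; left; rewrite lerDl ltW.
- exact/large/am.
- exact/large/am.
- by apply/small/chernoff_weight_ge1 => //; right; rewrite gerDl ltW.
Qed.

(** The sequence [a] may be unbounded, but the Chernoff weight on the indices
    beyond [n] replaces the Poisson mean [(1 + e) n] by [n]; hence the factor
    [A n]. *)
Lemma depoissonize_lower_nd (e : R) n : -1 < e -> e < 0 ->
  {homo a : i j / (i <= j)%N >-> i <= j} ->
  A ((1 + e) * n%:R) <= a n + ((1 + e) * expR (- e)) ^+ n * A n%:R.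
Proof.
move=> e1 es am; have x0 : 0 < 1 + e by rewrite -ltrBlDl sub0r.
apply: (depoissonize_ge aA) => // [k|]; last exact: aA.
have W0 := chernoff_weight_ge0 n k x0; rewrite mulrA.
have [kn|/ltnW nk] := leqP k n.
  by rewrite ler_wpDr ?am// mulr_ge0.
rewrite ler_wpDl// ler_peMl//; apply: chernoff_weight_ge1 => //; right.
by rewrite gerDl ltW.
Qed.

Lemma depoissonize_lower_ni (e : R) n : 0 < e -> (forall n, a n <= 1) ->
  {homo a : i j / (i <= j)%N >-> j <= i} ->
  A ((1 + e) * n%:R) <= a n + ((1 + e) * expR (- e)) ^+ n.
Proof.
move=> e0 a1 am; have x0 : 0 < 1 + e by rewrite addr_gt0.
rewrite -[_ ^+ n]mulr1.
apply: (depoissonize_ge aA (b := fun=> 1)).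
- by rewrite (lt_trans _ e0)// ltrN10.
- move=> k; rewrite mulr1; have W0 := chernoff_weight_ge0 n k x0.
  have [kn|/ltnW nk] := leqP k n.
    rewrite ler_wpDl// (le_trans (a1 k))//; apply: chernoff_weight_ge1 => //; left.
    by rewrite lerDl ltW.
  by rewrite ler_wpDr// am.
- by rewrite mulr1; exact: egf_one.
Qed.

End depoissonize_monotone.

Section rate.
Context (R : realType).

Lemma chernoff_rate_lt1 (e : R) : -1 < e -> e != 0 ->
  0 < (1 + e) * expR (- e) < 1.
Proof.
move=> e1 e0; have e10 : 0 < 1 + e by rewrite -ltrBlDl sub0r.
by rewrite mulr_gt0 ?expR_gt0//= expRN ltr_pdivrMr ?expR_gt0// mul1r expR_gt1Dx.
Qed.

Context (psi : nat -> R) (S : R -> R) (m : nat -> R) (gamma G : R).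
Hypothesis psi_gt0 : forall n, 0 < psi n.
Hypothesis m_y : m n @[n --> \oo] --> +oo.
Hypothesis S_m : forall c, 0 < c -> S (c * n%:R) / m n @[n --> \oo] --> c `^ gamma * G.
Hypothesis S_sub : S t / t @[t --> +oo] --> 0.

Lemma ln_le_poisson (e : R) : -1 < e -> e != 0 ->
  (forall n, psi n * (1 - ((1 + e) * expR (- e)) ^+ n) <= expR (S ((1 + e) * n%:R))) ->
  \forall n \near \oo, ln (psi n) <= S ((1 + e) * n%:R) + ln 2.
Proof.
move=> e1 e0 H; have /andP[r0 r1] := chernoff_rate_lt1 e1 e0.
have r_cvg : ((1 + e) * expR (- e)) ^+ n @[n --> \oo] --> 0.
  by apply: cvg_expr; rewrite ger0_norm// ltW.
have h0 : 0 < 2^-1 :> R by rewrite invr_gt0.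
have /cvgr_le/(_ _ h0) Hr := r_cvg.
near=> n; rewrite -ler_expR expRD !lnK ?posrE//.
have rn : ((1 + e) * expR (- e)) ^+ n <= 2^-1 by near: n; exact: Hr.
rewrite -ler_pdivrMr//; apply: le_trans (H n); rewrite ler_pM2l//.
by move: rn; set x := _ ^+ n; lra.
Unshelve. all: by end_near. Qed.

Lemma scaled_sublinear (c : R) : 0 < c -> S (c * n%:R) / n%:R @[n --> \oo] --> 0.
Proof.
move=> c0.
have cy : c * n%:R @[n --> \oo] --> +oo.
  apply/cvgryPge => A; near=> n; rewrite -ler_pdivrMl//.
  by near: n; exact: nbhs_infty_ger.
have : c * (S (c * n%:R) / (c * n%:R)) @[n --> \oo] --> c * 0.
  by apply: cvgM; [exact: cvg_cst|exact: (cvg_comp _ _ cy S_sub)].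
rewrite mulr0; apply: cvg_trans; apply: near_eq_cvg; apply: nearW => n /=.
by rewrite invfM [X in _ * X]mulrCA mulVKf ?gt_eqF.
Unshelve. all: by end_near. Qed.

(** The Chernoff factor decays exponentially in [n], while [S] and [B] are
    sublinear: the error is at most half of the left-hand side. *)
Lemma ln_ge_poisson (e : R) (B : nat -> R) : -1 < e -> e != 0 ->
  B n / n%:R @[n --> \oo] --> 0 ->
  (forall n, expR (S ((1 + e) * n%:R)) <=
    psi n + ((1 + e) * expR (- e)) ^+ n * expR (B n)) ->
  \forall n \near \oo, S ((1 + e) * n%:R) - ln 2 <= ln (psi n).
Proof.
move=> e1 e0 Bn H; have /andP[r0 r1] := chernoff_rate_lt1 e1 e0.
have e10 : 0 < 1 + e by rewrite -ltrBlDl sub0r.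
set r := (1 + e) * expR (- e) in r0 r1 H.
have lr : 0 < - ln r / 2 by rewrite divr_gt0// oppr_gt0 ln_lt0// r0.
have D0 : B n / n%:R - S ((1 + e) * n%:R) / n%:R @[n --> \oo] --> 0 - 0.
  by apply: cvgB => //; exact: scaled_sublinear.
rewrite subr0 in D0.
have /cvgr_le/(_ _ lr) HD := D0.
near=> n.
have n0 : 0 < n%:R :> R by rewrite ltr0n; near: n; exact: nbhs_infty_gt.
have Dn : B n / n%:R - S ((1 + e) * n%:R) / n%:R <= - ln r / 2 by near: n; exact: HD.
rewrite -mulrBl ler_pdivrMr// in Dn.
have ln2 : ln 2 <= n%:R * (- ln r / 2).
  by rewrite -ler_pdivrMr//; near: n; exact: nbhs_infty_ger.
have half : r ^+ n * expR (B n) <= expR (S ((1 + e) * n%:R)) / 2.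
  rewrite -[r]lnK ?posrE// -expRM_natl -expRD.
  rewrite -[X in _ <= _ / X]lnK ?posrE// -expRN -expRD ler_expR.
  have -> : n%:R * ln r = - (n%:R * (- ln r / 2)) - (n%:R * (- ln r / 2)) by field.
  rewrite [leRHS]mulrC in Dn; lra.
rewrite -ler_expR lnK ?posrE// expRD expRN lnK ?posrE//.
have := H n; set E := expR _ in half *; lra.
Unshelve. all: by end_near. Qed.

(** [u e] and [v e] tend to 1 with [e], and [c `^ gamma * G] is continuous in
    [c]. *)
Lemma rate_cvg (u v : R -> R) :
  (forall e, 0 < e < 1 -> 0 < u e /\ `|u e - 1| <= e /\
    \forall n \near \oo, ln (psi n) <= S (u e * n%:R) + ln 2) ->
  (forall e, 0 < e < 1 -> 0 < v e /\ `|v e - 1| <= e /\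
    \forall n \near \oo, S (v e * n%:R) - ln 2 <= ln (psi n)) ->
  ln (psi n) / m n @[n --> \oo] --> G.
Proof.
move=> hu hv.
suff H (d : R) : 0 < d -> \forall n \near \oo, `|ln (psi n) / m n - G| <= d.
  by apply/cvgrPdistC_le => d d0; exact: H.
move=> d0.
have [e e01 He] : exists2 e, 0 < e < 1 & forall c, `|c - 1| <= e ->
    `|c `^ gamma * G - G| <= d / 3.
  have cp := is_derive_continuous (is_derive_powR_fun gamma (@ltr01 R)).
  have d3 : 0 < d / 3 / (`|G| + 1) by rewrite !divr_gt0// ltr_wpDl.
  have /cvgrPdistC_le/(_ _ d3)/nbhs_ballP[r /= r0 Hr] := cp.
  exists (Num.min (1 / 2) (r / 2)).
    by rewrite lt_min gt_min !divr_gt0//= ltr_pdivrMr// mul1r ltr1n.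
  move=> c; rewrite le_min => /andP[_ cr].
  have := Hr c; rewrite /ball/= distrC => /(_ (le_lt_trans cr _)).
  rewrite ltr_pdivrMr// ltr_pMr// ltr1n => /(_ isT) Hc.
  rewrite powR1 in Hc.
  rewrite -[X in _ - X]mul1r -mulrBl normrM.
  apply: (le_trans (ler_wpM2r (normr_ge0 G) Hc)).
  rewrite mulrAC ler_pdivrMr ?ltr_wpDl// ler_wpM2l ?divr_ge0 ?(ltW d0)//.
  by rewrite lerDl.
have [u0 [u1 Hu]] := hu e e01; have [v0 [v1 Hv]] := hv e e01.
have d3 : 0 < d / 3 by rewrite divr_gt0.
have /cvgrPdistC_le/(_ _ d3) Lu := S_m u0.
have /cvgrPdistC_le/(_ _ d3) Lv := S_m v0.
near=> n.
have m0 : 0 < m n by near: n; exact: cvgry_gt.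
have K : ln 2 / m n <= d / 3.
  rewrite ler_pdivrMr// -ler_pdivrMl//.
  by near: n; exact: cvgry_ge.
have A1 : ln (psi n) / m n <= ln 2 / m n + S (u e * n%:R) / m n.
  by rewrite -mulrDl ler_wpM2r ?invr_ge0 ?(ltW m0)// addrC; near: n.
have A2 : S (v e * n%:R) / m n <= ln 2 / m n + ln (psi n) / m n.
  by rewrite -mulrDl ler_wpM2r ?invr_ge0 ?(ltW m0)// -lerBlDl; near: n.
have B1 : `|S (u e * n%:R) / m n - u e `^ gamma * G| <= d / 3 by near: n.
have B2 : `|S (v e * n%:R) / m n - v e `^ gamma * G| <= d / 3 by near: n.
exact: (sandwich_thirds A1 A2 B1 B2 K K (He _ u1) (He _ v1)).
Unshelve. all: by end_near. Qed.

End rate.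

(** * Samples and the atoms that they avoid *)

(** Values are restricted to those below [m], so that expansions over sets of
    values are finite. *)
Definition distinct_below (m : nat) (s : seq nat) : nat := \sum_(i < m) (val i \in s).

Lemma distinct_belowE m s : distinct_below m s = count (fun i => i < m)%N (undup s).
Proof.
rewrite /distinct_below -(big_mkord xpredT (fun i => nat_of_bool (i \in s))).
rewrite -sum1_count -big_mkcond/=.
rewrite -big_filter -[RHS]big_filter /index_iota subn0.
apply: perm_big; apply: uniq_perm; rewrite ?filter_uniq ?iota_uniq ?undup_uniq//.
by move=> i; rewrite !mem_filter mem_iota mem_undup/= add0n andbC.
Qed.

Lemma distinct_below_le m s : (distinct_below m s <= size s)%N.
Proof.
by rewrite distinct_belowE (leq_trans (count_size _ _))// size_undup.
Qed.

Lemma distinct_below_size m s : all (fun i => i < m)%N s ->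
  distinct_below m s = size (undup s).
Proof.
move=> /allP sm; rewrite distinct_belowE; apply/eqP; rewrite -all_count.
by apply/allP => i; rewrite mem_undup; exact: sm.
Qed.

Lemma distinct_below_mono m s x : (distinct_below m s <= distinct_below m (rcons s x))%N.
Proof.
by apply: leq_sum => i _; rewrite mem_rcons inE; case: (_ \in s); rewrite ?orbT// leq0n.
Qed.

Section sample.
Context (d : measure_display) (Omega : measurableType d) (R : realType)
  (P : probability Omega R) (X : nat -> {RV P >-> nat}).

Definition sample (n : nat) (w : Omega) : seq nat := [seq X k w | k <- iota 1 n].

Lemma sampleS n w : sample n.+1 w = rcons (sample n w) (X n.+1 w).
Proof. by rewrite /sample -[n.+1]addn1 iotaD map_cat/= add1n cats1 addn1. Qed.

Lemma size_sample n w : size (sample n w) = n.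
Proof. by rewrite size_map size_iota. Qed.

(** As [nat] is countable, the last draw can be fixed. *)
Lemma measurable_sample n (B : set (seq nat)) : measurable [set w | B (sample n w)].
Proof.
elim: n B => [|n IH] B.
  have [B0|B0] := pselect (B [::]).
    by rewrite (_ : mkset _ = setT)//; apply/seteqP; split.
  by rewrite (_ : mkset _ = set0)//; apply/seteqP; split.
rewrite (_ : mkset _ = \bigcup_(x in [set: nat])
  ((X n.+1 @^-1` [set x]) `&` [set w | B (rcons (sample n w) x)])).
  apply: bigcup_measurable => x _; apply: measurableI.
    by rewrite -[X in measurable X]setTI; exact: measurable_funPT.
  exact: (IH (fun s => B (rcons s x))).
apply/seteqP; split => w /=.
  by rewrite sampleS => Bw; exists (X n.+1 w).
by move=> [x _ [/= <-]]; rewrite sampleS.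
Qed.

Lemma measurable_fun_sample n (f : seq nat -> R) :
  measurable_fun setT (fun w => f (sample n w)).
Proof.
move=> _ B mB; rewrite setTI; exact: (measurable_sample n (fun s => B (f s))).
Qed.

Context (p : probability nat R).
Hypothesis hiid : iid_with_law X p.
Hypothesis hp : decreasing_law p.

Let w (i : nat) : R := mass p i.

Lemma mass_ge0 i : 0 <= w i.
Proof. exact: fine_ge0. Qed.

Lemma massE i : (w i)%:E = p [set i].
Proof. by rewrite fineK// fin_num_measure. Qed.

Lemma mass0 : w 0 = 0.
Proof. by rewrite /w /mass; have [-> _] := hp. Qed.

Lemma law_of_set m (J : {set 'I_m}) :
  p [set x | exists2 i : 'I_m, i \in J & val i = x] = (\sum_(i in J) w i)%:E.
Proof.
rewrite (_ : mkset _ = \big[setU/set0]_(i < m | i \in J) [set val i]); last first.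
  rewrite -bigcup_seq_cond; apply/seteqP; split => x /=.
    by move=> [i iJ <-]; exists i => //=; rewrite mem_index_enum.
  by move=> [i /= /andP[_ iJ] ->]; exists i.
rewrite measure_bigsetU_ord//.
  by rewrite -sumEFin; apply: eq_bigr => i _; rewrite massE.
move=> i j _ _ [x /= [-> /val_inj]]; exact.
Qed.

Lemma mass_sum_le1 m (J : {set 'I_m}) : \sum_(i in J) w i <= 1.
Proof. by rewrite -lee_fin -law_of_set probability_le1. Qed.

Lemma mass_sum n : \sum_(1 <= i < n) w i <= 1.
Proof.
have := mass_sum_le1 [set: 'I_n].
rewrite (eq_bigl xpredT); last by move=> i; rewrite inE.
apply: le_trans; rewrite -(big_mkord xpredT w); case: n => [|n]; first by rewrite !big_geq.
by rewrite [leRHS]big_ltn// mass0 add0r.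
Qed.

Definition avoid m (J : {set 'I_m}) (n : nat) : set Omega :=
  [set x | forall i : 'I_m, i \in J -> val i \notin sample n x].

Lemma measurable_avoid m (J : {set 'I_m}) n : measurable (avoid J n).
Proof.
exact: (measurable_sample n (fun s => forall i : 'I_m, i \in J -> val i \notin s)).
Qed.

Lemma prob_avoid m (J : {set 'I_m}) n :
  P (avoid J n) = ((1 - \sum_(i in J) w i) ^+ n)%:E.
Proof.
have [ind law] := hiid.
pose C := ~` [set x | exists2 i : 'I_m, i \in J & val i = x].
have pC : p C = (1 - \sum_(i in J) w i)%:E.
  by rewrite probability_setC// law_of_set.
pose K := [fset k in iota 1 n]%fset.
rewrite (_ : avoid J n = \bigcap_(k in [set` K]) (X k @^-1` C)); last first.
  apply/seteqP; split => x /=.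
    move=> avx k /=; rewrite in_fset/= => kn [i iJ ixk].
    by have /negP := avx i iJ; apply; apply/mapP; exists k.
  move=> H i iJ; apply/negP => /mapP[k kn ixk].
  by apply: (H k); [rewrite /= in_fset|exists i].
rewrite (ind K (fun=> C)).
- rewrite (eq_big_seq (fun=> (1 - \sum_(i in J) w i)%:E)); last first.
    move=> k; rewrite in_fset/= mem_iota => /andP[k0 _].
    by rewrite -pC -(law k k0).
  rewrite big_const_seq count_predT; set c := 1 - _.
  have -> : size K = n.
    rewrite -[RHS](size_iota 1) -(undup_id (iota_uniq 1 n)).
    by rewrite -[size K]/(#|` K|%fset) card_fseq.
  by elim: (n) => // k IH; rewrite iterS IH exprS EFinM.
- by move=> k /=; rewrite in_fset/= mem_iota => /andP[].
- by [].
Qed.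

End sample.

(** * The moment generating function of the range *)

Section occupancy.
Context (d : measure_display) (Omega : measurableType d) (R : realType)
  (P : probability Omega R) (X : nat -> {RV P >-> nat}) (p : probability nat R).
Hypothesis hiid : iid_with_law X p.
Hypothesis hp : decreasing_law p.
Context (l : R).

Let w (i : nat) : R := mass p i.

Definition occ_mgf (m n : nat) : R :=
  \int[P]_x expR (l * (distinct_below m (sample X n x))%:R).

Definition range_mgf (n : nat) : R :=
  \int[P]_x expR (l * (range_size X n x)%:R).

Lemma prob_Rintegral_cst (c : R) : \int[P]_x cst c x = c.
Proof.
rewrite Rintegral_cst//.
by rewrite (_ : fine _ = 1) ?mulr1// -[1]/(fine 1%:E); congr fine; exact: probability_setT.
Qed.

Lemma expR_distinct_le (k n : nat) : (k <= n)%N -> expR (l * k%:R) <= (1 + expR l) ^+ n.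
Proof.
move=> kn; rewrite mulrC expRM_natl.
apply: (@le_trans _ _ ((1 + expR l) ^+ k)).
  by rewrite lerXn2r ?nnegrE ?addr_ge0 ?expR_ge0// lerDr.
by rewrite ler_eXn2l// ltrDl expR_gt0.
Qed.

Lemma occ_integrable n (f : seq nat -> nat) : (forall s, (f s <= size s)%N) ->
  P.-integrable setT (EFin \o (fun x => expR (l * (f (sample X n x))%:R))).
Proof.
move=> fs; apply: (@le_integrable _ _ _ P setT _ _ (cst ((1 + expR l) ^+ n)%:E)) => //.
- by apply/measurable_EFinP; exact: (@measurable_fun_sample _ _ _ P X n (fun s => expR (l * (f s)%:R))).
- move=> x _; rewrite lee_fin ger0_norm ?expR_ge0// ger0_norm ?exprn_ge0 ?addr_ge0 ?expR_ge0//.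
  by apply: expR_distinct_le; rewrite (leq_trans (fs _))// size_sample.
- exact: finite_measure_integrable_cst.
Qed.

Definition subset_weight m (J : {set 'I_m}) : R :=
  \prod_i (if i \in J then 1 - expR l else expR l).

(** For an indicator [b], [expR (l * b)] is [expR l + (1 - expR l) * (1 - b)];
    the product over the values below [m] is expanded over the subsets [J]. *)
Lemma expR_distinct_expand m (s : seq nat) :
  expR (l * (distinct_below m s)%:R) =
  \sum_(J : {set 'I_m}) subset_weight J *
    (`[< forall i : 'I_m, i \in J -> val i \notin s >])%:R.
Proof.
rewrite /distinct_below natr_sum mulr_sumr expR_sum.
transitivity (\prod_(i < m) ((1 - expR l) * (val i \notin s)%:R + expR l)).
  apply: eq_bigr => i _; case: (_ \in s) => /=.
    by rewrite mulr1 mulr0 add0r.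
  by rewrite mulr0 expR0 mulr1 subrK.
rewrite bigA_distr; apply: eq_big => [J|J _]; first by rewrite inE.
rewrite /subset_weight.
transitivity ((\prod_(i < m) (if i \in J then 1 - expR l else expR l)) *
   \prod_(i < m) (if i \in J then (val i \notin s)%:R else 1)).
  by rewrite -big_split/=; apply: eq_bigr => i _; case: ifP => // _; rewrite mulr1.
congr (_ * _); case: asboolP => H.
  by rewrite big1// => i _; case: ifP => // /H ->.
apply/eqP; rewrite prodf_seq_eq0; apply/hasP.
move/existsNP : H => [i /not_implyP[iJ /negP ins]].
by exists i; rewrite ?mem_index_enum//= iJ (negbTE ins).
Qed.

Lemma occ_mgfE m n : occ_mgf m n =
  \sum_(J : {set 'I_m}) subset_weight J * (1 - \sum_(i in J) w i) ^+ n.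
Proof.
rewrite /occ_mgf /Rintegral.
transitivity (fine (\int[P]_x (\sum_(J : {set 'I_m}) (subset_weight J * \1_(avoid X J n) x)%:E))%E).
  congr fine; apply: eq_integral => x _.
  by rewrite expR_distinct_expand sumEFin; congr EFin; apply: eq_bigr => J _; rewrite indicE.
have iJ (J : {set 'I_m}) : P.-integrable setT (EFin \o (\1_(avoid X J n) : Omega -> R)).
  by apply: integrable_indic => //; exact: measurable_avoid.
rewrite integral_sum//; last first.
  by move=> J; exact: (integrableZl _ (subset_weight J) (iJ J)).
rewrite (_ : (\sum_(J : {set 'I_m}) _)%E = (\sum_(J : {set 'I_m}) subset_weight J * (1 - \sum_(i in J) w i) ^+ n)%:E)//.
rewrite -sumEFin; apply: eq_bigr => J _.
under eq_integral do rewrite EFinM.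
rewrite integralZl//; last exact: iJ.
have mJ : measurable (avoid X J n) by exact: measurable_avoid.
rewrite integral_indic// setIT EFinM; congr (_ * _)%E; exact: (prob_avoid hiid).
Qed.

(** Poissonization: every power in [occ_mgfE] turns into an exponential, and the
    sum over subsets becomes a product again. Probabilistically, the values
    are hit independently when the sample size is Poisson. *)
Lemma occ_mgf_egf m t : 0 <= t -> is_egf (occ_mgf m) t
  (expR t * expR (\sum_(1 <= i < m) ln (emix l (t * w i)))).
Proof.
move=> t0; have w0 i : 0 <= w i by exact: mass_ge0.
rewrite (_ : expR t * _ = \sum_(J : {set 'I_m}) subset_weight J * expR (t * (1 - \sum_(i in J) w i))).
  rewrite (_ : occ_mgf m = fun n => \sum_(J : {set 'I_m}) subset_weight J * (1 - \sum_(i in J) w i) ^+ n).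
    by apply: egf_sum => J; apply: egfZ; exact: egf_pow.
  by apply/funext => n; exact: occ_mgfE.
transitivity (expR t * \prod_(i < m) ((1 - expR l) * expR (- (t * w i)) + expR l)).
  congr (_ * _).
  rewrite -(big_mkord xpredT (fun i => (1 - expR l) * expR (- (t * w i)) + expR l)).
  transitivity (\prod_(0 <= i < m) emix l (t * w i)); last first.
    by apply: eq_bigr => i _; rewrite emixE; ring.
  have e0 : emix l (t * w 0) = 1.
    by rewrite /w (mass0 hp) mulr0 /emix oppr0 expR0 subrr mulr0 addr0.
  rewrite expR_sum; case: m => [|m]; first by rewrite !big_geq.
  rewrite [RHS]big_ltn// e0 mul1r; apply: eq_bigr => i _.
  by rewrite lnK// posrE emix_gt0// mulr_ge0.
rewrite bigA_distr mulr_sumr; apply: eq_big => [J|J _]; first by rewrite inE.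
rewrite mulrBr mulr1 expRD mulrCA; congr (_ * _).
rewrite mulr_sumr -sumrN expR_sum [in RHS]big_mkcond/= /subset_weight -big_split/=.
by apply: eq_bigr => i _; case: ifP => // _; rewrite mulr1.
Qed.

Lemma occ_mgf_ge0 m n : 0 <= occ_mgf m n.
Proof. by apply: Rintegral_ge0 => x _; exact: expR_ge0. Qed.

Lemma occ_mgf_nondecreasing m : 0 <= l -> {homo occ_mgf m : i j / (i <= j)%N >-> i <= j}.
Proof.
move=> l0; apply: homo_leq => [x|x y z|n]; [exact: lexx|exact: le_trans|].
apply: le_Rintegral => //; [exact: occ_integrable (distinct_below_le m)..|].
by move=> x _; rewrite ler_expR ler_wpM2l// ler_nat sampleS distinct_below_mono.
Qed.

Lemma occ_mgf_nonincreasing m : l <= 0 -> {homo occ_mgf m : i j / (i <= j)%N >-> j <= i}.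
Proof.
move=> l0; apply: (@homo_leq _ _ (fun x y => y <= x)) => [x|x y z yx zy|n].
- exact: lexx.
- exact: le_trans zy yx.
- apply: le_Rintegral => //; [exact: occ_integrable (distinct_below_le m)..|].
  by move=> x _; rewrite ler_expR ler_wnM2l// ler_nat sampleS distinct_below_mono.
Qed.

Lemma occ_mgf_le1 m n : l <= 0 -> occ_mgf m n <= 1.
Proof.
move=> l0; apply: (@le_trans _ _ (\int[P]_x (cst 1 x))).
  apply: le_Rintegral => //; first exact: occ_integrable (distinct_below_le m).
    exact: finite_measure_integrable_cst.
  by move=> x _; rewrite -expR0 ler_expR mulr_le0_ge0.
by rewrite prob_Rintegral_cst.
Qed.

Lemma range_mgf_integral n :
  (\int[P]_x (expR (l * (range_size X n x)%:R))%:E = (range_mgf n)%:E)%E.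
Proof.
rewrite /range_mgf /Rintegral fineK//; apply: integrable_fin_num => //.
exact: (occ_integrable n (@size_undup nat)).
Qed.

Lemma occ_mgf_cvg n : occ_mgf m n @[m --> \oo] --> range_mgf n.
Proof.
have : (\int[P]_x (expR (l * (distinct_below m (sample X n x))%:R))%:E)%E @[m --> \oo] -->
    (\int[P]_x (expR (l * (range_size X n x)%:R))%:E)%E.
  apply: (@dominated_cvg _ _ _ P setT _ _ _ (cst ((1 + expR l) ^+ n)%:E)) => //.
  - move=> m; apply/measurable_EFinP.
    exact: (@measurable_fun_sample _ _ _ P X n (fun s => expR (l * (distinct_below m s)%:R))).
  - move=> x _; apply: cvg_near_cst; exists (\sum_(i <- sample X n x) i).+1 => // m /= Hm.
    rewrite distinct_below_size//; apply/allP => i ix.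
    by rewrite (leq_trans _ Hm)// ltnS (big_rem i)//= leq_addr.
  - exact: finite_measure_integrable_cst.
  - move=> m x _; rewrite lee_fin ger0_norm ?expR_ge0//.
    by apply: expR_distinct_le; rewrite (leq_trans (distinct_below_le _ _))// size_sample.
by rewrite range_mgf_integral => /fine_cvg.
Qed.

Lemma range_mgf_gt0 n : 0 < range_mgf n.
Proof.
apply: (@lt_le_trans _ _ (\int[P]_x (cst (expR (- (`|l| * n%:R))) x))).
  by rewrite prob_Rintegral_cst expR_gt0.
apply: le_Rintegral => //.
- exact: finite_measure_integrable_cst.
- exact: (occ_integrable n (@size_undup nat)).
- move=> x _; rewrite ler_expR lerNl -mulNr.
  have : ((range_size X n x)%:R <= n%:R :> R).
    by rewrite ler_nat (leq_trans (size_undup _))// size_sample.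
  move=> rn; apply: (le_trans (ler_wpM2r (ler0n _ _) (ler_norm (- l)))).
  by rewrite normrN ler_wpM2l.
Qed.

Let S (t : R) : R := poisson_cumulant w l t.

Lemma expR_partial_cumulant_cvg t : 0 <= t ->
  expR (\sum_(1 <= i < m) ln (emix l (t * w i))) @[m --> \oo] --> expR (S t).
Proof.
move=> t0; have [_ wd] := hp.
have c := @poisson_cumulant_is_cvg R w wd (mass_sum hp) l t t0.
exact: (continuous_cvg _ (@continuous_expR R _) c).
Qed.

(** The truncation level [m] tends to infinity in the depoissonized inequality;
    so it does in the two lemmas below. *)
Lemma range_mgf_upper (e : R) n : -1 < e -> (0 < e /\ 0 <= l) \/ (e < 0 /\ l <= 0) ->
  range_mgf n * (1 - ((1 + e) * expR (- e)) ^+ n) <= expR (S ((1 + e) * n%:R)).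
Proof.
move=> e1 H; have x0 : 0 < 1 + e by rewrite -ltrBlDl sub0r.
have t0 : 0 <= (1 + e) * n%:R by rewrite mulr_ge0// ltW.
apply: (ler_cvg_to (cvgM (@occ_mgf_cvg n) (cvg_cst _)) (expR_partial_cumulant_cvg t0)).
apply: nearW => m.
apply: (depoissonize_upper (occ_mgf_ge0 m) (@occ_mgf_egf m)) => //.
by case: H => -[? ?]; [left|right]; split => //; [exact: occ_mgf_nondecreasing|exact: occ_mgf_nonincreasing].
Qed.

Lemma range_mgf_lower_nd (e : R) n : -1 < e < 0 -> 0 <= l ->
  expR (S ((1 + e) * n%:R)) <=
    range_mgf n + ((1 + e) * expR (- e)) ^+ n * expR (S n%:R).
Proof.
move=> /andP[e1 e0] l0; have x0 : 0 < 1 + e by rewrite -ltrBlDl sub0r.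
have t0 : 0 <= (1 + e) * n%:R by rewrite mulr_ge0// ltW.
have L : occ_mgf m n + ((1 + e) * expR (- e)) ^+ n *
      expR (\sum_(1 <= i < m) ln (emix l (n%:R * w i))) @[m --> \oo] -->
    range_mgf n + ((1 + e) * expR (- e)) ^+ n * expR (S n%:R).
  apply: cvgD; first exact: occ_mgf_cvg.
  by apply: cvgM; [exact: cvg_cst|exact: expR_partial_cumulant_cvg].
apply: (ler_cvg_to (expR_partial_cumulant_cvg t0) L).
apply: nearW => m.
exact: (depoissonize_lower_nd (occ_mgf_ge0 m) (@occ_mgf_egf m) n e1 e0 (@occ_mgf_nondecreasing m l0)).
Qed.

Lemma range_mgf_lower_ni (e : R) n : 0 < e -> l <= 0 ->
  expR (S ((1 + e) * n%:R)) <=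
    range_mgf n + ((1 + e) * expR (- e)) ^+ n * expR 0.
Proof.
move=> e0 l0; have x0 : 0 < 1 + e by rewrite addr_gt0.
have t0 : 0 <= (1 + e) * n%:R by rewrite mulr_ge0// ltW.
rewrite expR0 mulr1.
have L : occ_mgf m n + ((1 + e) * expR (- e)) ^+ n @[m --> \oo] -->
    range_mgf n + ((1 + e) * expR (- e)) ^+ n.
  by apply: cvgD; [exact: occ_mgf_cvg|exact: cvg_cst].
apply: (ler_cvg_to (expR_partial_cumulant_cvg t0) L).
apply: nearW => m.
exact: (depoissonize_lower_ni (occ_mgf_ge0 m) (@occ_mgf_egf m) n e0
  (fun n => occ_mgf_le1 m n l0) (@occ_mgf_nonincreasing m l0)).
Qed.

End occupancy.

(** * The large deviation principle *)

Section range_ldp.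
Context (d : measure_display) (Omega : measurableType d) (R : realType)
  (P : probability Omega R) (X : nat -> {RV P >-> nat}) (p : probability nat R).
Hypothesis hiid : iid_with_law X p.
Hypothesis hp : decreasing_law p.
Context (gamma : R).
Hypothesis gamma01 : 0 < gamma < 1.
Hypothesis hreg : regular_law gamma p.

Let w (i : nat) : R := mass p i.

Lemma mu_cvgy : mu p n%:R @[n --> \oo] --> +oo.
Proof.
have [zeta [zinv [zr zi wz]]] := hreg.
exact: (@mean_range_cvgy R w hp.2 (mass_sum hp) gamma zeta zinv gamma01 zr zi wz).
Qed.

(** The sign of [l] is that of the monotonicity of [range_mgf], and it decides
    on which side of [n] the Poisson parameter is taken for each bound. *)
Lemma ln_range_mgf_cvg l :
  ln (range_mgf X l n) / mu p n%:R @[n --> \oo] --> Lambda gamma l + l.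
Proof.
have [zeta [zinv [zr zi wz]]] := hreg.
have ratio c : 0 < c -> poisson_cumulant w l (c * n%:R) / mu p n%:R @[n --> \oo] -->
    c `^ gamma * (Lambda gamma l + l).
  exact: (@cumulant_ratio R w hp.2 (mass_sum hp) gamma zeta zinv gamma01 zr zi wz l c).
have sub := @poisson_cumulant_sublinear R w hp.2 (mass_sum hp) l.
have subn : poisson_cumulant w l n%:R / n%:R @[n --> \oo] --> 0.
  by have := scaled_sublinear sub (@ltr01 R); under eq_fun do rewrite mul1r.
have g0 := range_mgf_gt0 X l.
have plus (e : R) : 0 < e < 1 -> 0 < 1 + e /\ `|1 + e - 1| <= e.
  by move=> /andP[e0 _]; rewrite addr_gt0// addrC addKr gtr0_norm.
have minus (e : R) : 0 < e < 1 -> 0 < 1 - e /\ `|1 - e - 1| <= e.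
  by move=> /andP[e0 e1]; rewrite subr_gt0 e1 addrC addKr normrN gtr0_norm.
have [l0|/ltW l0] := leP 0 l.
- apply: (@rate_cvg R (range_mgf X l) _ _ gamma _ mu_cvgy ratio (fun e => 1 + e) (fun e => 1 - e)).
    move=> e e01; have [? ?] := plus e e01; have /andP[e0 e1] := e01; split=> //; split=> //.
    have em : -1 < e by rewrite (lt_trans _ e0)// ltrN10.
    apply: (ln_le_poisson g0 em) => [|n]; first by rewrite gt_eqF.
    by apply: (range_mgf_upper hiid hp) => //; left.
  move=> e e01; have [? ?] := minus e e01; have /andP[e0 e1] := e01; split=> //; split=> //.
  have em : -1 < - e by rewrite ltrN2.
  apply: (ln_ge_poisson g0 sub em _ subn) => [|n]; first by rewrite oppr_eq0 gt_eqF.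
  by apply: (range_mgf_lower_nd hiid hp) => //; rewrite em oppr_lt0.
- apply: (@rate_cvg R (range_mgf X l) _ _ gamma _ mu_cvgy ratio (fun e => 1 - e) (fun e => 1 + e)).
    move=> e e01; have [? ?] := minus e e01; have /andP[e0 e1] := e01; split=> //; split=> //.
    have em : -1 < - e by rewrite ltrN2.
    apply: (ln_le_poisson g0 em) => [|n]; first by rewrite oppr_eq0 gt_eqF.
    by apply: (range_mgf_upper hiid hp) => //; right; rewrite oppr_lt0.
  move=> e e01; have [? ?] := plus e e01; have /andP[e0 e1] := e01; split=> //; split=> //.
  have em : -1 < e by rewrite (lt_trans _ e0)// ltrN10.
  apply: (@ln_ge_poisson R (range_mgf X l) _ g0 sub e (fun=> 0) em).
  + by rewrite gt_eqF.
  + by under eq_fun do rewrite mul0r; exact: cvg_cst.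
  + by move=> n; exact: (range_mgf_lower_ni hiid hp).
Qed.

Lemma mu_gt0 t : 0 < t -> 0 < mu p t.
Proof. exact: (@mean_range_gt0 R w hp.2 (mass_sum hp)). Qed.

Definition Y_mgf (n : nat) (l : R) : R := range_mgf X l n * expR (- l * mu p n%:R).

Lemma Y_mgf_gt0 n l : 0 < Y_mgf n l.
Proof. by rewrite mulr_gt0 ?expR_gt0// range_mgf_gt0. Qed.

Lemma measurable_Y n : measurable_fun setT (Y X p n).
Proof.
exact: (@measurable_fun_sample _ _ _ P X n
  (fun s => ((size (undup s))%:R - mu p n%:R) / mu p n%:R)).
Qed.

Lemma Y_mgfE n l :
  (\int[P]_x (expR (l * mu p n%:R * Y X p n x))%:E = (Y_mgf n l)%:E)%E.
Proof.
have muY x : mu p n%:R * Y X p n x = (range_size X n x)%:R - mu p n%:R.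
  (* The mean vanishes only for the empty sample, where the range is empty. *)
  rewrite /Y; have [m0|m0] := eqVneq (mu p n%:R) 0; last by rewrite mulrC divfK.
  case: n m0 => [|n] m0; first by rewrite m0 mul0r subr0.
  by have := mu_gt0 (ltr0Sn R n); rewrite m0 ltxx.
under eq_integral do rewrite -mulrA muY mulrBr expRD EFinM muleC -mulNr.
rewrite integralZl//; last first.
  exact: (occ_integrable X l n (@size_undup nat)).
by rewrite range_mgf_integral -EFinM mulrC.
Qed.

Lemma ln_Y_mgf_cvg l : ln (Y_mgf n l) / mu p n%:R @[n --> \oo] --> Lambda gamma l.
Proof.
have L : ln (range_mgf X l n) / mu p n%:R - l @[n --> \oo] --> Lambda gamma l.
  rewrite -[X in _ --> X](addrK l).
  by apply: cvgB; [exact: ln_range_mgf_cvg|exact: cvg_cst].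
apply: cvg_trans L; apply: near_eq_cvg; near=> n => /=.
have m0 : 0 < mu p n%:R by near: n; exact: (cvgry_gt mu_cvgy).
rewrite /Y_mgf lnM ?posrE ?expR_gt0 ?range_mgf_gt0// expRK mulrDl mulNr mulNr mulfK//.
by rewrite gt_eqF.
Unshelve. all: by end_near. Qed.

End range_ldp.

Theorem theorem1p3 (R : realType) (d : measure_display)
    (Omega : measurableType d) (P : probability Omega R)
    (p : probability nat R) (xi : nat -> {RV P >-> nat}) (gamma : R)
    (hp : decreasing_law p) (hxi : iid_with_law xi p)
    (hgamma : 0 < gamma < 1) (hreg : regular_law gamma p) :
  [/\ (* Lambda is a well-defined smooth function on the real line *)
      forall lambda : R, (@lebesgue_measure R).-integrable `]0, +oo[
        (fun s => (Lambda_integrand gamma lambda s)%:E),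
      smooth (Lambda gamma),
      (* large deviation principle *)
      forall B : set R, measurable B ->
        let a := fun n : nat =>
          ((mu p n%:R)^-1%:E * lne (P [set w | B (Y xi p n w)]))%E in
        [/\ (- ereal_inf [set fenchel_legendre (Lambda gamma) x
                         | x in interior B] <= limn_einf a)%E,
            (limn_einf a <= limn_esup a)%E &
            (limn_esup a <= - ereal_inf [set fenchel_legendre (Lambda gamma) x
                                        | x in closure B])%E] &
      (* series expansion *)
      forall lambda : R, lambda < ln 2 ->
        - lambda + \sum_(1 <= n < N.+1)
          (1 - expR lambda) ^+ n *
          \sum_(1 <= k < n.+1)
             (-1) ^+ k / k%:R `^ (1 - gamma) * 'C(n.-1, k.-1)%:R
        @[N --> \oo] --> Lambda gamma lambda].
Proof.
split.
- by move=> l; have [] := ln_emix_parts hgamma l.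
- exact: smooth_Lambda.
- move=> B mB a; rewrite {}/a; split.
  + exact: (ldp_lower (measurable_Y xi p) (mu_cvgy hp hgamma hreg) (Y_mgf_gt0 xi p)
      (Y_mgfE xi hp) (@ln_Y_mgf_cvg _ _ _ _ _ _ hxi hp _ hgamma hreg)
      (Lambda_ge0 hgamma) (Lambda0 hgamma)
      (derivable_Lambda hgamma) (ltrN10 R) (Lambda_le_linear hgamma)
      (derive1_Lambda_onto hgamma) mB).
  + exact: limn_einf_sup.
  + exact: (ldp_upper (measurable_Y xi p) (mu_cvgy hp hgamma hreg) (Y_mgf_gt0 xi p)
      (Y_mgfE xi hp) (@ln_Y_mgf_cvg _ _ _ _ _ _ hxi hp _ hgamma hreg)
      (Lambda_ge0 hgamma) mB).
- by move=> l l2; exact: Lambda_series.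
Qed.
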